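(* Given $\hat z\in\Sigma$ and a measurable $\Gamma\subset\Sigma$, let $$\alpha=\inf\Big\{\frac{g(z,z')}{g(z,\hat z)}:\ z\in\Sigma,\ z'\in\Gamma,\ g(z,\hat z)>0\Big\},\qquad N(\Gamma)=\#\{k\le T_\Delta:\ z_k\in\Gamma\},\qquad \ell\ge\sup_{z'\in\Sigma}g(z',\hat z).$$ Then, for any $v\ge2$, $$\mathbb{Q}[G_{T_\Delta}(\hat z)\ge v\ell]\le\mathbb{Q}[G_{T_\Delta}(\hat z)\ge\ell]\Big(\exp\big\{-\big(\tfrac v2-1\big)\big\}+\sup_{z'\in\Sigma}\mathbb{Q}_{z'}\big[\eta\big(\Gamma\times[0,\tfrac12v\ell\alpha]\big)\le N(\Gamma)\big]\Big).$$
   Context: $\Sigma$ is a locally compact Polish metric space with Borel $\sigma$-algebra, $\mu$ a Radon measure, and $g:\Sigma\times\Sigma\to\mathbb{R}_+$ is measurable in each coordinate with $\int g(z,z')\mu(dz')=1$ for all $z$. $\Sigma$ contains a cemetery state $\Delta$: $\mu(\{\Delta\})=1$ and $g(\Delta,\cdot)=1_{\{\Delta\}}(\cdot)$. Soft local time: $\eta=\sum_{\lambda\in\Lambda}\delta_{(z_\lambda,v_\lambda)}$ is a Poisson point process on $\Sigma\times\mathbb{R}_+$ with intensity $\mu\otimes dv$. Given an initial state $z_0\in\Sigma$ and $G_0\equiv0$, define iteratively for $n\ge1$ (almost surely): $\xi_n=\inf\{t\ge0:\exists(z_\lambda,v_\lambda)\notin\{(z_k,v_k)\}_{k=1}^{n-1}\text{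 with }G_{n-1}(z_\lambda)+t\,g(z_{n-1},z_\lambda)\ge v_\lambda\}$; $G_n(z)=G_{n-1}(z)+\xi_n g(z_{n-1},z)$; $(z_n,v_n)$ is the unique pair $(z_\lambda,v_\lambda)\notin\{(z_k,v_k)\}_{k=1}^{n-1}$ with $G_n(z_\lambda)=v_\lambda$. Then $(z_n)_{n\ge1}$ is a Markov chain with transition density $g$ and $z_1$ has density $g(z_0,\cdot)$. $T_\Delta$ is the hitting time of $\Delta$ by $(z_n)_{n\ge1}$. $\mathbb{Q}_{z'}$ denotes the law of this construction with $z_0=z'$, and $\mathbb{Q}$ the law with a fixed arbitrary initial state $z_0=Z_0\in\Sigma$.
   Formalization: The density g is assumed jointly Borel measurable on Σ×Σ rather than only measurable in each coordinate; with separate measurability alone the transition kernel and the probabilities in the inequality can be undefined (Sierpinski-type example under CH). *)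

(* Defs.v *)
From HB Require Import structures.
From mathcomp Require Import all_boot all_order all_algebra.
From mathcomp Require Import all_classical all_reals all_analysis measurable_realfun.

Set Implicit Arguments.
Unset Strict Implicit.
Unset Printing Implicit Defensive.

Import Order.TTheory GRing.Theory Num.Theory.
Import numFieldNormedType.Exports.

Local Open Scope classical_set_scope.
Local Open Scope ring_scope.

#[short(type="completePMetricType")]
HB.structure Definition CompletePMetric (R : realType) :=
  {T of Metric R T & Complete T & Pointed T}.

Definition separable (T : topologicalType) : Prop :=
  exists2 D : set T, countable D & dense D.

Notation borel S := (g_sigma_algebraType (@open S)).

(* On a locally compact Polish space, inner and outer regularity follow from
   finiteness on compact sets. *)
Definition radon (R : realType) (S : completePMetricType R)
    (mu : {measure set (borel S) -> \bar R}) : Prop :=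
  forall K : set S, compact K -> (mu K < +oo)%E.

Section poisson_point_process.
Local Open Scope ereal_scope.
Context {R : realType}.

Definition point_measure {d} {T : measurableType d} (x : nat -> T) :
    set T -> \bar R :=
  mseries (fun i => \d_(x i)) 0.

Context {d} {Omega : measurableType d} (P : probability Omega R).

Definition counts_independent {dT} {T : measurableType dT}
    (X : nat -> Omega -> T) : Prop :=
  forall (n : nat) (A : 'I_n -> set T) (B : 'I_n -> set (\bar R)),
    (forall i, measurable (A i)) -> trivIset setT A ->
    (forall i, measurable (B i)) ->
    P [set w | forall i, B i (point_measure (X ^~ w) (A i))] =
    \prod_(i < n) P [set w | B i (point_measure (X ^~ w) (A i))].

(* The atoms of the process are enumerated by random points X i; this assumes
   infinitely many atoms, hence is only meant for an intensity of infinite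
   total mass.  The second argument of poisson_prob is unused. *)
Definition poisson_point_process {dT} {T : measurableType dT}
    (nu : set T -> \bar R) (X : nat -> Omega -> T) : Prop :=
  [/\ forall i, measurable_fun [set: Omega] (X i),
      forall A, measurable A -> nu A < +oo -> forall k : nat,
        P [set w | point_measure (X ^~ w) A = k%:R%:E] =
        poisson_prob (fine (nu A)) k [set k],
      forall A, measurable A -> nu A = +oo ->
        P [set w | point_measure (X ^~ w) A = +oo] = 1
    & counts_independent X].

End poisson_point_process.

(* The second factor of the intensity is Lebesgue measure on the half-line
   R_+, seen as a measure on R. *)
Definition slt_intensity (R : realType) (S : completePMetricType R)
    (mu : {measure set (borel S) -> \bar R}) : set (borel S * R) -> \bar R :=
  (mu \x mrestr lebesgue_measure (measurable_itv `[0%R, +oo[))%E.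

Section soft_local_time.
Context {R : realType} {T : choiceType}.
Variables (g : T -> T -> R) (E : set (T * R)) (z0 : T).

(* State after n steps: G_n, the point (z_n, v_n), and the set of the points
   (z_k, v_k) with 1 <= k <= n. *)
Record slt_state := SltState {
  slt_fun : T -> R ;
  slt_point : T * R ;
  slt_used : set (T * R) }.

Definition slt_incr (s : slt_state) : R :=
  inf [set t | 0 <= t /\ exists2 p, (E `\` slt_used s) p &
    p.2 <= slt_fun s p.1 + t * g (slt_point s).1 p.1].

(* The recursion is only well defined almost surely: inf is 0 on the empty set,
   and the chain stays where it is when there is no unique next point. *)
Definition slt_step (s : slt_state) : slt_state :=
  let G := fun z => slt_fun s z + slt_incr s * g (slt_point s).1 z in
  let p := xget (slt_point s)
    [set p | unique (fun q => (E `\` slt_used s) q /\ G q.1 = q.2) p] in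
  SltState G p (p |` slt_used s).

(* The initial height 0 is a dummy: (z0, 0) is not a point of the process. *)
Definition slt (n : nat) : slt_state :=
  iter n slt_step (SltState (fun=> 0) (z0, 0) set0).

Definition slt_chain (n : nat) : T := (slt_point (slt n)).1.

Definition soft_local_time (n : nat) (z : T) : R := slt_fun (slt n) z.

Variable Delta : T.

(* None stands for an infinite hitting time. *)
Definition hitting_time : option nat :=
  if pselect (exists n, (0 < n)%N && (slt_chain n == Delta)) is left h
  then Some (ex_minn h) else None.

Definition until_hitting (k : nat) : Prop :=
  if hitting_time is Some n then (k <= n)%N else True.

Definition soft_local_time_hit (z : T) : \bar R :=
  if hitting_time is Some n then (soft_local_time n z)%:E
  else limn (fun n => (soft_local_time n z)%:E).

(* Time 0 is not counted: z0 does not come from a point of the process. *)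
Definition visits (Gamma : set T) : \bar R :=
  counting [set k | (0 < k)%N /\ until_hitting k /\ Gamma (slt_chain k)].

End soft_local_time.

Definition min_ratio (R : realType) (T : Type) (g : T -> T -> R) (zhat : T)
    (Gamma : set T) : \bar R :=
  ereal_inf [set a | exists z z',
    [/\ Gamma z', 0 < g z zhat & a = (g z z' / g z zhat)%:E]].

(* Main.v *)
Require Import Defs.
From HB Require Import structures.
From mathcomp Require Import all_boot all_order all_algebra.
From mathcomp Require Import all_classical all_reals all_analysis measurable_realfun.
From mathcomp Require Import ring lra.

(** Let tau be the waiting time of the next atom, and G_n the local time after
    n steps. The bound is a first-passage argument for the height G_n(zhat),
    which grows by tau g(z_n, zhat) at each step.

    The Markov property. After n steps, delete the used atoms and lower the
    others by G_n. What remains is a Poisson process of the same intensity,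
    independent of the past. In it the atom (x, v) rings at time
    v / g(z_n, x), and the next point of the chain is the first to ring. The
    region under t g(z, .) has measure t because g(z, .) is a density; hence
    tau is exponential of parameter 1, and once the region under the first
    ring is removed, the atoms above it are as fresh as before. This is
    [poisson_given_step]; [poisson_given_slt] iterates it along the
    construction. It is obtained from void probabilities alone: [campbell]
    computes the mean number of isolated points by cutting the space into
    small cells, [freezing] lets the void region depend on an independent
    variable, and [slivnyak] combines them, the void region being allowed to
    depend on the isolated point itself.

    The recursion. The triple formed by the chain, the height still missing at
    zhat and the fact that Delta has been visited is therefore a Markov chain
    with an explicit kernel, and the probability that G at time n or T_Delta,
    whichever comes first, reaches s is given by the recursion [exceed]; see
    [integral_exceed].

    The inequality. To gain h + (v - 1) l one first has to gain h. At the step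
    that passes h, either the overshoot exceeds (v/2 - 1) l, which by lack of
    memory and g(., zhat) <= l has probability at most exp(-(v/2 - 1)), or a
    height of at least v l / 2 is still to be gained from the new position.
    So the price of the extra (v - 1) l is the factor exp(-(v/2 - 1)) + c,
    where c bounds the probability of ever gaining v l / 2; the induction on
    the number of steps is [exceed_contract].

    The constant c. If G(zhat) >= v l / 2 then G >= alpha v l / 2 on Gamma by
    definition of alpha, and every atom under the graph of G has been used:
    the atoms of the strip are distinct points of the chain lying in Gamma,
    visited before T_Delta. Hence there are at most N(Gamma) of them
    ([strip_le_visits]), so c can be taken to be the supremum in the theorem.

    Letting the number of steps tend to infinity and h tend to l gives
    [local_time_tail], of which the theorem is an instance. *)

Set Implicit Arguments.
Unset Strict Implicit.
Unset Printing Implicit Defensive.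

Import Order.TTheory GRing.Theory Num.Theory.
Import numFieldNormedType.Exports.

Local Open Scope classical_set_scope.
Local Open Scope ring_scope.

(** * Exponentials of minus a measure, void events *)
Section expeRN.
Local Open Scope ereal_scope.
Context {R : realType}.

Lemma expeRN_le1 (x : \bar R) : 0 <= x -> expeR (- x) <= 1.
Proof. by move=> x0; rewrite -(@expeR0 R) lee_expeR oppe_le0. Qed.

Lemma expeRN_fin_num (x : \bar R) : 0 <= x -> expeR (- x) \is a fin_num.
Proof. by move=> x0; rewrite ge0_fin_numE ?expeR_ge0// (le_lt_trans (expeRN_le1 x0)) ?ltry. Qed.

Lemma cvg_expeRN (u : (\bar R)^nat) (l : R) :
  u @ \oo --> l%:E -> expeR (- u n) @[n --> \oo] --> expeR (- l%:E).
Proof.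
move=> ul.
have ufin : \forall n \near \oo, u n \is a fin_num.
  by have /fine_cvgP[] := ul.
have /fine_cvgP[_ ul'] := ul.
apply: (@cvg_trans _ ((expR (- fine (u n)))%:E @[n --> \oo])).
  apply: near_eq_cvg; near=> n; rewrite /=.
  have un : u n \is a fin_num by near: n.
  by rewrite -[X in _ = expeR (- X)](fineK un).
apply: cvg_EFin; first by near=> n.
apply: (@cvg_comp _ _ _ (fun n => (- fine (u n))%R) expR _ (nbhs (- l)%R)).
  by apply: cvgN.
exact: continuous_expR.
Unshelve. all: by end_near. Qed.

Lemma measurable_expeR d (T : measurableType d) (f : T -> \bar R) :
  measurable_fun setT f -> measurable_fun setT (expeR \o f).
Proof.
move=> mf.
have -> : expeR \o f = fun x => if f x == +oo then +oo else
    if f x == -oo then 0 else (expR (fine (f x)))%:E.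
  by apply/funext => x /=; case: (f x).
apply: measurable_fun_ifT => //; first exact: measurable_fun_eqe.
apply: measurable_fun_ifT => //; first exact: measurable_fun_eqe.
apply/measurable_EFinP; apply: measurableT_comp => //.
exact: measurableT_comp.
Qed.

End expeRN.

Section avoid.
Context {O T P : Type}.

(** The void event of the section of A at Y: this is how a random region meets
    the points. *)
Definition avoid (Y : O -> T) (X : nat -> O -> P) (A : set (T * P)) : set O :=
  [set w | forall j, ~ A (Y w, X j w)].

Lemma avoidS Y X A B : A `<=` B -> avoid Y X B `<=` avoid Y X A.
Proof. by move=> AB w h j /AB; exact: h. Qed.

End avoid.

Lemma measurable_avoid d d' d'' (O : measurableType d) (T : measurableType d')
  (P : measurableType d'') (Y : O -> T) (X : nat -> O -> P) (A : set (T * P)) :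
  measurable_fun setT Y -> (forall j, measurable_fun setT (X j)) ->
  measurable A -> measurable (avoid Y X A).
Proof.
move=> mY mX mA.
have -> : avoid Y X A = \bigcap_j ((fun w => (Y w, X j w)) @^-1` (~` A)).
  by apply/seteqP; split=> w /= h j; [move=> _|]; exact: h.
apply: bigcapT_measurable => j; rewrite -[X in measurable X]setTI.
by apply: measurable_fun_pair => //; exact: measurableC.
Qed.

(** * Void probabilities of independent random sets *)
Section freezing.
Local Open Scope ereal_scope.
Context {R : realType} {dO dT dP} {O : measurableType dO}
  {T : measurableType dT} {P : measurableType dP}.
Variables (M : {measure set O -> \bar R})
  (nu : {sigma_finite_measure set P -> \bar R}).
Variables (Y : O -> T) (X : nat -> O -> P) (B0 : set T) (F : set P).
Hypotheses (mY : measurable_fun setT Y)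
  (mX : forall j, measurable_fun setT (X j)).
Hypotheses (mB0 : measurable B0) (mF : measurable F)
  (MB0 : M (Y @^-1` B0) < +oo) (nuF : nu F < +oo).
Hypothesis finF : {ae M, forall w, B0 (Y w) -> finite_set [set j | F (X j w)]}.
Hypothesis fixed : forall B A, measurable B -> B `<=` B0 ->
  measurable A -> A `<=` F ->
  M (Y @^-1` B `&` avoid Y X (setT `*` A)) = M (Y @^-1` B) * expeR (- nu A).

Let boxed (A : set (T * P)) := A `&` (setT `*` F).

Let frozen (A : set (T * P)) := measurable A /\
  forall B, measurable B -> B `<=` B0 ->
  M (Y @^-1` B `&` avoid Y X (boxed A)) =
  \int[M]_(w in Y @^-1` B) expeR (- nu (xsection (boxed A) (Y w))).

Let stepped (A : set (T * P)) := exists c : T -> nat, exists C : nat -> set P,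
  [/\ measurable_fun setT c, forall k, measurable (C k) &
      A = [set p | C (c p.1) p.2]].

Let mpre B : measurable B -> measurable (Y @^-1` B).
Proof. by move=> mB; rewrite -[X in measurable X]setTI; exact: mY. Qed.

Let mboxed A : measurable A -> measurable (boxed A).
Proof. by move=> mA; apply: measurableI => //; exact: measurableX. Qed.

Let mstepped A : stepped A -> measurable A.
Proof.
move=> [c [C [mc mC ->]]].
have -> : [set p : T * P | C (c p.1) p.2] =
    \bigcup_k ((c @^-1` [set k]) `*` C k).
  apply/seteqP; split=> [[y q]/= h|[y q] [k _ [/= <-]]//].
  by exists (c y).
apply: bigcupT_measurable => k; apply: measurableX => //.
by rewrite -[X in measurable X]setTI; exact: mc.
Qed.

Let stepped_frozen : stepped `<=` frozen.
Proof.
move=> A sA; split; first exact: mstepped.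
move: (sA) => [c [C [mc mC AE]]] B mB BB0.
pose D k := Y @^-1` (B `&` c @^-1` [set k]).
have mc1 k : measurable (c @^-1` [set k]).
  by rewrite -[X in measurable X]setTI; exact: mc.
have mD k : measurable (D k) by apply: mpre; exact: measurableI.
have tD : trivIset setT D.
  apply/trivIsetP => i j _ _ ij; apply/seteqP; split=> // w [[_ /= ci] [_ /= cj]].
  by move: ij; rewrite -ci -cj eqxx.
have BE : Y @^-1` B = \bigcup_k D k.
  by apply/seteqP; split=> [w Bw|w [k _ []]//]; exists (c (Y w)).
have mav : measurable (avoid Y X (boxed A)).
  exact: (measurable_avoid mY mX (mboxed (mstepped sA))).
rewrite BE setI_bigcupl measure_semi_bigcup//; last 3 first.
- by move=> i; exact: measurableI.
- exact: trivIset_setIr.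
- by apply: bigcupT_measurable => i; exact: measurableI.
rewrite ge0_integral_bigcup//; last 2 first.
- apply: measurable_funTS; apply: (@measurable_expeR _ _ _ (fun w => - nu (xsection (boxed A) (Y w)))).
  apply: measurableT_comp => //.
  by apply: (measurableT_comp (measurable_fun_xsection _ (mboxed (mstepped sA)))).
- by move=> *; exact: expeR_ge0.
apply: eq_eseriesr => k _.
have xk w : D k w -> xsection (boxed A) (Y w) = C k `&` F.
  move=> [_ /= ck]; apply/seteqP; split=> q; rewrite /xsection/= inE /boxed AE /= ck.
    by move=> [? [_ ?]].
  by move=> [? ?].
transitivity (M (D k `&` avoid Y X (setT `*` (C k `&` F)))).
  congr (M _); apply/seteqP; split=> w [Dw h]; split=> // j; have [_ /= ck] := Dw.
    by move=> [_ /= [Cj Fj]]; apply: (h j); rewrite /boxed AE /=; split; rewrite /= ?ck.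
  by rewrite /boxed AE => -[/=]; rewrite ck => Cj [_ Fj]; apply: (h j).
rewrite fixed//; last 3 first.
- exact: measurableI.
- by move=> y [/BB0].
- exact: measurableI.
rewrite (eq_integral (fun=> expeR (- nu (C k `&` F)))); last by move=> w /set_mem/xk ->.
have nuC : nu (C k `&` F) \is a fin_num.
  by rewrite ge0_fin_numE// (le_lt_trans _ nuF)// le_measure ?inE//; apply: measurableI.
rewrite -(fineK nuC) /= integral_cst//.
by rewrite muleC.
Qed.

Let stepped_setring : setring stepped.
Proof.
have key A B (op : Prop -> Prop -> Prop) : stepped A -> stepped B ->
    (forall C D, measurable C -> measurable D ->
       measurable [set q : P | op (C q) (D q)]) ->
    stepped [set p | op (A p) (B p)].
  move=> [c [C [mc mC ->]]] [e [E [me mE ->]]] mop.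
  exists (fun y => pickle (c y, e y)).
  exists (fun k => if unpickle k is Some (i, j) then
    [set q | op (C i q) (E j q)] else set0); split.
  - have mce : measurable_fun setT (fun y => (c y, e y)) by exact: measurable_fun_pair.
    move=> _ /= Z _; rewrite setTI.
    have -> : (fun y => pickle (c y, e y)) @^-1` Z =
       \bigcup_i \bigcup_j ([set y | Z (pickle (i, j))] `&` (c @^-1` [set i] `&` e @^-1` [set j])).
      apply/seteqP; split=> [y /= Zy|y [i _ [j _ [/= Zy [/= ci ej]]]]]; last by rewrite ci ej.
      by exists (c y) => //; exists (e y).
    apply: bigcupT_measurable => i; apply: bigcupT_measurable => j.
    apply: measurableI; last by apply: measurableI; rewrite -[X in measurable X]setTI; [exact: mc|exact: me].
    have [h|h] := pselect (Z (pickle (i, j))).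
      by rewrite (_ : [set _ | _] = setT)//; apply/seteqP; split.
    by rewrite (_ : [set _ | _] = set0)//; apply/seteqP; split.
  - by move=> k; case: unpickle => [[i j]|//]; exact: mop.
  - by apply/seteqP; split=> -[y q] /=; rewrite pickleK.
split.
- by exists (fun=> 0%N), (fun=> set0); split => //; apply/seteqP; split.
- by move=> A B sA sB; apply: (key A B or) => // C D mC mD; exact: measurableU.
- by move=> A B sA sB; apply: (key A B (fun a b => a /\ ~ b)) => // C D mC mD; exact: measurableD.
Qed.

Let mfrozen A B : measurable A -> measurable B ->
  measurable (Y @^-1` B `&` avoid Y X (boxed A)).
Proof. by move=> mA mB; apply: measurableI; [exact: mpre|exact: (measurable_avoid mY mX (mboxed mA))]. Qed.

Let nu_boxed A (y : T) : measurable A -> nu (xsection (boxed A) y) \is a fin_num.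
Proof.
move=> mA; rewrite ge0_fin_numE// (le_lt_trans _ nuF)// le_measure ?inE//.
  exact: (measurable_xsection _ (mboxed mA)).
by move=> q; rewrite /xsection/= inE => -[_ []].
Qed.

Let measurable_void A : measurable A ->
  measurable_fun setT (fun w => expeR (- nu (xsection (boxed A) (Y w)))).
Proof.
move=> mA; apply: (@measurable_expeR _ _ _ (fun w => - nu (xsection (boxed A) (Y w)))).
apply: measurableT_comp => //.
by apply: (measurableT_comp (measurable_fun_xsection _ (mboxed mA))).
Qed.

Let cvg_frozen (A : nat -> set (T * P)) (L : set (T * P)) B :
  measurable B -> B `<=` B0 -> (forall n, measurable (A n)) -> measurable L ->
  (forall y, nu (xsection (boxed (A n)) y) @[n --> \oo] --> nu (xsection (boxed L) y)) ->
  \int[M]_(w in Y @^-1` B) expeR (- nu (xsection (boxed (A n)) (Y w))) @[n --> \oo]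
  --> \int[M]_(w in Y @^-1` B) expeR (- nu (xsection (boxed L) (Y w))).
Proof.
move=> mB BB0 mA mL AL.
have MB : M (Y @^-1` B) < +oo.
  by apply: le_lt_trans MB0; rewrite le_measure ?inE//; [exact: mpre|exact: mpre|move=> w /BB0].
apply: (@dominated_cvg _ _ _ M _ (mpre mB) _ _ (cst 1)) => //.
- by move=> n; apply: measurable_funTS; exact: measurable_void.
- move=> w _; rewrite -(fineK (nu_boxed (Y w) mL)); apply: cvg_expeRN.
  by rewrite fineK//; exact: nu_boxed.
- apply/integrableP; split=> //; rewrite (eq_integral (cst 1)) => [|w _]; last by rewrite abse1.
  by rewrite integral_cst ?mul1e//; exact: mpre.
- by move=> n w _; rewrite gee0_abs ?expeR_ge0// expeRN_le1.
Qed.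

Let frozen_ndseq : ndseq_closed frozen.
Proof.
move=> A ndA fA; have mA n : measurable (A n) by have [] := fA n.
have mL : measurable (\bigcup_n A n) by exact: bigcupT_measurable.
split=> // B mB BB0.
have ndx y : nondecreasing_seq (fun n => xsection (boxed (A n)) y).
  move=> m n mn; apply/subsetPset => q; rewrite /xsection/= !inE => -[Am ?]; split=> //.
  by move: (ndA _ _ mn) => /subsetPset; apply.
have mx n y : measurable (xsection (boxed (A n)) y) by exact: (measurable_xsection _ (mboxed (mA n))).
have xL y : xsection (boxed (\bigcup_n A n)) y = \bigcup_n xsection (boxed (A n)) y.
  apply/seteqP; split=> q; rewrite /xsection/= ?inE.
    by move=> [[n _ An] Fq]; exists n => //=; rewrite inE.
  by move=> [n _]; rewrite /= inE => -[An Fq]; split=> //; exists n.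
have := cvg_frozen mB BB0 mA mL; move=> /(_ _)/cvg_lim <-//; last first.
  move=> y; rewrite xL; apply: nondecreasing_cvg_mu => //.
  exact: bigcupT_measurable.
apply/esym/cvg_lim => //.
under eq_cvg => n do (have [_ /(_ _ mB BB0) <-] := fA n).
have -> : Y @^-1` B `&` avoid Y X (boxed (\bigcup_n A n)) =
    \bigcap_n (Y @^-1` B `&` avoid Y X (boxed (A n))).
  apply/seteqP; split=> [w [Bw h] n _|w h]; first by split=> // j [An Fj]; apply: (h j); split=> //; exists n.
  split; first by have [] := h 0%N I.
  by move=> j [[n _ An] Fj]; have [_ /(_ j)] := h n I; apply.
apply: nonincreasing_cvg_mu.
- apply: le_lt_trans MB0; rewrite le_measure ?inE//; [exact: mfrozen|exact: mpre|].
  by move=> w [/BB0].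
- by move=> n; exact: mfrozen.
- by apply: bigcap_measurable => // k _; exact: mfrozen.
- move=> m n mn; apply/subsetPset; apply: setIS; apply: avoidS; apply: setSI.
  by move: (ndA _ _ mn) => /subsetPset.
Qed.

(** Local finiteness of the points enters here: a decreasing sequence of
    regions whose intersection is void must become void at some finite stage,
    because finitely many points of F have to leave it. *)
Let frozen_niseq : niseq_closed frozen.
Proof.
move=> A niA fA; have mA n : measurable (A n) by have [] := fA n.
have mL : measurable (\bigcap_n A n) by exact: bigcapT_measurable.
split=> // B mB BB0.
have nix y : nonincreasing_seq (fun n => xsection (boxed (A n)) y).
  move=> m n mn; apply/subsetPset => q; rewrite /xsection/= !inE => -[Am ?]; split=> //.
  by move: (niA _ _ mn) => /subsetPset; apply.
have mx n y : measurable (xsection (boxed (A n)) y) by exact: (measurable_xsection _ (mboxed (mA n))).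
have xL y : xsection (boxed (\bigcap_n A n)) y = \bigcap_n xsection (boxed (A n)) y.
  apply/seteqP; split=> q; rewrite /xsection/= ?inE.
    by move=> [Aq Fq] n _; rewrite /= inE; split => //; exact: Aq.
  move=> h; split; last by have := h 0%N I; rewrite /= inE => -[].
  by move=> n _; have := h n I; rewrite /= inE => -[].
have := cvg_frozen mB BB0 mA mL; move=> /(_ _)/cvg_lim <-//; last first.
  move=> y; rewrite xL; apply: nonincreasing_cvg_mu => //.
    by rewrite -ge0_fin_numE//; exact: nu_boxed.
  exact: bigcapT_measurable.
apply/esym/cvg_lim => //.
under eq_cvg => n do (have [_ /(_ _ mB BB0) <-] := fA n).
pose V := \bigcup_n (Y @^-1` B `&` avoid Y X (boxed (A n))).
have mV : measurable V by apply: bigcupT_measurable => n; exact: mfrozen.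
have VE : M (Y @^-1` B `&` avoid Y X (boxed (\bigcap_n A n))) = M V.
  have [N [mN N0 finN]] := finF.
  have VL : V `<=` Y @^-1` B `&` avoid Y X (boxed (\bigcap_n A n)).
    move=> w [n _ [Bw h]]; split=> // j [/(_ n I) An Fj]; apply: (h j); by split.
  apply/eqP; rewrite eq_le; apply/andP; split; last first.
    by rewrite le_measure ?inE//; exact: mfrozen.
  rewrite -[leRHS]adde0 -N0; apply: (le_trans _ (measureU2 _ mV mN)).
  rewrite le_measure ?inE//; [exact: mfrozen|exact: measurableU|].
  move=> w [Bw h]; have [Nw|Nw] := pselect (N w); [by right|left].
  have fw : finite_set [set j | F (X j w)].
    by apply: contrapT => nf; apply/Nw/finN => /(_ (BB0 _ Bw)).
  have [m hm] : exists m, forall j, F (X j w) -> ~ A m (Y w, X j w).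
    have ex j : exists m, F (X j w) -> ~ A m (Y w, X j w).
      have [Fj|?] := pselect (F (X j w)); last by exists 0%N.
      have := h j => /not_andP[|[]//].
      by move=> /existsNP[m /not_implyP[_ ?]]; exists m.
    have [f hf] := choice ex.
    (* one stage b serves the finitely many points of F at once *)
    have [b hb] : exists b, forall j, F (X j w) -> (f j <= b)%N.
      have [s sE] := (finite_seqP _).1 fw.
      exists (\big[maxn/0%N]_(j <- s) f j) => j Fj.
      by apply: leq_bigmax_seq => //; move: Fj; rewrite -[F _]/([set j | F (X j w)] j) sE.
    exists b => j Fj Ab; apply: (hf j Fj).
    by move: (niA _ _ (hb j Fj)) => /subsetPset; apply.
  by exists m => //; split=> // j [Am [_ /= Fj]]; exact: (hm j Fj).
rewrite VE; apply: nondecreasing_cvg_mu => //.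
- by move=> n; exact: mfrozen.
- move=> m n mn; apply/subsetPset; apply: setIS; apply: avoidS; apply: setSI.
  by move: (niA _ _ mn) => /subsetPset.
Qed.

(** Conditionally on Y the void probability of the section at Y is that of a
    fixed region, because Y is independent of the points. For regions that
    depend on Y through countably many values this is a countable sum. Such
    regions form a ring generating the product sigma-algebra, and the identity
    passes to monotone limits, so the monotone class theorem applies. The box F
    makes it possible to take decreasing limits. *)
Lemma freezing (A : set (T * P)) B : measurable A -> measurable B -> B `<=` B0 ->
  M (Y @^-1` B `&` avoid Y X (A `&` (setT `*` F))) =
  \int[M]_(w in Y @^-1` B) expeR (- nu (xsection (A `&` (setT `*` F)) (Y w))).
Proof.
move=> mA mB BB0; suff : frozen A by case=> _; apply.
apply: (monotone_setring_sub_g_sigma_ring (conj frozen_ndseq frozen_niseq) stepped_setring stepped_frozen).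
move: mA; rewrite [measurable]measurable_prod_measurableType.
apply: smallest_sub => //.
  have [sr0 srD srU] := smallest_sigma_ring stepped; split=> // C sC.
  apply: srD => //; apply: sub_g_sigma_ring.
  by exists (fun=> 0%N), (fun=> setT); split=> //; apply/seteqP; split.
move=> _ [C mC [D mD <-]]; apply: sub_g_sigma_ring.
(* a rectangle C x D is the region D over C and the empty region elsewhere *)
exists (fun y => (y \in C) : nat), (fun k => if k is 0%N then set0 else D); split.
- apply: (@measurableT_comp _ _ _ _ _ _ (fun b : bool => b : nat)) => //.
  apply: (measurable_fun_bool true).
  rewrite setTI (_ : _ @^-1` _ = C)//.
  by apply/seteqP; split=> y /=; [move/set_mem|move/mem_set].
- by case.
- apply/seteqP; split=> -[y q] /=; first by move=> [/mem_set -> ?].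
  by case: (boolP (y \in C)) => // /set_mem.
Qed.

End freezing.

(** * Counting points, and Poisson processes given a variable *)
Lemma finite_eventually (I : choiceType) (D : set I) (p : I -> nat -> Prop) :
  finite_set D ->
  (forall i, D i -> exists m0, forall m, (m0 <= m)%N -> p i m) ->
  exists m0, forall m, (m0 <= m)%N -> forall i, D i -> p i m.
Proof.
move=> /finite_seqP[s ->] h.
have ex i : exists m0, i \in s -> forall m, (m0 <= m)%N -> p i m.
  have [si|_] := boolP (i \in s); last by exists 0%N.
  by have [m0 ?] := h i si; exists m0.
have [f hf] := choice ex.
exists (\big[maxn/0%N]_(i <- s) f i) => m mm i si.
by apply: hf => //; apply: leq_trans mm; exact: leq_bigmax_seq.
Qed.

Section indic_series.
Local Open Scope ereal_scope.
Context {R : realType} {dO} {O : measurableType dO}.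

Definition how_many (E : nat -> set O) (w : O) : \bar R :=
  \sum_(i <oo) (\1_(E i) w)%:E.

Lemma how_many_ge0 E w : 0 <= how_many E w.
Proof. by apply: nneseries_ge0 => i _ _; rewrite lee_fin. Qed.

Lemma measurable_how_many E : (forall i, measurable (E i)) ->
  measurable_fun setT (how_many E).
Proof.
move=> mE; apply: ge0_emeasurable_sum => // i _.
by apply/measurable_EFinP; exact: measurable_indic.
Qed.

Lemma integral_how_many (M : {measure set O -> \bar R}) E :
  (forall i, measurable (E i)) ->
  \int[M]_w how_many E w = \sum_(i <oo) M (E i).
Proof.
move=> mE; rewrite integral_nneseries//.
- by apply: eq_eseriesr => i _; rewrite integral_indic// setIT.
- by move=> i; apply/measurable_EFinP; exact: measurable_indic.
Qed.

Lemma how_many_unique (E : nat -> set O) w i : E i w ->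
  (forall j, E j w -> j = i) -> how_many E w = 1.
Proof.
move=> Ei uniq; rewrite /how_many (@nneseriesD1 _ _ i)//; last first.
rewrite indicE mem_set// eseries0 ?adde0// => j _ /= /eqP ji.
by rewrite indicE memNset// => /uniq.
Qed.

Lemma how_many0 (E : nat -> set O) w : (forall j, ~ E j w) -> how_many E w = 0.
Proof. by move=> E0; rewrite /how_many eseries0// => j _ _; rewrite indicE memNset. Qed.

Lemma le_how_many_sum (E : nat -> set O) n w :
  \sum_(i < n) (\1_(E i) w)%:E <= how_many E w.
Proof.
by rewrite -(big_mkord xpredT (fun i => (\1_(E i) w)%:E)); apply: nneseries_lim_ge => *; rewrite lee_fin.
Qed.

Lemma how_many_split (E : nat -> set O) (c : nat -> nat) w :
  how_many E w = \sum_(k <oo) how_many (fun i => E i `&` [set _ | c i = k]) w.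
Proof.
rewrite /how_many nneseries_interchange//.
apply: eq_eseriesr => i _.
rewrite (@nneseriesD1 _ _ (c i))// eseries0 ?adde0; last first.
  by move=> k _ /= /eqP kc; rewrite indicE memNset// => -[_ /= /esym].
by congr (_%:E); rewrite !indicE; congr (_%:R); congr (nat_of_bool _); apply/idP/idP; rewrite !inE //= => -[].
Qed.

End indic_series.

Section poisson_given.
Local Open Scope ereal_scope.
Context {R : realType} {dO dT dP} {O : measurableType dO}
  {T : measurableType dT} {P : measurableType dP}.

(** A dissecting system relative to nu: kappa m codes the cell of a point in the
    m-th partition. Cells eventually separate any two points, and inside each
    window F n of finite measure they become uniformly small. *)
Definition dissecting (nu : set P -> \bar R) (P0 : set P) (F : nat -> set P)
    (kappa : nat -> P -> nat) :=
  [/\ [/\ forall n, measurable (F n), nondecreasing_seq F,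
      P0 = \bigcup_n F n & forall n, nu (F n) < +oo],
      forall m, measurable_fun setT (kappa m),
      forall x y, x <> y ->
        exists m0, forall m, (m0 <= m)%N -> kappa m x <> kappa m y
    & forall n (e : R), (0 < e)%R ->
        exists m0, forall m, (m0 <= m)%N -> forall k,
        nu (F n `&` kappa m @^-1` [set k]) <= e%:E].

(** By Renyi's theorem a Poisson process without multiple points is determined
    by its void probabilities. So this says that the points of X lying in P0
    form a Poisson process of intensity nu that is independent of Y. Terms of
    X outside P0 are dummies, which allows points to be deleted without
    renumbering the sequence. *)
Definition poisson_given (Q : set O -> \bar R) (nu : set P -> \bar R)
    (P0 : set P) (Y : O -> T) (X : nat -> O -> P) :=
  [/\ measurable_fun setT Y, forall j, measurable_fun setT (X j),
      {ae Q, forall w, forall i j, i <> j -> P0 (X i w) -> X i w <> X j w}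
    & forall B A, measurable B -> measurable A -> A `<=` P0 -> nu A < +oo ->
      Q (Y @^-1` B `&` avoid Y X (setT `*` A)) =
      Q (Y @^-1` B) * expeR (- nu A)].

End poisson_given.

(** * The mean number of isolated points *)
Section limn_einf_bounds.
Local Open Scope ereal_scope.
Context {R : realType}.
Implicit Types (u : (\bar R)^nat) (x : \bar R).

Lemma limn_einf_ge u x m0 :
  (forall m, (m0 <= m)%N -> x <= u m) -> x <= limn_einf u.
Proof.
move=> h; rewrite limn_einf_lim; rewrite (cvg_lim _ (@cvg_einfs_sup _ u))//.
apply: le_trans (ereal_sup_ubound _); last by exists m0.
by apply: le_ereal_inf_tmp => _ [m /= mm <-]; exact: h.
Qed.

Lemma limn_einf_le u x m0 :
  (forall m, (m0 <= m)%N -> u m <= x) -> limn_einf u <= x.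
Proof.
move=> h; rewrite limn_einf_lim; rewrite (cvg_lim _ (@cvg_einfs_sup _ u))//.
apply: ge_ereal_sup => _ [n _ <-].
apply: (@le_trans _ _ (u (maxn n m0))); last by apply: h; rewrite leq_maxr.
by apply: ereal_inf_lbound; exists (maxn n m0) => //=; rewrite leq_maxl.
Qed.

Lemma measurable_fun_limn_einf d (T : measurableType d) (f : (T -> \bar R)^nat) :
  (forall n, measurable_fun setT (f n)) ->
  measurable_fun setT (fun t => limn_einf (f ^~ t)).
Proof.
move=> mf; rewrite /limn_einf; apply: measurableT_comp => //.
apply: measurable_fun_limn_esup => n; exact: measurableT_comp.
Qed.

End limn_einf_bounds.

Section campbell.
Local Open Scope ereal_scope.
Context {R : realType} {dO dT dP} {O : measurableType dO}
  {T : measurableType dT} {P : measurableType dP}.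
Variables (Q : probability O R) (nu : {sigma_finite_measure set P -> \bar R})
  (P0 : set P) (F : nat -> set P) (kappa : nat -> P -> nat).
Hypothesis diss : dissecting nu P0 F kappa.
Variables (Y : O -> T) (X : nat -> O -> P).
Hypothesis pg : poisson_given Q nu P0 Y X.

Let mF n : measurable (F n). Proof. by have [[]] := diss. Qed.
Let FP0 n : F n `<=` P0.
Proof. by have [[_ _ -> _] _ _ _] := diss; exact: bigcup_sup. Qed.
Let nuF n : nu (F n) < +oo. Proof. by have [[]] := diss. Qed.
Let mY : measurable_fun setT Y. Proof. by case: pg. Qed.
Let mX j : measurable_fun setT (X j). Proof. by case: pg. Qed.
Let mpY B : measurable B -> measurable (Y @^-1` B).
Proof. by move=> mB; rewrite -[X in measurable X]setTI; exact: mY. Qed.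
Let mpX j D : measurable D -> measurable (X j @^-1` D).
Proof. by move=> mB; rewrite -[X in measurable X]setTI; exact: mX. Qed.
Let mcell m k : measurable (kappa m @^-1` [set k]).
Proof. by have [_ mk _ _] := diss; rewrite -[X in measurable X]setTI; exact: mk. Qed.

Let mavoid A : measurable A -> measurable (avoid Y X (setT `*` A)).
Proof. by move=> mA; apply: measurable_avoid => //; exact: measurableX. Qed.

Let nu_fin n A : measurable A -> A `<=` F n -> nu A \is a fin_num.
Proof.
move=> mA AF; rewrite ge0_fin_numE// (le_lt_trans _ (nuF n))// le_measure ?inE//.
Qed.

Let void B n A : measurable B -> measurable A -> A `<=` F n ->
  Q (Y @^-1` B `&` avoid Y X (setT `*` A)) = Q (Y @^-1` B) * expeR (- nu A).
Proof.
move=> mB mA AF; have [_ _ _ h] := pg; apply: h => //.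
  by move=> x /AF/FP0.
by rewrite -ge0_fin_numE//; exact: nu_fin AF.
Qed.

Variable n0 : nat.

Let cells m (D : set P) k := D `&` kappa m @^-1` [set k].

Let mcells m D k : measurable D -> measurable (cells m D k).
Proof. by move=> mD; exact: measurableI. Qed.

(** At the scale of the cells, this event stands for an isolated point of D in
    cell k; unlike the latter, it is a difference of two void events. *)
Let occupied B D A m k := Y @^-1` B `&`
  (\bigcup_i X i @^-1` cells m D k) `&` avoid Y X (setT `*` (A `\` cells m D k)).

Let moccupied B D A m k : measurable B -> measurable D -> measurable A ->
  measurable (occupied B D A m k).
Proof.
move=> mB mD mA; apply: measurableI; last by apply/mavoid/measurableD => //; exact: mcells.
by apply: measurableI; [exact: mpY|apply: bigcupT_measurable => i; exact/mpX/mcells].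
Qed.

Let sum_cells m D : measurable D -> nu D = \sum_(k <oo) nu (cells m D k).
Proof.
move=> mD; have DE : D = \bigcup_k cells m D k.
  by apply/seteqP; split=> [x Dx|x [k _ []]//]; exists (kappa m x).
rewrite [in LHS]DE measure_semi_bigcup//.
- by move=> k; exact: mcells.
- apply/trivIsetP => i j _ _ ij; apply/seteqP; split=> // x [[_ /= ki] [_ /= kj]].
  by move: ij; rewrite -ki -kj eqxx.
- by rewrite -DE.
Qed.

Let Q_occupied B D A m k : measurable B -> measurable D -> measurable A ->
  D `<=` F n0 -> A `<=` F n0 ->
  Q (occupied B D A m k) = Q (Y @^-1` B) *
    (expeR (- nu (A `\` cells m D k)) - expeR (- nu (A `|` cells m D k))).
Proof.
move=> mB mD mA DF AF; set C := cells m D k.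
have mC : measurable C by exact: mcells.
have CF : C `<=` F n0 by move=> x [/DF].
have mAC : measurable (A `\` C) by exact: measurableD.
have mAUC : measurable (A `|` C) by exact: measurableU.
have -> : occupied B D A m k =
    (Y @^-1` B `&` avoid Y X (setT `*` (A `\` C))) `\`
    (Y @^-1` B `&` avoid Y X (setT `*` (A `|` C))).
  apply/seteqP; split=> [w [[Bw [i _ Ci]] av]|w [[Bw av] nav]].
    by split=> // -[_ /(_ i)]; apply; split=> //; right.
  split=> //; split=> //.
  have : ~ avoid Y X (setT `*` (A `|` C)) w by move=> h; exact: nav.
  move=> /existsNP[i /contrapT[_ /= [Ai|Ci]]]; exists i => //.
  by apply: contrapT => nC; apply: (av i).
have mE1 : measurable (Y @^-1` B `&` avoid Y X (setT `*` (A `\` C))).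
  by apply: measurableI; [exact: mpY|exact: mavoid].
have mE2 : measurable (Y @^-1` B `&` avoid Y X (setT `*` (A `|` C))).
  by apply: measurableI; [exact: mpY|exact: mavoid].
rewrite measureD//; last by rewrite (le_lt_trans (probability_le1 _ _))// ltry.
have sub : Y @^-1` B `&` avoid Y X (setT `*` (A `|` C)) `<=`
    Y @^-1` B `&` avoid Y X (setT `*` (A `\` C)).
  move=> w [Bw av]; split=> //; apply: avoidS av => -[y q] [_ /= [Aq _]].
  by split=> //; left.
rewrite (setIidr sub).
have Qfin : Q (Y @^-1` B) \is a fin_num by rewrite fin_num_measure//; exact: mpY.
rewrite muleBr//; last by apply: fin_num_adde_defr; exact: expeRN_fin_num.
by congr (_ - _); apply: (void (n := n0)) => // x; [case=> /AF|case=> [/AF|/CF]].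
Qed.

(** With a = nu A, d = nu of the cell and b = nu of A outside the cell: the
    probability that the cell is occupied and the rest of A void is d exp(-a)
    up to factors that tend to 1 with the size e of the cells. *)
Let real_bounds (a b d e : R) : (0 <= d)%R -> (d <= e)%R ->
  (a - d <= b)%R -> (b <= a)%R ->
  (expR (- e) * d * expR (- a) <= expR (- b) - expR (- (b + d)) /\
   expR (- b) - expR (- (b + d)) <= expR e * d * expR (- a))%R.
Proof.
move=> d0 de adb ba; rewrite opprD expRD -{1 3}(mulr1 (expR (- b))) -mulrBr.
have e0 x := @expR_ge0 R x; have eg x := @expR_gt0 R x.
have lo : (expR (- d) * d <= 1 - expR (- d))%R.
  rewrite expRN -(ler_pM2l (eg d)) mulrA mulfV ?gt_eqF// mul1r mulrBr mulr1 mulfV ?gt_eqF//.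
  by have := expR_ge1Dx d; lra.
have hi : (1 - expR (- d) <= d)%R by have := expR_ge1Dx (- d); lra.
have h1 : (expR (- a) <= expR (- b))%R by rewrite ler_expR lerN2.
have h2 : (expR (- b) <= expR (- a) * expR e)%R by rewrite -expRD ler_expR; lra.
have h3 : (expR (- e) <= expR (- d))%R by rewrite ler_expR lerN2.
split.
  rewrite mulrC ler_pM ?mulr_ge0//.
  by rewrite (le_trans _ lo)// ler_wpM2r.
rewrite [leRHS](_ : _ = (expR (- a) * expR e * d)%R); last by ring.
by rewrite ler_pM// subr_ge0 -expR0 ler_expR oppr_le0.
Qed.

Let sum_occupied B D A (e : R) : measurable B -> measurable D -> measurable A ->
  D `<=` F n0 -> A `<=` F n0 -> (0 < e)%R ->
  exists m0, forall m, (m0 <= m)%N ->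
  let C := Q (Y @^-1` B) * nu D * expeR (- nu A) in
  (expR (- e))%:E * C <= \sum_(k <oo) Q (occupied B D A m k) /\
  \sum_(k <oo) Q (occupied B D A m k) <= (expR e)%:E * C.
Proof.
move=> mB mD mA DF AF e0; have [_ _ _ /(_ n0 e e0)[m0 small]] := diss.
exists m0 => m mm C; have := small m mm => {}small.
have Afin := nu_fin mA AF.
have Qfin : Q (Y @^-1` B) \is a fin_num by rewrite fin_num_measure//; exact: mpY.
have bounds k :
    (expR (- e))%:E * (Q (Y @^-1` B) * expeR (- nu A)) * nu (cells m D k) <= Q (occupied B D A m k) /\
    Q (occupied B D A m k) <= (expR e)%:E * (Q (Y @^-1` B) * expeR (- nu A)) * nu (cells m D k).
  rewrite Q_occupied//.
  have mC := mcells m k mD.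
  set Ck := cells m D k in mC *.
  have CF : Ck `<=` F n0 by move=> x [/DF].
  have dfin := nu_fin mC CF.
  have mAC : measurable (A `\` Ck) by exact: measurableD.
  have bfin : nu (A `\` Ck) \is a fin_num by apply: (nu_fin (n := n0)) => // x [/AF].
  have -> : nu (A `|` Ck) = nu (A `\` Ck) + nu Ck.
    rewrite -(setDUK (_ : Ck `<=` A `|` Ck)) ?[Ck `|` _]setUC; last by move=> x; right.
    rewrite setDUl setDv setU0; apply: measureU => //.
    by apply/seteqP; split=> x // [[_ ?]].
  have ba : nu (A `\` Ck) <= nu A by rewrite le_measure ?inE// => x [].
  have adb : nu A - nu Ck <= nu (A `\` Ck).
    rewrite leeBlDr//; apply: le_trans (measureU2 _ mAC mC); rewrite le_measure ?inE//.
      exact: measurableU.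
    by move=> x Ax; have [?|?] := pselect (Ck x); [right|left].
  have de : nu Ck <= e%:E.
    apply: le_trans (small k); rewrite le_measure ?inE//; first exact: measurableI.
    by move=> x [/DF].
  have d0 : 0 <= nu Ck by [].
  have [q [q0 Qq]] : exists q : R, (0 <= q)%R /\ Q (Y @^-1` B) = q%:E.
    by exists (fine (Q (Y @^-1` B))); split; [exact: fine_ge0|rewrite fineK].
  rewrite Qq; move: ba adb de d0.
  rewrite -(fineK Afin) -(fineK dfin) -(fineK bfin).
  rewrite -EFinD -EFinB !lee_fin => ba adb de d0.
  have [] := real_bounds d0 de adb ba.
  set X1 := fine (nu A); set X2 := fine (nu Ck); set X3 := fine (nu _) => lo hi.
  split.
    rewrite [leLHS](_ : _ = (q * (expR (- e) * X2 * expR (- X1)))%R); last by ring.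
    exact: ler_wpM2l.
  rewrite [leRHS](_ : _ = (q * (expR e * X2 * expR (- X1)))%R); last by ring.
  exact: ler_wpM2l.
have q0 : 0 <= Q (Y @^-1` B) * expeR (- nu A) by rewrite mule_ge0 ?expeR_ge0.
have qf : Q (Y @^-1` B) * expeR (- nu A) \is a fin_num.
  by rewrite fin_numM// expeRN_fin_num.
have CE (x : R) : x%:E * C = \sum_(k <oo) x%:E * (Q (Y @^-1` B) * expeR (- nu A)) * nu (cells m D k).
  rewrite -(fineK qf) -EFinM nneseriesZl// -sum_cells// EFinM fineK//.
  by rewrite /C -!muleA; congr (_ * (_ * _)); rewrite muleC.
split; rewrite CE; apply: lee_nneseries => // k _.
- by rewrite mule_ge0// mule_ge0// lee_fin expR_ge0.
- by have [] := bounds k.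
- by have [] := bounds k.
Qed.

Let expR_squeeze (x c : R) : (0 <= c)%R ->
  (forall e, 0 < e -> x <= expR e * c)%R -> (x <= c)%R.
Proof.
move=> c0 h; rewrite leNgt; apply/negP => cx.
have x0 : (0 < x)%R by exact: le_lt_trans cx.
pose e := ((x - c) / (2 * x))%R.
have e0 : (0 < e)%R by rewrite divr_gt0 ?subr_gt0// mulr_gt0.
have := h e e0; apply/negP; rewrite -ltNge.
rewrite -(ltr_pM2l (expR_gt0 (- e))) mulrA -expRD addNr expR0 mul1r.
apply: (@lt_le_trans _ _ ((1 - e) * x)%R); last first.
  by apply: ler_wpM2r; [exact: ltW|exact: expR_ge1Dx].
have -> : ((1 - e) * x = x - (x - c) / 2)%R by rewrite /e; field; rewrite gt_eqF.
lra.
Qed.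

Let separated w : (forall i j, i <> j -> P0 (X i w) -> X i w <> X j w) ->
  forall J : set nat, finite_set J -> (forall i, J i -> P0 (X i w)) ->
  exists m0, forall m, (m0 <= m)%N -> forall i, J i -> forall j, J j ->
    kappa m (X i w) = kappa m (X j w) -> i = j.
Proof.
move=> inj J fJ JP0; apply: finite_eventually => // i Ji.
apply: finite_eventually => // j Jj.
have [->|ij] := pselect (i = j); first by exists 0%N.
have [_ _ sep _] := diss.
have [m0 hm0] := sep _ _ (inj _ _ ij (JP0 _ Ji)).
by exists m0 => m /hm0.
Qed.

(** Once the cells separate the points, occupied cells count them; Fatou's
    lemma then bounds the mean number of points by the limit of the mean number
    of occupied cells. This integrable bound is what the dominated convergence
    in Campbell's formula rests on. *)
Let mean_count_le D : measurable D -> D `<=` F n0 ->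
  \int[Q]_w how_many (fun i => X i @^-1` D) w <= nu D.
Proof.
move=> mD DF.
have dfin := nu_fin mD DF.
rewrite integral_how_many; last by move=> i; exact: mpX.
apply: lime_le; first by apply: is_cvg_nneseries => *.
near=> N.
(* finitely many indices, so that a single partition separates them all *)
pose EN i := X i @^-1` D `&` [set _ | (i < N)%N].
have mEN i : measurable (EN i).
  apply: measurableI; first exact: mpX.
  have [iN|iN] := boolP (i < N)%N.
    by rewrite (_ : [set _ | _] = setT)//; apply/seteqP; split.
  by rewrite (_ : [set _ | _] = set0)//; apply/seteqP; split=> // w /=; rewrite (negbTE iN).
apply: (@le_trans _ _ (\int[Q]_w how_many EN w)).
  rewrite integral_how_many//.
  rewrite (eq_big_nat _ _ (F2 := fun i => Q (EN i))); last first.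
    move=> i /andP[_ iN]; congr (Q _); rewrite /EN; apply/seteqP; split=> w //=; last by case.
  by apply: nneseries_lim_ge => *.
pose Tm m : O -> \bar R := how_many (occupied setT D set0 m).
have mTm m : measurable_fun setT (Tm m).
  by apply: measurable_how_many => k; exact: moccupied.
have le1 m w : (forall i j, EN i w -> EN j w -> kappa m (X i w) = kappa m (X j w) -> i = j) ->
    how_many EN w <= Tm m w.
  move=> sep; rewrite (how_many_split _ (fun i => kappa m (X i w))).
  apply: lee_nneseries => [k _ _|k _]; first exact: how_many_ge0.
  have [[i [ENi ki]]|none] := pselect (exists i, EN i w /\ kappa m (X i w) = k).
    rewrite (@how_many_unique _ _ _ _ _ i)//; last first.
      by move=> j [ENj kj]; apply: sep => //; rewrite kj ki.
    rewrite lee_fin indicE mem_set//; split; last first.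
      by move=> j [_ [[]]].
    by split=> //; exists i => //; split=> //; case: ENi.
  rewrite how_many0 ?lee_fin// => i [ENi /= ki]; apply: none; by exists i.
have fat := fatou Q measurableT mTm (fun m w _ => how_many_ge0 _ _).
have [_ _ inj _] := pg.
apply: (@le_trans _ _ (\int[Q]_w limn_einf (Tm ^~ w))).
  apply: ae_ge0_le_integral => //.
  - by move=> *; exact: how_many_ge0.
  - exact: measurable_how_many.
  - move=> w _; apply: (limn_einf_ge (m0 := 0%N)) => m _; exact: how_many_ge0.
  - exact: measurable_fun_limn_einf.
  case: inj => N0 [mN0 QN0 hN0]; exists N0; split=> // w hw; apply: hN0 => /= hinj; apply: hw => _.
  have [||m0 hm0] := separated hinj (J := [set i | EN i w]).
  - by apply: (sub_finite_set _ (finite_II N)) => i [].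
  - by move=> i [/DF/FP0].
  apply: (limn_einf_ge (m0 := m0)) => m mm.
  by apply: le1 => i j Ei Ej; exact: hm0.
apply: (le_trans fat).
have bnd e : (0 < e)%R -> limn_einf (fun m => \int[Q]_w Tm m w) <= (expR e * fine (nu D))%:E.
  move=> e0; have [|m0 hm0] := sum_occupied measurableT mD measurable0 DF _ e0 => //.
  apply: (limn_einf_le (m0 := m0)) => m mm.
  rewrite integral_how_many; last by move=> k; exact: moccupied.
  have [_] := hm0 m mm.
  rewrite preimage_setT probability_setT mul1e measure0 oppe0 expeR0 mule1.
  by rewrite EFinM fineK.
have l0 : 0 <= limn_einf (fun m => \int[Q]_w Tm m w).
  by apply: (limn_einf_ge (m0 := 0%N)) => m _; apply: integral_ge0 => w _; exact: how_many_ge0.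
have lfin : limn_einf (fun m => \int[Q]_w Tm m w) \is a fin_num.
  by rewrite ge0_fin_numE// (le_lt_trans (bnd 1%R ltr01))// ltry.
rewrite -(fineK dfin) -(fineK lfin) lee_fin; apply: expR_squeeze; first exact: fine_ge0.
by move=> e e0; rewrite -lee_fin fineK//; exact: bnd.
Unshelve. all: by end_near. Qed.

Let finite_hits w (D : set P) :
  how_many (fun i => X i @^-1` D) w < +oo :> \bar R -> finite_set [set i | D (X i w)].
Proof.
have -> : how_many (fun i => X i @^-1` D) w = counting [set i | D (X i w)] :> \bar R.
  rewrite counting_dirac; apply: eq_eseriesr => i _; rewrite diracE indicE.
  by congr (_%:R%:E); congr nat_of_bool; apply/idP/idP; rewrite !inE.
by rewrite /counting; case: asboolP.
Qed.

Lemma ae_finite_hits D : measurable D -> D `<=` F n0 ->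
  {ae Q, forall w, finite_set [set i | D (X i w)]}.
Proof.
move=> mD DF.
have mE i : measurable (X i @^-1` D) by exact: mpX.
have : Q.-integrable setT (how_many (fun i => X i @^-1` D)).
  apply/integrableP; split; first exact: measurable_how_many.
  rewrite (eq_integral (how_many (fun i => X i @^-1` D))); last first.
    by move=> w _; rewrite gee0_abs// how_many_ge0.
  by rewrite (le_lt_trans (mean_count_le mD DF))// -ge0_fin_numE//; exact: nu_fin DF.
move=> /(integrable_ae measurableT); apply: filterS => w /(_ I) wfin.
by apply: finite_hits; rewrite -ge0_fin_numE ?how_many_ge0.
Qed.

Definition isolated (B : set T) (D A : set P) (i : nat) : set O :=
  Y @^-1` B `&` X i @^-1` D `&` [set w | forall j, j <> i -> ~ A (X j w)].

Lemma measurable_isolated B D A i : measurable B -> measurable D -> measurable A ->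
  measurable (isolated B D A i).
Proof.
move=> mB mD mA; apply: measurableI.
  by apply: measurableI; [exact: mpY|exact: mpX].
have -> : [set w | forall j, j <> i -> ~ A (X j w)] =
    \bigcap_j (if j == i then setT else X j @^-1` (~` A)).
  apply/seteqP; split=> w /= h j.
    by move=> _; case: eqP => //= ji; exact: h.
  by move=> ji; have := h j I; case: eqP.
apply: bigcapT_measurable => j; case: eqP => // _.
by apply: mpX; exact: measurableC.
Qed.

(** The sum counts the points of D with no other point in A. Fine cells see the
    same number almost surely, since they separate the finitely many points of
    D and A; their number is dominated by the number of points of D, which is
    integrable, and its mean was computed from void probabilities. *)
Lemma campbell B D A : measurable B -> measurable D -> measurable A ->
  D `<=` F n0 -> A `<=` F n0 ->
  \sum_(i <oo) Q (isolated B D A i) = Q (Y @^-1` B) * nu D * expeR (- nu A).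
Proof.
move=> mB mD mA DF AF.
have mE i : measurable (X i @^-1` D) by exact: mpX.
have mal i := measurable_isolated i mB mD mA.
rewrite -integral_how_many//.
have mDA : measurable (D `|` A) by exact: measurableU.
have DAF : D `|` A `<=` F n0 by move=> x [/DF|/AF].
have aefin := ae_finite_hits mDA DAF.
have [_ _ inj _] := pg.
have dom m w : how_many (occupied B D A m) w <= how_many (fun i => X i @^-1` D) w :> \bar R.
  rewrite [leRHS](how_many_split _ (fun i => kappa m (X i w))).
  apply: lee_nneseries => [k _ _|k _]; first by rewrite lee_fin.
  have [occ|nocc] := pselect (occupied B D A m k w); last first.
    by rewrite indicE memNset// how_many_ge0.
  rewrite indicE mem_set//; case: occ => -[_ [i _ [Di ki]]] _.
  rewrite /how_many (@nneseriesD1 _ _ i)//.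
  by rewrite indicE mem_set// leeDl// nneseries_ge0.
have eqE w m : (forall i j, (D `|` A) (X i w) -> (D `|` A) (X j w) ->
    kappa m (X i w) = kappa m (X j w) -> i = j) ->
    how_many (occupied B D A m) w = how_many (isolated B D A) w :> \bar R.
  move=> sep; rewrite [RHS](how_many_split _ (fun i => kappa m (X i w))).
  apply: eq_eseriesr => k _.
  have [[i [Di ki]]|none] := pselect (exists i, D (X i w) /\ kappa m (X i w) = k); last first.
    rewrite how_many0; last by move=> i [[[_ Di] _] /= ki]; apply: none; exists i.
    by rewrite indicE memNset// => -[[_ [i _ [Di ki]]] _]; apply: none; exists i.
  have uni j : D (X j w) -> kappa m (X j w) = k -> j = i.
    by move=> Dj kj; apply: sep; [by left|by left|rewrite kj ki].
  have [ali|nali] := pselect (isolated B D A i w).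
    rewrite (@how_many_unique _ _ _ _ _ i)//; last by move=> j [[[_ Dj] _] /= kj]; exact: uni.
    rewrite indicE mem_set//; case: ali => -[Bw _] h; split.
      by split=> //; exists i.
    move=> j [_ /= [Aj nCj]]; apply: (h j) => // ji; apply: nCj; rewrite ji; by split.
  rewrite how_many0; last first.
    by move=> j [alj /= kj]; apply: nali; rewrite -(uni j)//; case: alj => -[].
  rewrite indicE memNset// => -[[Bw _] av]; apply: nali; split=> //.
  move=> j ji Aj; apply: (av j); split=> //=; split=> // -[_ /= kj].
  by apply: ji; apply: sep; [by right|by left|rewrite kj ki].
have cvgI : \int[Q]_w how_many (occupied B D A m) w @[m --> \oo] -->
    \int[Q]_w how_many (isolated B D A) w.
  have [||||//] := @dominated_convergence _ _ _ Q setT measurableT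
    (fun m => how_many (occupied B D A m)) (how_many (isolated B D A))
    (how_many (fun i => X i @^-1` D))
    (fun m => measurable_how_many (fun k => moccupied m k mB mD mA)).
  - exact: measurable_how_many.
  - apply: filterS2 aefin inj => w fw hinj _.
    have [|m0 hm0] := separated hinj fw.
      by move=> i /DAF/FP0.
    apply: cvg_near_cst; exists m0 => // m /= mm.
    by apply: eqE => i j Di Dj; apply: hm0.
  - apply/integrableP; split; first exact: measurable_how_many.
    rewrite (eq_integral (how_many (fun i => X i @^-1` D))); last first.
      by move=> w _; rewrite gee0_abs// how_many_ge0.
    by rewrite (le_lt_trans (mean_count_le mD DF))// -ge0_fin_numE//; exact: nu_fin DF.
  - by apply: aeW => w m _; rewrite gee0_abs ?how_many_ge0.
have Afin := nu_fin mA AF; have Dfin := nu_fin mD DF.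
have Cfin : Q (Y @^-1` B) * nu D * expeR (- nu A) \is a fin_num.
  by rewrite !fin_numM ?expeRN_fin_num// fin_num_measure//; exact: mpY.
have C0 : 0 <= Q (Y @^-1` B) * nu D * expeR (- nu A).
  by rewrite !mule_ge0// expeR_ge0.
set C := (X in _ = X); rewrite -/C in Cfin C0.
set L := (X in X = _).
have Lb e : (0 < e)%R -> (expR (- e))%:E * C <= L /\ L <= (expR e)%:E * C.
  move=> e0; have [m0 hm0] := sum_occupied mB mD mA DF AF e0.
  have hm m : (m0 <= m)%N -> (expR (- e))%:E * C <= \int[Q]_w how_many (occupied B D A m) w /\
      \int[Q]_w how_many (occupied B D A m) w <= (expR e)%:E * C.
    by move=> mm; rewrite integral_how_many; [exact: hm0|move=> k; exact: moccupied].
  rewrite /L -(cvg_lim _ cvgI)//; have cv : cvgn (fun m => \int[Q]_w how_many (occupied B D A m) w) by apply/cvg_ex; exists L.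
  split; [apply: lime_ge|apply: lime_le] => //; by exists m0 => // m /= /hm[].
have L0 : 0 <= L by apply: integral_ge0 => w _; exact: how_many_ge0.
have Lfin : L \is a fin_num.
  rewrite ge0_fin_numE// (le_lt_trans (Lb 1%R ltr01).2)//.
  by rewrite -(fineK Cfin) -EFinM ltry.
rewrite -(fineK Lfin) -(fineK Cfin); congr (_%:E); apply/eqP.
rewrite eq_le; apply/andP; split; apply: expR_squeeze; rewrite ?fine_ge0// => e e0.
  by rewrite -lee_fin EFinM !fineK//; have [] := Lb e e0.
rewrite -(ler_pM2l (expR_gt0 (- e))) mulrA -expRD addNr expR0 mul1r.
by rewrite -lee_fin EFinM !fineK//; have [] := Lb e e0.
Qed.

End campbell.

(** * Void regions that depend on the isolated point *)
Section ge0_integral_density.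
Local Open Scope ereal_scope.
Context {R : realType} {d1 d2} {T1 : measurableType d1} {T2 : measurableType d2}.
Variables (m : {measure set T2 -> \bar R}) (Lam : {measure set T1 -> \bar R}).
Variables (f : T1 -> T2) (h : T1 -> \bar R).
Hypotheses (mf : measurable_fun setT f) (mh : measurable_fun setT h).
Hypotheses (h0 : forall x, 0 <= h x) (hfin : forall x, h x \is a fin_num).
Hypothesis mE : forall C, measurable C -> m C = \int[Lam]_(x in f @^-1` C) h x.

Let mpre C : measurable C -> measurable (f @^-1` C).
Proof. by move=> mC; rewrite -[X in measurable X]setTI; exact: mf. Qed.

Let mEind C : measurable C -> m C = \int[Lam]_x ((\1_C (f x))%:E * h x).
Proof.
move=> mC; rewrite mE// integral_mkcond; apply: eq_integral => x _.
rewrite patchE indicE -[_ \in f @^-1` C]/(f x \in C).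
by case: ifPn; rewrite ?mul1e ?mul0e.
Qed.

Import HBNNSimple.

(** If m is the image by f of the measure of density h, integrals against m
    can be computed upstairs. *)
Lemma ge0_integral_density (phi : T2 -> \bar R) :
  measurable_fun setT phi -> (forall y, 0 <= phi y) ->
  \int[m]_y phi y = \int[Lam]_x (phi (f x) * h x).
Proof.
move=> mphi phi0.
pose a := nnsfun_approx measurableT mphi.
have aphi y : EFin \o a ^~ y @ \oo --> phi y.
  by apply: cvg_nnsfun_approx.
have nda y : nondecreasing_seq (fun n => (a n y)%:E).
  by move=> k n kn; rewrite lee_fin; exact/lefP/nd_nnsfun_approx.
have mah n : measurable_fun setT (fun x => (a n (f x))%:E * h x).
  by apply: emeasurable_funM => //; apply/measurable_EFinP; apply: measurableT_comp.
have -> : \int[m]_y phi y = limn (fun n => \int[m]_y (a n y)%:E).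
  rewrite -monotone_convergence//.
  - by apply: eq_integral => y _; apply/esym/cvg_lim => //; exact: aphi.
  - by move=> n; exact/measurable_EFinP.
  - by move=> n y _; rewrite lee_fin.
have -> : \int[Lam]_x (phi (f x) * h x) =
    limn (fun n => \int[Lam]_x ((a n (f x))%:E * h x)).
  rewrite -monotone_convergence//.
  - apply: eq_integral => x _; apply/esym/cvg_lim => //.
    by apply: cvgeZr => //; exact: aphi.
  - by move=> n x _; rewrite mule_ge0// lee_fin.
  - by move=> x _ k n kn; apply: lee_wpmul2r => //; exact: nda.
apply/congr_lim/funext => n.
under eq_integral do rewrite fimfunE -fsumEFin//.
rewrite ge0_integral_fsum//; last 2 first.
- by move=> r; exact/measurable_EFinP/measurable_funM.
- by move=> r y _; rewrite nnfun_muleindic_ge0.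
transitivity (\sum_(r \in range (a n))
    \int[Lam]_x ((r * \1_(a n @^-1` [set r]) (f x))%:E * h x)); last first.
  rewrite -ge0_integral_fsum//.
  - apply: eq_integral => x _; rewrite -ge0_mule_fsuml; last first.
      by move=> r; rewrite nnfun_muleindic_ge0.
    by rewrite fsumEFin// -fimfunE.
  - move=> r; apply: emeasurable_funM => //; apply/measurable_EFinP/measurable_funM => //.
    by apply: measurableT_comp.
  - by move=> r x _; rewrite mule_ge0// nnfun_muleindic_ge0.
apply: eq_fsbigr => r /set_mem[y _ ry].
have r0 : (0 <= r)%R by rewrite -ry.
have mr : measurable (a n @^-1` [set r]) by [].
under eq_integral do rewrite EFinM.
rewrite ge0_integralZl_EFin//; last exact/measurable_EFinP.
rewrite integral_indic// setIT mEind// -ge0_integralZl_EFin//.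
- by apply: eq_integral => x _; rewrite EFinM muleA.
- by move=> x _; rewrite mule_ge0// lee_fin.
- apply: emeasurable_funM => //; apply/measurable_EFinP.
  by apply: measurableT_comp.
Qed.

End ge0_integral_density.

Section slivnyak.
Local Open Scope ereal_scope.
Context {R : realType} {dO dT dP} {O : measurableType dO}
  {T : measurableType dT} {P : measurableType dP}.
Variables (Q : probability O R) (nu : {sigma_finite_measure set P -> \bar R})
  (P0 : set P) (F : nat -> set P) (kappa : nat -> P -> nat).
Hypothesis diss : dissecting nu P0 F kappa.
Variables (Y : O -> T) (X : nat -> O -> P).
Hypothesis pg : poisson_given Q nu P0 Y X.

Let mF n : measurable (F n). Proof. by have [[]] := diss. Qed.
Let FP0 n : F n `<=` P0.
Proof. by have [[_ _ -> _] _ _ _] := diss; exact: bigcup_sup. Qed.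
Let nuF n : nu (F n) < +oo. Proof. by have [[]] := diss. Qed.
Let ndF m n : (m <= n)%N -> F m `<=` F n.
Proof. by have [[_ h _ _] _ _ _] := diss; move=> /h/subsetPset. Qed.
Let mY : measurable_fun setT Y. Proof. by case: pg. Qed.
Let mX j : measurable_fun setT (X j). Proof. by case: pg. Qed.

(** Choosing a point among the X i amounts to working under the measure M,
    counting measure on the index times Q: Z is the chosen point together with
    Y, and W enumerates the other points, skipping the chosen index. Under M
    they behave as independent, so that [freezing] applies to them. *)
Let M : {measure set (nat * O) -> \bar R} := (counting \x Q)%E.
Let Z (p : nat * O) : T * P := (Y p.2, X p.1 p.2).
Let W (j : nat) (p : nat * O) : P := X (bump p.1 j) p.2.

Let measurable_nat_pair d (U : measurableType d) (f : nat -> O -> U) :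
  (forall i, measurable_fun setT (f i)) ->
  measurable_fun setT (fun p : nat * O => f p.1 p.2).
Proof.
move=> mf _ C mC; rewrite setTI.
have -> : (fun p : nat * O => f p.1 p.2) @^-1` C = \bigcup_i ([set i] `*` (f i @^-1` C)).
  apply/seteqP; split=> [[i w] /= Cf|[i w] [k _ [/= -> ]]//]; by exists i.
apply: bigcupT_measurable => i; apply: measurableX => //.
by rewrite -[X in measurable X]setTI; exact: mf.
Qed.

Let mZ : measurable_fun setT Z.
Proof.
apply: measurable_fun_pair; last exact: measurable_nat_pair.
by apply: measurableT_comp => //.
Qed.

Let mW j : measurable_fun setT (W j).
Proof. exact: (@measurable_nat_pair _ _ (fun i w => X (bump i j) w)). Qed.

Let ME E : M E = \sum_(i <oo) Q (xsection E i).
Proof. exact: (ge0_integral_count (fun i => measure_ge0 Q (xsection E i))). Qed.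

Let K (x : O * P) : T * P := (Y x.1, x.2).
Let mK : measurable_fun setT K.
Proof. by apply: measurable_fun_pair => //; exact: measurableT_comp. Qed.
Let mKpre C : measurable C -> measurable (K @^-1` C).
Proof. by move=> mC; rewrite -[X in measurable X]setTI; exact: mK. Qed.
Let mZpre C : measurable C -> measurable (Z @^-1` C).
Proof. by move=> mC; rewrite -[X in measurable X]setTI; exact: mZ. Qed.
Let mav A : measurable A -> measurable (avoid Z W A).
Proof. by move=> mA; exact: measurable_avoid. Qed.

Let YM : {mfun O >-> T} := HB.pack Y (isMeasurableFun.Build _ _ _ _ Y mY).
Let law : probability T R := distribution Q YM.

Let boxed n (C : set (T * P)) := C `&` (setT `*` F n).
Let mboxed n C : measurable C -> measurable (boxed n C).
Proof. by move=> mC; apply: measurableI => //; exact: measurableX. Qed.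

(** Campbell's formula gives this for rectangles C, and both sides are finite
    measures in C. *)
Let M_fixed n C A : measurable C -> measurable A -> A `<=` F n ->
  M (Z @^-1` (boxed n C) `&` avoid Z W (setT `*` A)) =
  (Q \x nu) (K @^-1` (boxed n C)) * expeR (- nu A).
Proof.
move=> mC mA AF.
have nufin D : measurable D -> D `<=` F n -> nu D \is a fin_num.
  by move=> mD DF; rewrite ge0_fin_numE// (le_lt_trans _ (nuF n))// le_measure ?inE.
have Afin := nufin A mA AF.
pose c : {nonneg R} := NngNum (expR_ge0 (- fine (nu A))).
have cE : expeR (- nu A) = c%:num%:E by rewrite -(fineK Afin).
have mV : measurable (Z @^-1` (setT `*` F n) `&` avoid Z W (setT `*` A)).
  by apply: measurableI; [apply: mZpre|apply: mav]; exact: measurableX.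
have mV' : measurable (K @^-1` (setT `*` F n)) by apply: mKpre; exact: measurableX.
pose m2 : {finite_measure set P -> \bar R} := mscale c (mfrestr (mF n) (nuF n)).
pose m'0 : {measure set (T * P) -> \bar R} := pushforward (mrestr M mV) Z.
pose m' := m'0 mZ.
pose m''0 : {measure set (T * P) -> \bar R} := mscale c (pushforward (mrestr (Q \x nu) mV') K).
pose m'' := m''0 mK.
have -> : M (Z @^-1` (boxed n C) `&` avoid Z W (setT `*` A)) = m' C.
  by rewrite /m' /pushforward /mrestr; congr (M _); rewrite setIA -preimage_setI.
have -> : (Q \x nu) (K @^-1` (boxed n C)) * expeR (- nu A) = m'' C.
  by rewrite cE muleC.
rewrite -(@product_measure_unique _ _ _ _ _ law m2 m')//; last first.
  move=> B D mB mD; rewrite /m' /pushforward /mrestr /m2 /= /mscale /mfrestr /mrestr /=.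
  rewrite /distribution /pushforward /=.
  have -> : Z @^-1` (B `*` D) `&` (Z @^-1` (setT `*` F n) `&` avoid Z W (setT `*` A)) =
     Z @^-1` (B `*` (D `&` F n)) `&` avoid Z W (setT `*` A).
    by rewrite setIA -preimage_setI -setXI setIT.
  rewrite ME.
  have DF : D `&` F n `<=` F n by move=> x [].
  have mDF : measurable (D `&` F n) by exact: measurableI.
  rewrite muleCA muleC -cE -(campbell diss pg mB mDF mA DF AF).
  apply: eq_eseriesr => i _; congr (Q _); apply/seteqP; split=> w; rewrite /xsection/= inE.
    move=> [[/= Bw Dw] av]; split=> // j ji Aj.
    have ij : i != j by apply/eqP => ij; apply: ji.
    have := av (unbump i j); rewrite /W /= unbumpK//; last by rewrite inE eq_sym.
    by apply.
  move=> [[Bw Dw] al]; split=> // j [_ /=]; apply: al => /eqP.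
  by rewrite eq_sym (negbTE (neq_bump _ _)).
apply: product_measure_unique => //.
move=> B D mB mD; rewrite /m'' /m2 /= /mscale /= /distribution /pushforward /mfrestr /mrestr.
have -> : K @^-1` (B `*` D) `&` K @^-1` (setT `*` F n) = (Y @^-1` B) `*` (D `&` F n).
  by apply/seteqP; split=> -[w q] /=; [move=> [[? ?] [_ ?]]|move=> [? [? ?]]].
rewrite product_measure1E//; first by rewrite muleCA.
- by rewrite -[X in measurable X]setTI; exact: mY.
- exact: measurableI.
Qed.

Let M_total n C : measurable C ->
  M (Z @^-1` (boxed n C)) = (Q \x nu) (K @^-1` (boxed n C)).
Proof.
move=> mC; have := @M_fixed n C set0 mC measurable0 (sub0set _).
rewrite measure0 oppe0 expeR0 mule1 => <-; congr (M _).
by apply/seteqP; split=> [p Cp|p []//]; split=> // j [].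
Qed.

Let boxed_id n C : C `<=` setT `*` F n -> boxed n C = C.
Proof. by move=> CF; apply/seteqP; split=> [x []//|x Cx]; split=> //; exact: CF. Qed.

Let boxT_fin n : (Q \x nu) (K @^-1` (setT `*` F n)) < +oo.
Proof.
have -> : K @^-1` (setT `*` F n) = setT `*` F n by apply/seteqP; split.
by rewrite product_measure1E// [X in X * _]probability_setT mul1e.
Qed.

Let ae_finite k : {ae M, forall p, finite_set [set j | F k (W j p)]}.
Proof.
have [N [mN QN hN]] := ae_finite_hits diss pg (mF k) (@subset_refl _ (F k)).
exists (setT `*` N); split.
- exact: measurableX.
- rewrite ME eseries0// => i _ _.
  rewrite (_ : xsection _ _ = N)//; apply/seteqP; split=> w; rewrite /xsection/= inE.
    by case.
  by split.
- move=> [i w] /= hp; split=> //=; apply: hN => fw; apply: hp.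
  rewrite (_ : [set j | _] = bump i @^-1` [set j | F k (X j w)])//.
  by apply: finite_preimage => // a b _ _ /(congr1 (unbump i)); rewrite !bumpK.
Qed.

Let void_rate (A : set ((T * P) * P)) (x : T * P) : \bar R := expeR (- nu (xsection A x)).

Let measurable_void_rate A : measurable A -> measurable_fun setT (void_rate A).
Proof.
move=> mA; apply: (@measurable_expeR _ _ _ (fun x => - nu (xsection A x))).
apply: measurableT_comp => //; exact: measurable_fun_xsection.
Qed.

Let mboxedP k (A : set ((T * P) * P)) : measurable A -> measurable (A `&` (setT `*` F k)).
Proof. by move=> mA; apply: measurableI => //; exact: measurableX. Qed.

Let transfer n C (phi : T * P -> \bar R) : measurable C ->
  measurable_fun setT phi -> (forall x, 0 <= phi x) ->
  \int[M]_(p in Z @^-1` (boxed n C)) phi (Z p) =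
  \int[Q \x nu]_(x in K @^-1` (boxed n C)) phi (K x).
Proof.
move=> mC mphi phi0; have mb := mboxed n mC.
rewrite -[LHS](@ge0_integral_pushforward _ _ _ _ _ Z mZ M (boxed n C) phi)//; last exact: measurable_funTS.
rewrite -[RHS](@ge0_integral_pushforward _ _ _ _ _ K mK (Q \x nu) (boxed n C) phi)//; last exact: measurable_funTS.
apply: eq_measure_integral => D mD DC; rewrite /pushforward -(boxed_id (n := n) (C := D)); first exact: M_total.
by move=> x /DC[].
Qed.

Let slivnyak_box n k C (A : set ((T * P) * P)) : measurable C -> measurable A ->
  M (Z @^-1` (boxed n C) `&` avoid Z W (A `&` (setT `*` F k))) =
  \int[Q \x nu]_(x in K @^-1` (boxed n C)) void_rate (A `&` (setT `*` F k)) (K x).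
Proof.
move=> mC mA; have mb := mboxed n mC.
rewrite -(@transfer n C (void_rate (A `&` (setT `*` F k))) mC (measurable_void_rate (mboxedP k mA))); last first.
  by move=> x; exact: expeR_ge0.
apply: (@freezing _ _ _ _ _ _ _ M nu Z W (setT `*` F n)) => //.
- exact: measurableX.
- by rewrite -(boxed_id (n := n) (C := setT `*` F n))// M_total ?boxed_id//; exact: measurableX.
- by apply: filterS (ae_finite k).
- move=> B D mB BF mD DF; pose m := maxn n k.
  have BE : B = boxed m B.
    rewrite boxed_id// => x /BF[? Fx]; split=> //; apply: ndF Fx; exact: leq_maxl.
  rewrite BE M_total// -M_fixed// => x /DF; apply: ndF; exact: leq_maxr.
- by move=> x [].
Qed.

(** A point chosen at random from a Poisson process sees the others as an
    undisturbed Poisson process: the void probability of the region A seen from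
    it is exp(-nu) of that region. *)
Lemma slivnyak C (A : set ((T * P) * P)) : measurable C -> C `<=` setT `*` P0 ->
  measurable A -> A `<=` setT `*` P0 ->
  (forall x, C x -> nu (xsection A x) < +oo) ->
  \sum_(i <oo) Q [set w | C (Y w, X i w) /\
    forall j, j <> i -> ~ A ((Y w, X i w), X j w)] =
  \int[Q \x nu]_(x in K @^-1` C) expeR (- nu (xsection A (Y x.1, x.2))).
Proof.
move=> mC CP0 mA AP0 Afin.
have P0E : P0 = \bigcup_n F n by have [[]] := diss.
have ndbox U (B : set (U * P)) a b : (a <= b)%N -> B `&` (setT `*` F a) `<=` B `&` (setT `*` F b).
  by move=> ab x [Bx [_ Fx]]; split=> //; split=> //; exact: ndF Fx.
have -> : \sum_(i <oo) Q [set w | C (Y w, X i w) /\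
    forall j, j <> i -> ~ A ((Y w, X i w), X j w)] = M (Z @^-1` C `&` avoid Z W A).
  rewrite ME; apply: eq_eseriesr => i _; congr (Q _).
  apply/seteqP; split=> w; rewrite /xsection/= inE.
    move=> [Cw al]; split=> // j; apply: al => /eqP.
    by rewrite eq_sym (negbTE (neq_bump _ _)).
  move=> [Cw av]; split=> // j ji Aj.
  have ij : i != j by apply/eqP => ij; apply: ji.
  have := av (unbump i j); rewrite /W /= unbumpK//; last by rewrite inE eq_sym.
have step n : M (Z @^-1` (boxed n C) `&` avoid Z W A) =
    \int[Q \x nu]_(x in K @^-1` (boxed n C)) void_rate A (K x).
  have mb := mboxed n mC.
  have KC : (Q \x nu) (K @^-1` (boxed n C)) < +oo.
    apply: le_lt_trans (boxT_fin n); rewrite le_measure ?inE//; [exact: mKpre| |by move=> x []].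
    by apply: mKpre; exact: measurableX.
  (* remove the box on the void region by dominated convergence *)
  have cvgR : \int[Q \x nu]_(x in K @^-1` (boxed n C)) void_rate (A `&` (setT `*` F k)) (K x)
      @[k --> \oo] --> \int[Q \x nu]_(x in K @^-1` (boxed n C)) void_rate A (K x).
    apply: (@dominated_cvg _ _ _ (Q \x nu)%E _ (mKpre mb) _ _ (cst 1)) => //.
    - move=> k; apply: measurable_funTS.
      by apply: (measurableT_comp (measurable_void_rate (mboxedP k mA))).
    - move=> x [Cx _]; rewrite /void_rate.
      have fin : nu (xsection A (K x)) \is a fin_num by rewrite ge0_fin_numE// Afin.
      rewrite -(fineK fin); apply: cvg_expeRN; rewrite fineK//.
      have -> : xsection A (K x) = \bigcup_k xsection (A `&` (setT `*` F k)) (K x).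
        apply/seteqP; split=> q; rewrite /xsection/= ?inE.
          move=> Aq; have [_ /=] := AP0 _ Aq; rewrite P0E => -[k _ Fk].
          by exists k => //=; rewrite inE.
        by move=> [k _] /=; rewrite inE => -[].
      apply: nondecreasing_cvg_mu.
      + by move=> k; exact: (measurable_xsection _ (mboxedP k mA)).
      + by apply: bigcupT_measurable => k; exact: (measurable_xsection _ (mboxedP k mA)).
      + by move=> a b ab; apply/subsetPset => q; rewrite /xsection/= !inE; exact: ndbox.
    - apply/integrableP; split=> //; rewrite (eq_integral (cst 1)) => [|w _]; last by rewrite abse1.
      by rewrite integral_cst ?mul1e//; exact: mKpre.
    - by move=> k x _; rewrite gee0_abs ?expeR_ge0// expeRN_le1.
  rewrite -(cvg_lim _ cvgR)//; apply/esym/cvg_lim => //.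
  under eq_cvg => k do rewrite -slivnyak_box//.
  have -> : Z @^-1` (boxed n C) `&` avoid Z W A =
      \bigcap_k (Z @^-1` (boxed n C) `&` avoid Z W (A `&` (setT `*` F k))).
    apply/seteqP; split=> [p [Bp av] k _|p h]; first by split=> // j [Aj _]; exact: (av j).
    split; first by have [] := h 0%N I.
    move=> j Aj; have [_ /=] := AP0 _ Aj; rewrite P0E => -[k _ Fk].
    by have [_ /(_ j)] := h k I; apply; split.
  have mE k : measurable (Z @^-1` (boxed n C) `&` avoid Z W (A `&` (setT `*` F k))).
    by apply: measurableI; [exact: mZpre|exact: (mav (mboxedP k mA))].
  apply: nonincreasing_cvg_mu => //.
  - apply: (@le_lt_trans _ _ (M (Z @^-1` (boxed n C)))); last by rewrite M_total.
    by rewrite le_measure ?inE//; exact: mZpre.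
  - by apply: bigcap_measurable => // k _; exact: mE.
  - by move=> a b ab; apply/subsetPset; apply: setIS; apply: avoidS; exact: ndbox.
(* remove the box on the chosen point by monotone convergence *)
have CE : C = \bigcup_n boxed n C.
  apply/seteqP; split=> [x Cx|x [n _ []]//].
  by have [_] := CP0 _ Cx; rewrite P0E => -[n _ Fn]; exists n.
have ZC : Z @^-1` C `&` avoid Z W A = \bigcup_n (Z @^-1` (boxed n C) `&` avoid Z W A).
  by rewrite -setI_bigcupl -preimage_bigcup -CE.
have lhs : M (Z @^-1` (boxed n C) `&` avoid Z W A) @[n --> \oo] --> M (Z @^-1` C `&` avoid Z W A).
  rewrite ZC; apply: nondecreasing_cvg_mu.
  - by move=> n; apply: measurableI; [exact: (mZpre (mboxed n mC))|exact: mav].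
  - by rewrite -ZC; apply: measurableI; [exact: mZpre|exact: mav].
  - by move=> a b ab; apply/subsetPset; apply: setSI => p; exact: ndbox.
rewrite -(cvg_lim _ lhs)//; apply/cvg_lim => //.
under eq_cvg do rewrite step.
have -> : K @^-1` C = \bigcup_n K @^-1` (boxed n C) by rewrite -preimage_bigcup -CE.
apply: ge0_nondecreasing_set_cvg_integral.
- by move=> a b ab; apply/subsetPset => x; exact: ndbox.
- by move=> n; exact: (mKpre (mboxed n mC)).
- by move=> n; apply: measurable_funTS; apply: (measurableT_comp (measurable_void_rate mA)).
- by move=> n x _; exact: expeR_ge0.
Qed.

End slivnyak.

(** * Lebesgue measure on the half-line *)
Section half_line.
Local Open Scope ereal_scope.
Context {R : realType}.

(** The second factor of the intensity, as a measure on R with its standard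
    sigma-algebra; Lebesgue measure itself lives on a copy of R. *)
Definition half_line : set R -> \bar R :=
  mrestr lebesgue_measure (measurable_itv `[0%R, +oo[).

Let leb0 : {measure set (measurableTypeR R) -> \bar R} :=
  mrestr lebesgue_measure (measurable_itv `[0%R, +oo[).

HB.instance Definition _ := isMeasure.Build _ R R half_line
  (measure0 leb0) (measure_ge0 leb0) (@measure_semi_sigma_additive _ _ _ leb0).

Let half_line_sigma_finite : sigma_finite setT half_line.
Proof.
have /sigma_finiteP[F [TF ndF Foo]] := sigma_finiteT (@lebesgue_measure R).
exists F => // i; have [mFi Fi] := Foo i; split=> //.
rewrite /half_line /mrestr; apply: le_lt_trans Fi; rewrite le_measure ?inE//.
by apply: measurableI => //; exact: measurable_itv.
Qed.

HB.instance Definition _ := Measure_isSigmaFinite.Build _ _ _ half_line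
  half_line_sigma_finite.

Lemma half_lineE (A : set R) :
  half_line A = lebesgue_measure (A `&` [set` `[0%R, +oo[]).
Proof. by []. Qed.

Lemma half_line_le_lebesgue (A : set R) : measurable A ->
  half_line A <= lebesgue_measure A.
Proof.
move=> mA; rewrite [leLHS]half_lineE le_measure ?inE//.
by apply: measurableI => //; exact: measurable_itv.
Qed.

Lemma lebesgue_measure_translate (c : R) (A : set R) : measurable A ->
  lebesgue_measure [set x | A (x - c)%R] = lebesgue_measure A.
Proof.
move=> mA.
have mt : measurable_fun setT (fun x : measurableTypeR R => (x - c)%R : measurableTypeR R).
  exact: measurable_funB.
pose m0 : {measure set (measurableTypeR R) -> \bar R} :=
  pushforward lebesgue_measure (fun x : measurableTypeR R => (x - c)%R : measurableTypeR R).
pose m := m0 mt.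
rewrite -[LHS]/(m A); apply/esym/lebesgue_measure_unique => // _ [[a b]] _ <-.
rewrite /m /m0 /= /pushforward.
rewrite (_ : _ @^-1` _ = [set` `](a + c)%R, (b + c)%R]]); last first.
  by apply/seteqP; split=> x /=; rewrite !in_itv/= ltrBrDr lerBlDr.
by rewrite !lebesgue_measure_itv/= !lte_fin ltrD2r; case: ifP => // _; rewrite -!EFinB; congr (_%:E); ring.
Qed.

(** Lebesgue measure is translation invariant; the set A, moved up by c, leaves
    room for an interval of length c below it. *)
Lemma half_line_raise (c : R) (A : set R) : measurable A -> (0 <= c)%R ->
  (forall x, A x -> (0 <= x)%R) ->
  half_line [set x | (0 <= x)%R /\ ((x <= c)%R \/ A (x - c)%R)] = c%:E + half_line A.
Proof.
move=> mA c0 A0.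
have mAc : measurable [set x : R | A (x - c)%R].
  rewrite -[X in measurable X]setTI.
  have mt : measurable_fun setT (fun x : R => (x - c)%R) by exact: measurable_funB.
  exact: mt.
have mgt : measurable [set x : R | (c < x)%R].
  by rewrite -set_itvoy; exact: measurable_itv.
have m0 : measurable [set x : R | (0 < x)%R].
  by rewrite -set_itvoy; exact: measurable_itv.
have -> : half_line A = lebesgue_measure (A `&` [set x | (0 < x)%R]).
  rewrite half_lineE.
  have -> : A `&` [set` `[0%R, +oo[] = (A `&` [set x | (0 < x)%R]) `|` (A `&` [set 0%R]).
    apply/seteqP; split=> x /=; rewrite in_itv/= andbT.
      move=> [Ax]; rewrite le_eqVlt => /orP[/eqP x0|x0]; [by right|by left].
    by move=> [[Ax /ltW]|[Ax x0]]; split=> //; rewrite x0.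
  have n0 : lebesgue_measure (A `&` [set 0%R : R]) = 0.
    apply: (subset_measure0 _ _ _ (lebesgue_measure_set1 0%R)) => //.
    exact: measurableI.
  rewrite measureU//; last 3 first.
  - exact: measurableI.
  - exact: measurableI.
  - by apply/seteqP; split=> x // [[_ /= x0] [_ /= x00]]; move: x0; rewrite x00 ltxx.
  by rewrite [X in _ + X = _]n0 adde0.
have -> : half_line [set x | (0 <= x)%R /\ ((x <= c)%R \/ A (x - c)%R)] =
    lebesgue_measure ([set` `[0%R, c]] `|` ([set x | A (x - c)%R] `&` [set x | (c < x)%R])).
  rewrite half_lineE; congr (lebesgue_measure _).
  apply/seteqP; split=> x /=; rewrite !in_itv/= andbT.
    move=> [[x0 h] _]; have [xc|xc] := leP x c; first by left; rewrite x0.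
    by right; split=> //; case: h => // xc'; move: xc; rewrite ltNge xc'.
  move=> [/andP[x0 xc]|[Ax cx]]; first by split=> //; split=> //; left.
  have x0 : (0 <= x)%R by rewrite (le_trans c0)// ltW.
  by split=> //; split=> //; right.
rewrite measureU//; last 2 first.
- exact: measurableI.
- apply/seteqP; split=> x // [/= +[_ /= cx]]; rewrite in_itv/= => /andP[_ xc].
  by move: cx; rewrite ltNge xc.
congr (_ + _).
  rewrite [LHS]lebesgue_measure_itv/= lte_fin; case: ifPn => [_|]; first by rewrite oppr0 adde0.
  by rewrite -leNgt => c0'; congr (_%:E); apply/eqP; rewrite eq_le c0 c0'.
rewrite -(@lebesgue_measure_translate c); last exact: measurableI.
by congr (lebesgue_measure _); apply/seteqP; split=> x /= []; rewrite subr_gt0.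
Qed.

Lemma ge0_integral_half_line (f : R -> \bar R) : measurable_fun setT f ->
  (forall x, 0 <= f x) ->
  \int[half_line]_x f x = \int[lebesgue_measure]_(x in `[0%R, +oo[) f x.
Proof.
move=> mf f0; rewrite (@ge0_integral_density _ _ _ (measurableTypeR R) R half_line lebesgue_measure id
  (fun x => (\1_(`[0%R, +oo[) x)%:E))//.
- rewrite [RHS]integral_mkcond; apply: eq_integral => x _.
  by rewrite patchE indicE; case: ifPn; rewrite ?mule1 ?mule0.
- apply/measurable_EFinP; exact: measurable_indic.
- by move=> C mC; rewrite [LHS]half_lineE integral_indic// setIC.
Qed.

Lemma integral_exp_tail (a c : R) : (0 < c)%R ->
  \int[lebesgue_measure]_(x in `[a, +oo[) (expR (- (x / c)))%:E =
  (c * expR (- (a / c)))%:E.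
Proof.
move=> c0.
pose G (x : R) := (- (c * expR (- (x / c))))%R.
have dG (x : R) : is_derive x 1%R G (expR (- (x / c))).
  have h1 : is_derive (x : R^o) (1%R : R^o) (fun y : R^o => - (y / c) : R^o)%R (- c^-1 : R^o)%R.
    have := @is_deriveZ R R^o R^o id (- c^-1)%R x 1%R 1%R (is_derive_id (x : R^o) 1%R).
    rewrite /GRing.scale/= mulr1; congr (is_derive _ _ _ _).
    by apply/funext => y; exact: (etrans (mulNr c^-1 y) (congr1 -%R (mulrC c^-1 y)))%R.
  have h2 : is_derive (x : R^o) (1%R : R^o) (fun y : R^o => expR (- (y / c)) : R^o)%R (- c^-1 * expR (- (x / c)) : R^o)%R.
    have := @is_derive1_comp R expR (fun y : R => - (y / c))%R x _ _ (is_derive_expR _) h1.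
    by rewrite mulrC.
  have := @is_deriveZ R R^o R^o _ (- c)%R x 1%R _ h2.
  rewrite /GRing.scale/= mulrA mulNr mulrN opprK mulfV ?gt_eqF// mul1r; congr (is_derive _ _ _ _).
  by apply/funext => y; exact: (mulNr c (expR (- (y / c))))%R.
have cf : continuous (fun x : R => expR (- (x / c)))%R.
  move=> x; apply: (@continuous_comp _ _ _ (fun x : R => - (x / c))%R expR).
    by apply: continuousN; apply: continuousM => //; exact: cst_continuous.
  exact: continuous_expR.
rewrite (@ge0_continuous_FTC2y _ _ G _ 0)//.
- by rewrite sub0e /G -EFinN opprK.
- exact: continuous_subspaceT.
- rewrite -oppr0; apply: cvgN; rewrite -(mulr0 c); apply: cvgM; first exact: cvg_cst.
  apply: (@cvg_comp _ _ _ (fun x : R => x / c)%R (fun x : R => expR (- x))%R _ (pinfty_nbhs R)); last exact: cvgr_expR.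
  rewrite (_ : (fun x : R => x / c)%R = (fun x : R => c^-1 * x)%R); last by apply/funext => x; rewrite mulrC.
  by apply: gt0_cvgMry; [rewrite invr_gt0|exact: cvg_id].
- apply/cvg_at_right_filter/differentiable_continuous/derivable1_diffP.
  by have [] := dG a.
- by move=> x _; rewrite derive1E; have [_ ->] := dG x.
Qed.

End half_line.

(** * One step of the construction *)
Lemma measurable_fun_inv (R : realType) d (T : measurableType d) (f : T -> R) :
  (forall x, 0 <= f x) -> measurable_fun setT f ->
  measurable_fun setT (fun x => (f x)^-1).
Proof.
move=> f0 mf; rewrite (_ : (fun x => (f x)^-1) = (fun x => f x `^ (-1))).
  by apply: (measurableT_comp (measurable_powR (-1))).
by apply/funext => x; rewrite powR_inv1.
Qed.

Section intensity.
Local Open Scope ereal_scope.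
Context {R : realType} {dU} {U : measurableType dU}.
Variable mu : {sigma_finite_measure set U -> \bar R}.

Definition intensity : set (U * R)%type -> \bar R := (mu \x half_line)%E.

HB.instance Definition _ := Measure.copy intensity (mu \x half_line)%E.

Let intensity_sigma_finite : sigma_finite setT intensity.
Proof.
have /sigma_finiteP[F [TF ndF Foo]] := sigma_finiteT mu.
have /sigma_finiteP[G [TG ndG Goo]] := sigma_finiteT (@half_line R).
apply/sigma_finiteP; exists (fun k => F k `*` G k); split.
- rewrite -setXTT TF TG; apply/seteqP; split=> [[x y] [/= [n _ Fx] [k _ Gy]]|[x y] [n _ [/= Fx Gy]]].
    exists (maxn n k) => //; split=> /=.
      by move: x Fx; exact/subsetPset/ndF/leq_maxl.
    by move: y Gy; exact/subsetPset/ndG/leq_maxr.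
  by split; exists n.
- move=> a b ab; apply/subsetPset => -[x y] [/= Fx Gy]; split=> /=.
    by move: x Fx; exact/subsetPset/ndF.
  by move: y Gy; exact/subsetPset/ndG.
- move=> k; have [mFk Fk] := Foo k; have [mGk Gk] := Goo k.
  split; first exact: measurableX.
  by rewrite [ltLHS]product_measure1E// lte_mul_pinfty// ge0_fin_numE.
Qed.

HB.instance Definition _ := Measure_isSigmaFinite.Build _ _ _ intensity
  intensity_sigma_finite.

End intensity.

Section step.
Local Open Scope ereal_scope.
Context {R : realType} {dU dT dT' dO} {U : measurableType dU}
  {T : measurableType dT} {T' : measurableType dT'} {O : measurableType dO}.
Variables (mu : {sigma_finite_measure set U -> \bar R}) (g : U -> U -> R).
Hypotheses (g_ge0 : forall z x, (0 <= g z x)%R)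
  (g_measurable : measurable_fun setT (fun p : U * U => g p.1 p.2))
  (g_density : forall z, \int[mu]_x (g z x)%:E = 1).

Let nu : {sigma_finite_measure set (U * R)%type -> \bar R} := intensity mu.

(** Atoms of negative height are dummies: they stand for used atoms. *)
Definition alive : set (U * R)%type := [set p | 0 <= p.2]%R.

(** Lower the atoms by t g(z, .): this region is void if and only if all heights
    remain positive and the lowered atoms avoid A. *)
Definition raised (t : R) (z : U) (A : set (U * R)%type) : set (U * R)%type :=
  [set q | 0 <= q.2 /\ (q.2 <= t * g z q.1 \/ A (q.1, q.2 - t * g z q.1))]%R.

Let measurable_g z : measurable_fun setT (g z).
Proof. exact: (measurableT_comp g_measurable (pair1_measurable z)). Qed.

(** Above each x the section of A moves up by t g(z, x), and t g(z, .) has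
    integral t. The term t is the exponential clock; the term nu A says that
    the lowered process is again Poisson of intensity nu. *)
Lemma measure_raised t z A : (0 <= t)%R -> measurable A -> A `<=` alive ->
  nu (raised t z A) = t%:E + nu A.
Proof.
move=> t0 mA A0.
have E x : half_line (xsection (raised t z A) x) = (t * g z x)%:E + half_line (xsection A x).
  rewrite -half_line_raise.
  - congr (half_line _); apply/seteqP; split=> v; rewrite /xsection/= !in_setE.
      by move=> [? [?|?]]; split=> //; [left|right].
    by move=> [? [?|?]]; split=> //; [left|right].
  - exact: measurable_xsection.
  - exact: mulr_ge0.
  - by move=> v; rewrite /xsection/= inE => /A0.
rewrite [LHS](_ : _ = \int[mu]_x half_line (xsection (raised t z A) x))//.
rewrite (eq_integral (fun x => (t * g z x)%:E + half_line (xsection A x))); last by move=> x _; exact: E.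
rewrite ge0_integralD//.
- congr (_ + _).
  under eq_integral do rewrite EFinM.
  by rewrite ge0_integralZl_EFin//; [rewrite g_density mule1|move=> x _; rewrite lee_fin|exact/measurable_EFinP].
- by move=> x _; rewrite lee_fin mulr_ge0.
- by apply/measurable_EFinP; exact: measurable_funM.
- exact: measurable_fun_xsection.
Qed.

(** An atom (x, v) is reached at time v / g(z, x); the substitution v = t g(z, x)
    turns the intensity into g(z, x) dt mu(dx), and the integral over x gives
    the tail of an exponential variable. *)
Lemma integral_clock_tail z u : (0 <= u)%R ->
  \int[nu]_(p in [set p : U * R | 0 < g z p.1 /\ u * g z p.1 <= p.2]%R)
    (expR (- (p.2 / g z p.1)))%:E = (expR (- u))%:E.
Proof.
move=> u0.
have mg1 : measurable_fun setT (fun p : U * R => g z p.1).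
  by apply: measurableT_comp => //.
have mD : measurable [set p : U * R | 0 < g z p.1 /\ u * g z p.1 <= p.2]%R.
  apply: measurableI.
    by rewrite -[X in measurable X]setTI; apply: measurable_fun_ltr.
  by rewrite -[X in measurable X]setTI; apply: measurable_fun_ler => //; exact: measurable_funM.
rewrite integral_mkcond.
set f := (X in integral _ _ X).
have mf : measurable_fun setT f.
  apply: (measurable_restrictT _ mD).1; apply: measurable_funTS.
  apply/measurable_EFinP; apply: measurableT_comp => //; apply: measurableT_comp => //.
  by apply: measurable_funM => //; apply: measurable_fun_inv.
have f0 p : 0 <= f p by rewrite /f; apply: erestrict_ge0 => *; rewrite lee_fin expR_ge0.
rewrite fubini_tonelli1//.
rewrite (eq_integral (fun x => (expR (- u))%:E * (g z x)%:E)); last first.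
  move=> x _; rewrite /fubini_F.
  have mfx : measurable_fun setT (fun y => f (x, y)) by exact: (measurableT_comp mf (pair1_measurable x)).
  rewrite ge0_integral_half_line//.
  have := g_ge0 z x; rewrite le_eqVlt => /orP[/eqP g0|g0].
    rewrite -g0 mule0 integral0_eq// => y _.
    by rewrite /f patchE memNset//= -g0 => -[]; rewrite ltxx.
  rewrite -EFinM mulrC -[in RHS](mulfK (lt0r_neq0 g0) u) -integral_exp_tail//.
  rewrite [LHS]integral_mkcond [RHS]integral_mkcond; apply: eq_integral => y _.
  rewrite !patchE.
  have [y0|y0] := boolP (y \in `[0%R, +oo[%classic); have [yu|yu] := boolP (y \in `[(u * g z x)%R, +oo[%classic).
  - rewrite mem_set//=; split=> //; by move: yu; rewrite inE/= in_itv/= andbT.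
  - rewrite memNset//= => -[_ h]; move: yu; rewrite notin_setE/= in_itv/= andbT; apply; exact: h.
  - exfalso; move: y0; rewrite notin_setE/= in_itv/= andbT; apply.
    by move: yu; rewrite inE/= in_itv/= andbT; apply: le_trans; rewrite mulr_ge0.
  - by [].
rewrite ge0_integralZl_EFin//; first by rewrite g_density mule1.
- by move=> x _; rewrite lee_fin.
- exact/measurable_EFinP.
Qed.

Variables (Q : probability O R) (F : nat -> set (U * R)%type)
  (kappa : nat -> U * R -> nat).
Hypothesis diss : dissecting nu alive F kappa.
Variables (Y : O -> T) (X : nat -> O -> U * R).
Hypothesis pg : poisson_given Q nu alive Y X.
Variables (z0 : T -> U).
Hypothesis mz0 : measurable_fun setT z0.

Let mY : measurable_fun setT Y. Proof. by case: pg. Qed.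
Let mX j : measurable_fun setT (X j). Proof. by case: pg. Qed.

(** The component z0 of the state Y is the current point of the chain. *)
Definition rate (y : T) (x : U) : R := g (z0 y) x.

Definition clock (x : T * (U * R)) : R := (x.2.2 / rate x.1 x.2.1)%R.

Definition may_ring : set (T * (U * R)) :=
  [set x | 0 <= x.2.2 /\ 0 < rate x.1 x.2.1]%R.

Definition rings_first (i : nat) : set O :=
  [set w | may_ring (Y w, X i w) /\ forall j, j <> i -> (0 <= (X j w).2)%R ->
    (clock (Y w, X i w) * rate (Y w) (X j w).1 < (X j w).2)%R].

Let measurable_rate d (V : measurableType d) (a : V -> T) (b : V -> U) :
  measurable_fun setT a -> measurable_fun setT b ->
  measurable_fun setT (fun v => rate (a v) (b v)).
Proof.
move=> ma mb; have h : measurable_fun setT (fun v => (z0 (a v), b v)).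
  by apply: measurable_fun_pair => //; exact: measurableT_comp.
exact: (measurableT_comp g_measurable h).
Qed.

Let measurable_clock : measurable_fun setT clock.
Proof.
apply: measurable_funM; first by do 2 apply: measurableT_comp => //.
apply: measurable_fun_inv; first by move=> x; exact: g_ge0.
by apply: measurable_rate => //; apply: measurableT_comp => //.
Qed.

Let measurable_le_set d (V : measurableType d) (a b : V -> R) :
  measurable_fun setT a -> measurable_fun setT b -> measurable [set v | a v <= b v]%R.
Proof. by move=> ma mb; rewrite -[X in measurable X]setTI; exact: measurable_fun_ler. Qed.

Let measurable_lt_set d (V : measurableType d) (a b : V -> R) :
  measurable_fun setT a -> measurable_fun setT b -> measurable [set v | a v < b v]%R.
Proof. by move=> ma mb; rewrite -[X in measurable X]setTI; exact: measurable_fun_ltr. Qed.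

Let mpre d1 d2 (V1 : measurableType d1) (V2 : measurableType d2) (f : V1 -> V2) B :
  measurable_fun setT f -> measurable B -> measurable (f @^-1` B).
Proof. by move=> mf mB; rewrite -[X in measurable X]setTI; exact: mf. Qed.

Let measurable_may_ring : measurable may_ring.
Proof.
apply: measurableI.
  by apply: measurable_le_set => //; do 2 apply: measurableT_comp => //.
apply: measurable_lt_set => //; apply: measurable_rate => //.
by apply: measurableT_comp => //.
Qed.

(** The section at x = (y, p) is the region that has to be void for p to ring
    first and for the other atoms, once lowered, to avoid A. *)
Let late (A : set (U * R)) : set ((T * (U * R)) * (U * R)) :=
  [set xq | 0 <= clock xq.1 /\ raised (clock xq.1) (z0 xq.1.1) A xq.2]%R.

Let measurable_late A : measurable A -> measurable (late A).
Proof.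
move=> mA.
have mc : measurable_fun setT (fun xq : (T * (U * R)) * (U * R) => clock xq.1).
  exact: measurableT_comp.
have mr : measurable_fun setT (fun xq : (T * (U * R)) * (U * R) =>
    (clock xq.1 * g (z0 xq.1.1) xq.2.1)%R).
  apply: measurable_funM => //.
  by apply: measurable_rate; [apply: measurableT_comp => //|apply: measurableT_comp => //].
have mv : measurable_fun setT (fun xq : (T * (U * R)) * (U * R) => xq.2.2).
  by apply: measurableT_comp => //.
apply: measurableI; first exact: measurable_le_set.
apply: measurableI; first exact: measurable_le_set.
apply: measurableU; first exact: measurable_le_set.
apply: (@mpre _ _ _ _ (fun xq : (T * (U * R)) * (U * R) =>
  (xq.2.1, xq.2.2 - clock xq.1 * g (z0 xq.1.1) xq.2.1)%R)) => //.
apply: measurable_fun_pair; first by apply: measurableT_comp => //.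
exact: measurable_funB.
Qed.

Let xsection_late A x : (0 <= clock x)%R ->
  xsection (late A) x = raised (clock x) (z0 x.1) A.
Proof.
move=> c0; apply/seteqP; split=> q; rewrite /xsection/= in_setE; first by case.
by move=> ?; split.
Qed.

Let late_at (C : set (T * (U * R))) A (i : nat) : set O :=
  [set w | C (Y w, X i w) /\ forall j, j <> i -> ~ late A ((Y w, X i w), X j w)].

Let measurable_late_at C A i : measurable C -> measurable A -> measurable (late_at C A i).
Proof.
move=> mC mA.
have mYX : measurable_fun setT (fun w => (Y w, X i w)) by exact: measurable_fun_pair.
apply: measurableI; first exact: (mpre mYX mC).
rewrite [X in measurable X](_ : _ = \bigcap_j (if j == i then setT else
  (fun w => ((Y w, X i w), X j w)) @^-1` (~` late A))).
  apply: bigcapT_measurable => j; case: eqP => // _.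
  apply: mpre; last by apply: measurableC; exact: measurable_late.
  exact: measurable_fun_pair.
apply/seteqP; split=> w /= h j.
  by move=> _; case: eqP => //= ji; exact: h.
by move=> ji; have := h j I; case: eqP.
Qed.

Let K (x : O * (U * R)) : T * (U * R) := (Y x.1, x.2).
Let mK : measurable_fun setT K.
Proof. by apply: measurable_fun_pair => //; exact: measurableT_comp. Qed.

Let weight (C : set (T * (U * R))) : \bar R :=
  \int[Q \x nu]_(x in K @^-1` C) (expR (- clock (K x)))%:E.

Let clock_ge0 x : may_ring x -> (0 <= clock x)%R.
Proof. by move=> [x0 /ltW ?]; rewrite divr_ge0. Qed.

(** Slivnyak's formula, where [measure_raised] makes the contribution of A
    split off as a factor. *)
Let sum_late_at C A : measurable C -> C `<=` may_ring -> measurable A -> A `<=` alive ->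
  nu A < +oo -> \sum_(i <oo) Q (late_at C A i) = weight C * expeR (- nu A).
Proof.
move=> mC CD mA A0 Afin.
have nuA : nu A \is a fin_num by rewrite ge0_fin_numE.
have rE x : C x -> nu (xsection (late A) x) = (clock x)%:E + nu A.
  by move=> /CD/clock_ge0 c0; rewrite xsection_late// measure_raised.
rewrite (@slivnyak _ _ _ _ _ _ _ Q nu alive F kappa diss Y X pg C (late A))//.
- rewrite /weight muleC -(fineK nuA) /= -ge0_integralZl_EFin//.
  + apply: eq_integral => x /set_mem Cx; rewrite [xsection _ _](_ : _ = xsection (late A) (K x))//.
    by rewrite rE// -(fineK nuA) /= opprD expRD EFinM muleC.
  + exact: mpre.
  + apply: measurable_funTS; apply/measurable_EFinP; apply: measurableT_comp => //.
    apply: measurableT_comp => //; exact: measurableT_comp.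
- by move=> x /CD[].
- exact: measurable_late.
- by move=> [x q] [_ []].
- by move=> x /rE ->; rewrite lte_add_pinfty ?ltry.
Qed.

Let weight_unfold (psi : T * (U * R) -> \bar R) : measurable_fun setT psi ->
  (forall x, 0 <= psi x) ->
  \int[Q \x nu]_(x in K @^-1` may_ring) psi (K x) =
  \int[Q]_w \int[nu]_(p in [set p | may_ring (Y w, p)]) psi (Y w, p).
Proof.
move=> mpsi psi0; rewrite integral_mkcond fubini_tonelli1//.
- apply: eq_integral => w _; rewrite /fubini_F [RHS]integral_mkcond.
  by apply: eq_integral => p _; rewrite !patchE.
- apply: (measurable_restrictT _ (mpre mK measurable_may_ring)).1; apply: measurable_funTS.
  exact: measurableT_comp.
- by move=> x; apply: erestrict_ge0.
Qed.

Let measurable_expclock : measurable_fun setT (fun x => (expR (- clock x))%:E).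
Proof.
apply/measurable_EFinP; apply: measurableT_comp => //; exact: measurableT_comp.
Qed.

Let weight_may_ring : weight may_ring = 1.
Proof.
rewrite /weight (weight_unfold measurable_expclock); last by move=> x; rewrite lee_fin expR_ge0.
rewrite (eq_integral (fun=> 1)); first by rewrite integral_cst// mul1e; exact: probability_setT.
move=> w _; have := integral_clock_tail (z0 (Y w)) (lexx 0%R); rewrite oppr0 expR0 => <-.
congr (integral _ _ _); apply/seteqP; split=> p /=; rewrite /may_ring /= mul0r; first by case.
by case.
Qed.

Let rings_firstE i : rings_first i = late_at may_ring set0 i.
Proof.
apply/seteqP; split=> w [Dw h]; split=> // j ji.
  move=> [c0 [v0 [le|//]]]; have := h j ji v0.
  by move=> /(le_lt_trans le); rewrite ltxx.
move=> v0; rewrite ltNge; apply/negP => le; apply: (h j ji).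
by split; [exact: clock_ge0|split=> //; left].
Qed.

Let mfirst i : measurable (rings_first i).
Proof. by rewrite rings_firstE; exact: measurable_late_at. Qed.

Lemma rings_first_unique i j w : rings_first i w -> rings_first j w -> i = j.
Proof.
move=> [[vi gi] hi] [[vj gj] hj]; have [//|ij] := pselect (i = j).
have := hi j (nesym ij) vj.
have := hj i ij vi.
rewrite -ltr_pdivlMr// -[in X in _ -> X]ltr_pdivlMr//.
by move=> /lt_trans h /h; rewrite ltxx.
Qed.

Let trivIset_first : trivIset setT rings_first.
Proof. by move=> i j _ _ [w [fi fj]]; exact: rings_first_unique fi fj. Qed.

Let Q_first : Q (\bigcup_i rings_first i) = 1.
Proof.
rewrite measure_semi_bigcup//; last exact: bigcupT_measurable.
under eq_eseriesr do rewrite rings_firstE.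
by rewrite sum_late_at// ?measure0// weight_may_ring oppe0 expeR0 mule1.
Qed.

Let Q_nofirst : Q (~` \bigcup_i rings_first i) = 0.
Proof. by rewrite probability_setC ?Q_first ?subee//; exact: bigcupT_measurable. Qed.

(** The events that atom i rings first are disjoint in i, and their
    probabilities add up to the total mass of the exponential law. *)
Lemma ae_rings_first : {ae Q, forall w, exists i, rings_first i w}.
Proof.
exists (~` \bigcup_i rings_first i); split.
- by apply: measurableC; exact: bigcupT_measurable.
- exact: Q_nofirst.
- by move=> w h [i _ fi]; apply: h; exists i.
Qed.

Variables (Y' : O -> T') (X' : nat -> O -> U * R) (next : T * (U * R) -> T').
(** Y' is the state after the first ring, and X' the family of atoms lowered and
    stripped of the one that rang. On the null event where no atom rings
    first, both are arbitrary. *)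
Hypotheses (mY' : measurable_fun setT Y') (mX' : forall j, measurable_fun setT (X' j))
  (mnext : measurable_fun setT next).
Hypothesis Y'E : forall i w, rings_first i w -> Y' w = next (Y w, X i w).
Hypothesis X'E : forall i j w, rings_first i w -> j <> i -> (0 <= (X j w).2)%R ->
  X' j w = ((X j w).1, (X j w).2 - clock (Y w, X i w) * rate (Y w) (X j w).1)%R.
Hypothesis X'dead : forall i j w, rings_first i w -> j = i \/ ((X j w).2 < 0)%R ->
  ((X' j w).2 < 0)%R.

(** The event splits according to the atom that rings first, and then says that
    the region [late A] seen from that atom contains no other atom. *)
Let step_law B A : measurable B -> measurable A -> A `<=` alive -> nu A < +oo ->
  Q (Y' @^-1` B `&` avoid Y' X' (setT `*` A)) =
  weight (may_ring `&` next @^-1` B) * expeR (- nu A).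
Proof.
move=> mB mA A0 Afin.
have mnB := mpre mnext mB.
have mC : measurable (may_ring `&` next @^-1` B) by exact: measurableI.
have mE : measurable (Y' @^-1` B `&` avoid Y' X' (setT `*` A)).
  by apply: measurableI; [exact: mpre|apply: measurable_avoid => //; exact: measurableX].
rewrite -sum_late_at//.
have mU : measurable (\bigcup_i rings_first i) by exact: bigcupT_measurable.
have -> : Q (Y' @^-1` B `&` avoid Y' X' (setT `*` A)) =
    Q ((Y' @^-1` B `&` avoid Y' X' (setT `*` A)) `&` \bigcup_i rings_first i).
  rewrite [LHS](measureDI _ _ mU)// [X in X + _](_ : _ = 0) ?add0e//.
  apply: (@subset_measure0 _ _ _ Q _ (~` \bigcup_i rings_first i)).
  - exact: measurableD.
  - exact: measurableC.
  - by move=> w [].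
  - exact: Q_nofirst.
rewrite setI_bigcupr measure_semi_bigcup//; last 3 first.
- by move=> i; exact: measurableI.
- exact: trivIset_setIl.
- by rewrite -setI_bigcupr; exact: measurableI.
apply: eq_eseriesr => i _; congr (Q _); apply/seteqP; split=> w.
  move=> [[Bw av] fi]; have [Dw hw] := fi.
  split; first by split=> //; rewrite /= -(Y'E fi).
  move=> j ji [_ [/= v0 [le|Aj]]].
    by have := hw j ji v0; rewrite ltNge le.
  by apply: (av j); split=> //=; rewrite (X'E fi ji v0).
move=> [[Dw /= Bw] h].
have fi : rings_first i w.
  rewrite rings_firstE; split=> // j ji [c0 [v0 [le|//]]].
  by apply: (h j ji); split=> //; split=> //; left.
split=> //; split; first by rewrite /= (Y'E fi).
move=> j [_ /= Aj]; have [ji|ji] := pselect (j = i).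
  by have := X'dead fi (or_introl ji); rewrite ltNge (A0 _ Aj).
have [v0|v0] := leP 0%R (X j w).2; last first.
  by have := X'dead fi (or_intror v0); rewrite ltNge (A0 _ Aj).
apply: (h j ji); split; first exact: clock_ge0.
by split=> //; right; move: Aj; rewrite (X'E fi ji v0).
Qed.

Let Q_Y' B : measurable B -> Q (Y' @^-1` B) = weight (may_ring `&` next @^-1` B).
Proof.
move=> mB; have := @step_law B set0 mB measurable0 (sub0set _).
rewrite measure0 oppe0 expeR0 mule1 => <-//; congr (Q _).
by apply/seteqP; split=> [w Bw|w []//]; split=> // j [].
Qed.

(** The void probability factors as the law of Y' times exp(-nu A): the lowered
    atoms have forgotten which atom rang, and when. *)
Lemma poisson_given_step : poisson_given Q nu alive Y' X'.
Proof.
split=> //; last by move=> B A mB mA A0 Afin; rewrite step_law// Q_Y'.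
have [_ _ dist _] := pg.
apply: filterS2 dist ae_rings_first => w dw [i fi] a b ab a0 Xab.
have alive_not j : (0 <= (X' j w).2)%R -> j <> i /\ (0 <= (X j w).2)%R.
  move=> j0; split; first by move=> ji; have := X'dead fi (or_introl ji); rewrite ltNge j0.
  by rewrite leNgt; apply/negP => jn; have := X'dead fi (or_intror jn); rewrite ltNge j0.
have [ai va] := alive_not a a0.
have [bi vb] := alive_not b (eq_ind _ (fun p => (0 <= p.2)%R) a0 _ Xab).
apply: (dw a b ab va); move: Xab; rewrite (X'E fi ai va) (X'E fi bi vb).
case: (X a w) (X b w) => [xa ua] [xb ub] /= [-> +].
by move=> /addIr ->.
Qed.

(** Taking A empty in the law of the step gives the transition kernel. *)
Lemma integral_step (phi : T' -> \bar R) : measurable_fun setT phi ->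
  (forall y, 0 <= phi y) ->
  \int[Q]_w phi (Y' w) = \int[Q]_w \int[nu]_(p in [set p | may_ring (Y w, p)])
    (phi (next (Y w, p)) * (expR (- clock (Y w, p)))%:E).
Proof.
move=> mphi phi0.
pose m0 : {measure set T' -> \bar R} := pushforward Q Y'.
pose m := m0 mY'.
have -> : \int[Q]_w phi (Y' w) = \int[m]_y phi y.
  by rewrite [RHS](@ge0_integral_pushforward _ _ _ _ _ Y' mY' Q setT phi).
have mD := mpre mK measurable_may_ring.
pose h x := (((fun x => (expR (- clock (K x)))%:E) \_ (K @^-1` may_ring)) x : \bar R).
have h0 x : 0 <= h x by apply: erestrict_ge0 => ? _; rewrite lee_fin expR_ge0.
rewrite (@ge0_integral_density _ _ _ _ _ m (Q \x nu)%E (next \o K) h)//.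
- rewrite -(@weight_unfold (fun x => phi (next x) * (expR (- clock x))%:E)).
  + rewrite [RHS]integral_mkcond; apply: eq_integral => x _.
    by rewrite /h !patchE; case: ifPn => //; rewrite mule0.
  + by apply: emeasurable_funM => //; exact: measurableT_comp.
  + by move=> x; rewrite mule_ge0// lee_fin expR_ge0.
- exact: measurableT_comp.
- apply: (measurable_restrictT _ mD).1; apply: measurable_funTS.
  exact: (measurableT_comp measurable_expclock mK).
- by move=> x; rewrite /h patchE; case: ifP.
- move=> C mC; rewrite -[LHS]/(Q (Y' @^-1` C)) Q_Y'// /weight.
  rewrite [RHS]integral_mkcond [LHS]integral_mkcond; apply: eq_integral => x _.
  rewrite /h !patchE preimage_setI -comp_preimage in_setI.
  by case: (x \in _ @^-1` C); rewrite ?andbT ?andbF.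
Qed.

End step.

(** * Separable metric spaces and their Borel sets *)
Lemma separable_countable_base (R : realType) (S : completePMetricType R) :
  separable S -> exists U : nat -> set S, (forall n, open (U n)) /\
    forall x V, nbhs x V -> exists n, U n x /\ U n `<=` V.
Proof.
move=> [D /countable_injP[f finj] dD].
exists (fun n => if unpickle n is Some (a, b) then
  \bigcup_(x in [set x | D x /\ f x = a]) (ball x (b.+1%:R^-1 : R))° else set0).
split=> [n|x V].
  case: unpickle => [[a b]|]; last exact: open0.
  by apply: bigcup_open => x _; exact: open_interior.
move=> /nbhs_ballP[e /= e0 xeV].
have [b be] : exists b : nat, (b.+1%:R^-1 < e / 2 :> R).
  have := near_infty_natSinv_lt (PosNum (divr_gt0 e0 (ltr0Sn R 1))).
  by move=> [b _ /(_ b (leqnn b))] /= ?; exists b.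
set r := (b.+1%:R^-1 : R) in be; have r0 : 0 < r by rewrite invr_gt0.
have [q [xq Dq]] : ((ball x (r / 2))° `&` D) !=set0.
  apply: dD; last exact: open_interior.
  by exists x; apply: nbhsx_ballx; rewrite divr_gt0.
exists (pickle (f q, b)); rewrite pickleK; split.
  exists q => //; apply/nbhs_ballP; exists (r / 2); first by rewrite /= divr_gt0.
  move=> y xy; rewrite -/r (splitr r); apply: (@ball_triangle _ _ x) => //.
  by apply: ball_sym; exact: interior_subset xq.
move=> y [q' [Dq' fq'] /interior_subset q'y]; apply: xeV.
have qq : q' = q by apply: finj; rewrite ?inE.
rewrite qq in q'y.
rewrite (splitr e); apply: (@ball_triangle _ _ q).
  by apply: le_ball (interior_subset xq); lra.
by apply: le_ball q'y; exact: ltW.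
Qed.

Section borel_separable.
Context {R : realType} {S : completePMetricType R}.
Hypothesis S_separable : separable S.

Lemma open_borel (U : set S) : open U -> measurable (U : set (borel S)).
Proof. by move=> oU; exact: sub_sigma_algebra. Qed.

(** A countable base separates points. *)
Lemma separating_opens : exists U : nat -> set S, (forall n, open (U n)) /\
  forall x y, x <> y -> exists n, U n x /\ ~ U n y.
Proof.
have [U [oU bU]] := separable_countable_base S_separable.
exists U; split=> // x y xy; have e0 : 0 < mdist x y by rewrite mdist_gt0; exact/eqP.
have [n [Ux UA]] := bU x _ (nbhsx_ballx x _ e0).
by exists n; split=> // /UA; rewrite ballEmdist/= ltxx.
Qed.

(** The diagonal is measurable because countably many open sets separate
    points. *)
Lemma measurable_eq_set d (V : measurableType d) (f h : V -> borel S) :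
  measurable_fun setT f -> measurable_fun setT h -> measurable [set v | f v = h v].
Proof.
move=> mf mh; have [U [oU sU]] := separating_opens.
have mp (k : V -> borel S) n : measurable_fun setT k -> measurable (k @^-1` U n).
  by move=> mk; rewrite -[X in measurable X]setTI; apply: mk => //; exact: open_borel.
have -> : [set v | f v = h v] =
    \bigcap_n ~` ((f @^-1` U n `&` ~` (h @^-1` U n)) `|` (h @^-1` U n `&` ~` (f @^-1` U n))).
  apply/seteqP; split=> [v /= fh n _ /=|v hv]; first by rewrite fh => -[[]|[]].
  apply: contrapT => /sU[n [Uf Uh]]; apply: (hv n I); by left.
apply: bigcapT_measurable => n; apply: measurableC; apply: measurableU; apply: measurableI.
- exact: mp.
- by apply: measurableC; exact: mp.
- exact: mp.
- by apply: measurableC; exact: mp.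
Qed.

Lemma measurable_borel1 (x : S) : measurable ([set x] : set (borel S)).
Proof.
have := @measurable_eq_set _ (borel S) id (cst x) (@measurable_id _ _ _) (@measurable_cst _ _ _ _ _ _).
by rewrite (_ : [set v | _] = [set x]).
Qed.

(** By local compactness the members of a countable base that lie in a compact
    set cover the space. *)
Lemma radon_sigma_finite (mu : {measure set (borel S) -> \bar R}) :
  locally_compact [set: S] -> radon mu -> sigma_finite setT mu.
Proof.
move=> lc rad; have [U [oU bU]] := separable_countable_base S_separable.
pose E n := if `[< exists K : set S, compact K /\ U n `<=` K >] then U n else set0.
exists E; last first.
  move=> n; rewrite /E; case: asboolP => [[K [cK UK]]|_]; last first.
    by split; rewrite ?measure0// ltry.
  have mU : measurable (U n : set (borel S)) by exact: open_borel.
  split=> //; apply: le_lt_trans (rad K cK); rewrite le_measure ?inE//.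
  have /closed_openC/open_borel := compact_closed (@metric_hausdorff _ S) cK.
  by move=> /measurableC; rewrite setCK.
apply/seteqP; split=> // x _.
have [V xV [cV _]] := lc x I.
have {}xV : nbhs (x : S) V.
  by apply: (@filterS S (nbhs (x : S)) _ _ _ (fun y (h : setT y -> V y) => h I) xV).
have [n [Ux UV]] := bU x V xV.
by exists n => //; rewrite /E; case: asboolP => // h; exfalso; apply: h; exists V.
Qed.

Lemma measurable_fibers d (V : measurableType d) (f : V -> nat) :
  (forall k, measurable (f @^-1` [set k])) -> measurable_fun setT f.
Proof.
move=> mf _ B _; rewrite setTI (_ : _ @^-1` _ = \bigcup_(k in B) f @^-1` [set k]).
  by apply: bigcup_measurable => k _; exact: mf.
by apply/seteqP; split=> [v Bv|v [k Bk /= vk]]; [exists (f v)|rewrite vk].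
Qed.

Lemma measurable_nat2 d (V : measurableType d) (f h : V -> nat) (op : nat -> nat -> nat) :
  measurable_fun setT f -> measurable_fun setT h ->
  measurable_fun setT (fun v => op (f v) (h v)).
Proof.
move=> mf mh; apply: measurable_fibers => k.
have mp (u : V -> nat) i : measurable_fun setT u -> measurable (u @^-1` [set i]).
  by move=> mu; rewrite -[X in measurable X]setTI; exact: mu.
rewrite (_ : _ @^-1` _ = \bigcup_i \bigcup_(j in [set j | op i j = k])
    (f @^-1` [set i] `&` h @^-1` [set j])).
  apply: bigcupT_measurable => i; apply: bigcup_measurable => j _.
  by apply: measurableI; exact: mp.
apply/seteqP; split=> [v vk|v [i _ [j /= ijk [/= fi hj]]]]; last by rewrite fi hj.
by exists (f v) => //; exists (h v).
Qed.

(** Cells are products. In S, a cell records which of the first m separating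
    open sets contain the point, written in binary. In height, it is a slice of
    width 1/(m + 1), and this alone makes the cells small: a cell in the window
    E n x [0, n) has measure at most mu (E n) / (m + 1). *)
Lemma dissecting_intensity (mu : {sigma_finite_measure set (borel S) -> \bar R}) :
  exists F kappa, dissecting (intensity mu) (@alive R _ (borel S)) F kappa.
Proof.
have [U [oU sU]] := separating_opens.
have /sigma_finiteP[E [TE ndE Eoo]] := sigma_finiteT mu.
have ndE' a b : (a <= b)%N -> E a `<=` E b by move=> /ndE/subsetPset.
(* binary code of the memberships of x in the first m separating sets *)
pose c := fix c m (x : S) := if m is m'.+1 then ((x \in U m') + (c m' x).*2)%N else 0%N.
have mc m : measurable_fun [set: borel S] (c m).
  elim: m => [|m IH]; first exact: measurable_cst.
  apply: (@measurable_nat2 _ (borel S) (fun x : borel S => ((x : S) \in U m) : nat) (c m) (fun a b => (a + b.*2)%N)) => //.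
  apply: (@measurableT_comp _ _ _ _ _ _ (fun b : bool => b : nat)) => //.
  apply: (measurable_fun_bool true); rewrite setTI (_ : _ @^-1` _ = U m); first exact: open_borel.
  by apply/seteqP; split=> y /=; [move/set_mem|move/mem_set].
have csep m n x y : (n < m)%N -> c m x = c m y -> (x \in U n) = (y \in U n).
  elim: m => // m IH; rewrite ltnS leq_eqVlt => nm cE.
  have bE : (x \in U m) = (y \in U m).
    by have := congr1 odd cE; rewrite /= !oddD !odd_double !addbF; do 2 case: (_ \in _).
  case/orP: nm => [/eqP ->//|nm]; apply: IH => //.
  by have := cE; rewrite /= bE => /addnI/double_inj.
pose fl m (v : R) := pickle (Num.floor (m.+1%:R * v)).
have mfl m : measurable_fun setT (fl m).
  apply: measurable_fibers => k; case E0 : (unpickle k : option int) => [z|]; last first.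
    rewrite (_ : _ @^-1` _ = set0)//; apply/seteqP; split=> // v /= vk.
    by move: E0; rewrite -vk /fl pickleK.
  have [zk|zk] := eqVneq (pickle z) k; last first.
    rewrite (_ : _ @^-1` _ = set0)//; apply/seteqP; split=> // v /= vk.
    by move: E0 zk; rewrite -vk /fl pickleK => -[<-]; rewrite eqxx.
  rewrite (_ : _ @^-1` _ = (fun v => m.+1%:R * v) @^-1` [set` `[z%:~R, (z + 1)%:~R[]).
    rewrite -[X in measurable X]setTI; have mm : measurable_fun setT (fun v : R => m.+1%:R * v).
      exact: measurable_funM.
    by apply: mm => //; exact: measurable_itv.
  apply/seteqP; split=> v /=; rewrite in_itv/=.
    rewrite /fl -zk => /(pcan_inj pickleK) <-; exact: floor_itv.
  by rewrite -floor_eq /fl => /eqP ->.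
exists (fun n => E n `*` [set` `[0, n%:R[]).
exists (fun m x => pickle (c m x.1, fl m x.2)); split.
- split.
  + by move=> n; apply: measurableX; [exact: (Eoo n).1|exact: measurable_itv].
  + move=> a b ab; apply/subsetPset => -[x v] [/= Ex].
    rewrite in_itv/= => /andP[v0 va]; split=> /=.
      exact: ndE' Ex.
    by rewrite in_itv/= v0 (lt_le_trans va)// ler_nat.
  + apply/seteqP; split=> [[x v] /= v0|[x v] [n _ [_ /=]]]; last by rewrite in_itv/= => /andP[].
    have : (\bigcup_i E i) x by rewrite -TE.
    move=> [n _ En]; exists (maxn n (Num.truncn v).+1) => //; split=> /=.
      by apply: ndE' En; exact: leq_maxl.
    rewrite in_itv/=; apply/andP; split=> //; apply: lt_le_trans (truncnS_gt v) _.
    by rewrite ler_nat leq_maxr.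
  + move=> n; have [mE Efin] := Eoo n.
    rewrite [ltLHS]product_measure1E//.
    rewrite lte_mul_pinfty// ?ge0_fin_numE//.
    apply: (@le_lt_trans _ _ (lebesgue_measure [set` `[0 : R, n%:R[])).
      by apply: half_line_le_lebesgue; exact: measurable_itv.
    by rewrite lebesgue_measure_itv/=; case: ifP => _; rewrite ?ltry// -EFinB ltry.
- move=> m; apply: (@measurable_nat2 _ _ (fun x : borel S * R => c m x.1)
    (fun x : borel S * R => fl m x.2) (fun a b => pickle (a, b))).
  + by apply: (measurableT_comp (mc m)).
  + by apply: (measurableT_comp (mfl m)).
- move=> [x u] [y v] xy; have [xy1|xy1] := pselect (x = y); last first.
    have [n [Ux Uy]] := sU x y xy1.
    exists n.+1 => m nm /(pcan_inj pickleK)[/(csep _ _ _ _ nm) h _].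
    by apply: Uy; apply/set_mem; rewrite -h mem_set.
  have uv : u != v by apply/eqP => uv; apply: xy; rewrite xy1 uv.
  have d0 : 0 < `|u - v| by rewrite normr_gt0 subr_eq0.
  exists (Num.truncn `|u - v|^-1) => m mm /(pcan_inj pickleK)[_ /(pcan_inj pickleK) fE].
  have /andP[] := floor_itv (m.+1%:R * u); rewrite fE => l1 h1.
  have /andP[l2 h2] := floor_itv (m.+1%:R * v).
  have : m.+1%:R * `|u - v| < 1.
    rewrite -[m.+1%:R]ger0_norm// -normrM mulrBr ltr_norml.
    by rewrite intrD in h1 h2; apply/andP; split; lra.
  rewrite -ltr_pdivlMr// div1r ltNge => /negP; apply.
  by apply: (le_trans (ltW (truncnS_gt _))); rewrite ler_nat.
- move=> n e e0; have [mE Efin] := Eoo n.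
  have Ef : mu (E n) \is a fin_num by rewrite ge0_fin_numE.
  exists (Num.truncn (fine (mu (E n)) / e)) => m mm k.
  case E0 : (unpickle k : option (nat * nat)) => [[a b]|]; last first.
    rewrite (_ : _ `&` _ = set0) ?measure0 ?lee_fin ?ltW//.
    apply/seteqP; split=> // -[x v] [_ /= vk]; by move: E0; rewrite -vk pickleK.
  have [->|/set0P[[x0 w0] [/= [Ex0 _] k0]]] := eqVneq ((E n `*` [set` `[0, n%:R[]) `&`
      (fun x : borel S * R => pickle (c m x.1, fl m x.2)) @^-1` [set k]) set0.
    by rewrite measure0 lee_fin ltW.
  pose z := Num.floor (m.+1%:R * w0).
  have m0 : (0 : R) < m.+1%:R by [].
  apply: (@le_trans _ _ (intensity mu (E n `*` [set` `[z%:~R / m.+1%:R, (z + 1)%:~R / m.+1%:R[]))).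
    rewrite le_measure ?inE//.
    + apply: measurableI; first by apply: measurableX => //; exact: measurable_itv.
      rewrite -[X in measurable X]setTI.
      have mk : measurable_fun setT (fun x : borel S * R => pickle (c m x.1, fl m x.2)).
        apply: (@measurable_nat2 _ _ (fun x : borel S * R => c m x.1)
          (fun x : borel S * R => fl m x.2) (fun a b => pickle (a, b))).
          by apply: (measurableT_comp (mc m)).
        by apply: (measurableT_comp (mfl m)).
      exact: mk.
    + by apply: measurableX => //; exact: measurable_itv.
    + move=> [x w] [/= [Ex _]]; rewrite -k0 => /(pcan_inj pickleK)[_ /(pcan_inj pickleK) wE].
      split=> //=; rewrite in_itv/= ler_pdivrMr// ltr_pdivlMr// ![w * _]mulrC /z -wE.
      exact: floor_itv.
  rewrite [leLHS]product_measure1E//.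
  apply: (@le_trans _ _ (mu (E n) * (m.+1%:R^-1)%:E)%E).
    rewrite lee_wpmul2l//.
    apply: (@le_trans _ _ (lebesgue_measure [set` `[z%:~R / m.+1%:R, (z + 1)%:~R / m.+1%:R[ : interval R])).
      by apply: half_line_le_lebesgue; exact: measurable_itv.
    rewrite lebesgue_measure_itv/=; case: ifP => _; last by rewrite lee_fin invr_ge0.
    by rewrite -EFinB lee_fin intrD -mulrBl addrAC subrr add0r div1r.
  rewrite -(fineK Ef) -EFinM lee_fin ler_pdivrMr// mulrC -ler_pdivrMr//.
  by apply: (le_trans (ltW (truncnS_gt _))); rewrite ler_nat.
Qed.

End borel_separable.

(** * Pathwise properties of soft local times *)
Section slt_facts.
Context {R : realType} {T : choiceType}.
Variables (g : T -> T -> R) (E : set (T * R)) (z0 Delta : T).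
Hypothesis g_ge0 : forall z z', 0 <= g z z'.

Definition slt_gap (n : nat) : R := slt_incr g E (slt g E z0 n).

Fixpoint hit_by (n : nat) : bool :=
  if n is m.+1 then hit_by m || (slt_chain g E z0 m.+1 == Delta) else false.

(** Local time stopped at T_Delta. The recursive form is the one that matches the
    Markov chain; [stopped_local_timeE] relates it to the hitting time. *)
Fixpoint stopped_local_time (n : nat) (z : T) : R :=
  if n is m.+1 then stopped_local_time m z +
    (if hit_by m then 0 else slt_gap m * g (slt_chain g E z0 m) z) else 0.

Lemma slt_gap_ge0 n : 0 <= slt_gap n.
Proof.
rewrite /slt_gap /slt_incr; set A := (X in inf X).
have [->|/set0P A0] := eqVneq A set0; first by rewrite inf0.
by apply: lb_le_inf => // t [].
Qed.

Lemma soft_local_timeS n z : soft_local_time g E z0 n.+1 z =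
  soft_local_time g E z0 n z + slt_gap n * g (slt_chain g E z0 n) z.
Proof. by []. Qed.

Lemma hit_byP n : reflect (exists k, [/\ (0 < k)%N, (k <= n)%N & slt_chain g E z0 k = Delta]) (hit_by n).
Proof.
elim: n => [|n IH] /=; first by constructor => -[k []]; case: k.
apply: (iffP orP) => [[/IH[k [k0 kn kD]]|/eqP nD]|[k [k0]]].
- by exists k; split=> //; exact: leqW.
- by exists n.+1.
rewrite leq_eqVlt => /orP[/eqP -> /eqP|kn kD]; [by right|left].
by apply/IH; exists k.
Qed.

Lemma hit_by_hitting_time n : hit_by n =
  if hitting_time g E z0 Delta is Some m then (m <= n)%N else false.
Proof.
rewrite /hitting_time; case: pselect => [h|h].
  case: ex_minnP => m /andP[m0 /eqP mD] mmin; apply/idP/idP => [/hit_byP[k [k0 kn /eqP kD]]|mn].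
    by apply: leq_trans kn; apply: mmin; rewrite k0 kD.
  by apply/hit_byP; exists m.
apply/negbTE/negP => /hit_byP[k [k0 kn kD]]; apply: h; exists k.
by rewrite k0 kD eqxx.
Qed.

Lemma until_hittingS k : until_hitting g E z0 Delta k.+1 <-> ~~ hit_by k.
Proof.
by rewrite hit_by_hitting_time /until_hitting; case: hitting_time => // m; rewrite -ltnNge.
Qed.

Lemma stopped_local_timeE n z : stopped_local_time n z = soft_local_time g E z0
  (if hitting_time g E z0 Delta is Some m then minn n m else n) z.
Proof.
elim: n => [|n IH]; first by case: hitting_time => // m; rewrite min0n.
rewrite /= IH hit_by_hitting_time; case: hitting_time => [m|]; last by [].
have [mn|nm] := leqP m n; first by rewrite addr0 (minn_idPr (leqW mn)).
by rewrite (minn_idPl nm).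
Qed.

Lemma nondecreasing_stopped_local_time z :
  nondecreasing_seq (stopped_local_time ^~ z).
Proof.
apply/nondecreasing_seqP => n /=; rewrite lerDl; case: ifP => // _.
by rewrite mulr_ge0// slt_gap_ge0.
Qed.

(** Whether or not Delta is ever hit, G at T_Delta is the limit of the stopped
    local times, which are nondecreasing. *)
Lemma soft_local_time_hitE z : soft_local_time_hit g E z0 Delta z =
  ereal_sup (range (fun n => (stopped_local_time n z)%:E)).
Proof.
have nd : nondecreasing_seq (fun n => (stopped_local_time n z)%:E).
  by move=> a b ab; rewrite lee_fin; exact: nondecreasing_stopped_local_time.
rewrite /soft_local_time_hit; case ht : hitting_time => [m|].
  apply/eqP; rewrite eq_le; apply/andP; split.
    apply: ereal_sup_ubound; exists m => //; by rewrite stopped_local_timeE ht minnn.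
  apply: ge_ereal_sup => _ [n _ <-]; rewrite lee_fin.
  have -> : soft_local_time g E z0 m z = stopped_local_time (maxn n m) z.
    by rewrite stopped_local_timeE ht (minn_idPr (leq_maxr _ _)).
  exact/nondecreasing_stopped_local_time/leq_maxl.
have /cvg_lim <- // := ereal_nondecreasing_cvgn nd.
by apply/congr_lim/funext => n; rewrite stopped_local_timeE ht.
Qed.

Lemma visitsE (Gamma : set T) : visits g E z0 Delta Gamma = counting
  [set k | (0 < k)%N /\ ~~ hit_by k.-1 /\ Gamma (slt_chain g E z0 k)].
Proof.
rewrite /visits; congr counting; apply/seteqP; split=> -[|k] /= [] // _ [h ?].
  by split=> //; split=> //; exact/until_hittingS.
by split=> //; split=> //; exact/until_hittingS.
Qed.

End slt_facts.

(** * Measurability of the construction *)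
Section slt_measurable.
Context {R : realType} {S : completePMetricType R}.
Hypothesis S_separable : separable S.
Context {d} {Omega : measurableType d}.
Variables (g : S -> S -> R) (z0 : S) (X : nat -> Omega -> borel S * R).
Hypotheses (g_ge0 : forall z z', 0 <= g z z')
  (g_measurable : measurable_fun [set: borel S * borel S]
    (fun p : borel S * borel S => g p.1 p.2)).
Hypothesis mX : forall i, measurable_fun setT (X i).

Let atoms w : set (S * R) := range (X ^~ w).
Let st w n := slt g (atoms w) z0 n.

Let mpre d1 d2 (V1 : measurableType d1) (V2 : measurableType d2) (f : V1 -> V2) B :
  measurable_fun setT f -> measurable B -> measurable (f @^-1` B).
Proof. by move=> mf mB; rewrite -[X in measurable X]setTI; exact: mf. Qed.

Let mle (a b : Omega -> R) : measurable_fun setT a -> measurable_fun setT b ->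
  measurable [set w | a w <= b w].
Proof. by move=> ma mb; rewrite -[X in measurable X]setTI; exact: measurable_fun_ler. Qed.

Let meq (f h : Omega -> borel S * R) : measurable_fun setT f -> measurable_fun setT h ->
  measurable [set w | f w = h w].
Proof.
move=> mf mh.
rewrite (_ : mkset _ = [set w | (f w).1 = (h w).1] `&` [set w | (f w).2 = (h w).2]).
  apply: measurableI.
    apply: (measurable_eq_set S_separable); exact: measurableT_comp.
  rewrite (_ : mkset _ = (fun w => (f w).2 - (h w).2) @^-1` [set 0]).
    apply: mpre => //; apply: measurable_funB; exact: measurableT_comp.
  by apply/seteqP; split=> w /= /eqP; [rewrite -subr_eq0 => /eqP|rewrite subr_eq0 => /eqP].
apply/seteqP; split=> w /= [] //; first by move=> ->.
by move=> h1 h2; rewrite (surjective_pairing (f w)) h1 h2 -surjective_pairing.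
Qed.

(** The set of used points is tested on atoms only, since the recursion looks at
    it nowhere else. *)
Definition slt_state_measurable n :=
  [/\ measurable_fun [set: Omega * borel S]
        (fun p : Omega * borel S => slt_fun (st p.1 n) p.2),
      measurable_fun setT (fun w => slt_point (st w n) : borel S * R)
    & forall i, measurable [set w | slt_used (st w n) (X i w)]].

Let gpt n : slt_state_measurable n -> measurable_fun [set: Omega * borel S]
  (fun p : Omega * borel S => g (slt_point (st p.1 n)).1 p.2).
Proof.
move=> [_ mp _].
have h : measurable_fun [set: Omega * borel S]
    (fun p : Omega * borel S => ((slt_point (st p.1 n)).1 : borel S, p.2)).
  apply: measurable_fun_pair => //.
  have a := measurableT_comp mp (@measurable_fst _ _ Omega (borel S)).
  exact: (measurableT_comp measurable_fst a).
exact: (measurableT_comp g_measurable h).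
Qed.

Let at_atom (f : Omega * borel S -> R) i : measurable_fun setT f ->
  measurable_fun setT (fun w => f (w, (X i w).1)).
Proof.
move=> mf; have h : measurable_fun setT (fun w => (w, (X i w).1)).
  by apply: measurable_fun_pair => //; exact: measurableT_comp.
exact: (measurableT_comp mf h).
Qed.

Let reached n (t : R) w := exists i, ~ slt_used (st w n) (X i w) /\
  (X i w).2 <= slt_fun (st w n) (X i w).1 + t * g (slt_point (st w n)).1 (X i w).1.

Let measurable_reached n t : slt_state_measurable n -> measurable [set w | reached n t w].
Proof.
move=> sm; have [mf mp mu] := sm.
rewrite (_ : mkset _ = \bigcup_i (~` [set w | slt_used (st w n) (X i w)] `&`
  [set w | (X i w).2 <= slt_fun (st w n) (X i w).1 + t * g (slt_point (st w n)).1 (X i w).1])).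
  apply: bigcupT_measurable => i; apply: measurableI; first exact: measurableC.
  apply: mle; first exact: measurableT_comp.
  apply: measurable_funD; first exact: (at_atom i mf).
  by apply: measurable_funM => //; exact: (at_atom i (gpt sm)).
by apply/seteqP; split=> w /= [i]; [exists i|move=> _ ?; exists i].
Qed.

Let reached_mono n a b w : a <= b -> reached n a w -> reached n b w.
Proof.
move=> ab [i [ui le]]; exists i; split=> //; apply: le_trans le _.
by rewrite lerD2l ler_wpM2r.
Qed.

Let gapE n w : slt_gap g (atoms w) z0 n = inf [set t | 0 <= t /\ reached n t w].
Proof.
rewrite /slt_gap /slt_incr; congr inf; apply/seteqP; split=> t /= [t0].
  by move=> [p [[i _ <-] up] le]; split=> //; exists i.
by move=> [i [ui le]]; split=> //; exists (X i w) => //; split=> //; exists i.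
Qed.

(** The infimum is less than r when a level below r is reached, for which
    rational levels suffice, or when no level is reached at all and the
    infimum takes its default value 0. *)
Lemma measurable_slt_gap n : slt_state_measurable n ->
  measurable_fun setT (fun w => slt_gap g (atoms w) z0 n).
Proof.
move=> sm; apply: (measurability _ (RGenInftyO.measurableE R)) => //= _ [_ [r ->] <-].
rewrite setTI.
rewrite (_ : _ @^-1` _ = ([set w | (0 < r)%R] `&` \bigcap_k ~` [set w | reached n k%:R w]) `|`
    \bigcup_(q in [set q : rat | 0 <= (ratr q : R) < r]) [set w | reached n (ratr q) w]).
  apply: measurableU.
    apply: measurableI.
      have [r0|r0] := ltP 0 r.
        by rewrite (_ : mkset _ = setT)//; apply/seteqP; split.
      by rewrite (_ : mkset _ = set0)//; apply/seteqP; split=> // w; rewrite /= ltNge r0.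
    by apply: bigcapT_measurable => k; apply: measurableC; exact: measurable_reached.
  rewrite bigcup_mkcond; apply: bigcupT_measurable_rat => q; case: ifP => _ //; exact: measurable_reached.
apply/seteqP; split=> w; rewrite /= in_itv/= gapE.
  set A := (X in inf X) => Ar.
  have [A0|/set0P A0] := eqVneq A set0.
    left; rewrite A0 inf0 in Ar; split=> // k _ rk.
    by have : A k%:R by []; rewrite A0.
  right; have hA : has_inf A by split=> //; exists 0 => t [].
  have [t [t0 rt] tr] : exists2 t, A t & t < r.
    have [||t At tr] := @inf_adherent _ A (r - inf A) => //; first by rewrite subr_gt0.
    by exists t => //; rewrite addrC subrK in tr.
  have [q] := rat_in_itvoo tr; rewrite in_itv/= => /andP[tq qr].
  exists q; first by rewrite /= qr (le_trans t0 (ltW tq)).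
  exact: reached_mono (ltW tq) rt.
move=> [[r0 h]|[q /= /andP[q0 qr] rq]].
  rewrite (_ : mkset _ = set0) ?inf0//; apply/seteqP; split=> // t [t0 rt].
  apply: (h (Num.truncn t).+1 I); apply: reached_mono rt; exact/ltW/truncnS_gt.
apply: le_lt_trans qr; apply: ge_inf; last by [].
by exists 0 => t [].
Qed.

(** Outside an almost sure event the construction falls back on default values.
    The new point is therefore expressed through the countably many events that
    atom i is the unique one reached, and the old point where none occurs. *)
Lemma slt_state_measurableS n : slt_state_measurable n -> slt_state_measurable n.+1.
Proof.
move=> sm; have [mf mp mu] := sm.
have mf' : measurable_fun [set: Omega * borel S]
    (fun p : Omega * borel S => slt_fun (st p.1 n.+1) p.2).
  apply: measurable_funD => //; apply: measurable_funM; last exact: gpt.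
  exact: (measurableT_comp (measurable_slt_gap sm)).
pose hitp w i := ~ slt_used (st w n) (X i w) /\ slt_fun (st w n.+1) (X i w).1 = (X i w).2.
have mhit i : measurable [set w | hitp w i].
  rewrite (_ : mkset _ = ~` [set w | slt_used (st w n) (X i w)] `&`
      (fun w => slt_fun (st w n.+1) (X i w).1 - (X i w).2) @^-1` [set 0]).
    apply: measurableI; first exact: measurableC.
    apply: mpre => //; apply: measurable_funB; last exact: measurableT_comp.
    exact: (at_atom i mf').
  apply/seteqP; split => w /= [ui /eqP h]; split=> //; apply/eqP.
    by rewrite subr_eq0.
  by rewrite -subr_eq0.
pose Ui i := [set w | hitp w i /\ forall j, hitp w j -> X i w = X j w].
have mUi i : measurable (Ui i).
  rewrite (_ : Ui i = [set w | hitp w i] `&`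
      \bigcap_j (~` [set w | hitp w j] `|` [set w | X i w = X j w])).
    apply: measurableI => //; apply: bigcapT_measurable => j.
    by apply: measurableU; [exact: measurableC|exact: meq].
  apply/seteqP; split=> w /= [hi h]; split=> // j.
    by move=> _; have [hj|hj] := pselect (hitp w j); [right; exact: h|left].
  by move=> hj; have [/(_ hj)|] := h j I.
have ptE w : slt_point (st w n.+1) = xget (slt_point (st w n))
    [set p | exists i, Ui i w /\ X i w = p].
  rewrite {1}/st /slt iterS -/(slt g (atoms w) z0 n) -/(st w n) /=; congr xget.
  apply/seteqP; split=> p /=.
    move=> [[[[i _ <-] up] Gp] uniq]; exists i; split=> //; split=> // j [uj Gj].
    by apply: uniq; split=> //; split=> //; exists j.
  move=> [i [[[ui Gi] uniq] <-]]; split; first by split=> //; split=> //; exists i.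
  by move=> _ [[[j _ <-] uj] Gj]; exact: uniq.
have mp' : measurable_fun setT (fun w => slt_point (st w n.+1) : borel S * R).
  move=> _ C mC; rewrite setTI.
  rewrite (_ : _ @^-1` _ = [set w | C (xget (slt_point (st w n))
      [set p | exists i, Ui i w /\ X i w = p])]); last first.
    by apply/seteqP; split=> w; rewrite /preimage /mkset ptE.
  rewrite (_ : mkset _ = (\bigcup_i (Ui i `&` X i @^-1` C)) `|`
      ((\bigcap_i ~` Ui i) `&` (fun w => slt_point (st w n) : borel S * R) @^-1` C)).
    apply: measurableU.
      by apply: bigcupT_measurable => i; apply: measurableI => //; exact: mpre.
    apply: measurableI; last exact: mpre.
    by apply: bigcapT_measurable => i; exact: measurableC.
  apply/seteqP; split=> w.
    have [[p Pp]|none] := pselect ([set p | exists i, Ui i w /\ X i w = p] !=set0).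
      have [i [Uiw iE]] := xgetPex (slt_point (st w n)) (ex_intro _ p Pp).
      by move=> /= Cx; left; exists i => //; split=> //=; rewrite iE.
    rewrite /= xgetPN; last by move=> p Pp; apply: none; exists p.
    by move=> Cx; right; split=> // i _ Uiw; apply: none; exists (X i w); exists i.
  move=> [[i _ [Uiw Ci]]|[nU Cx]].
    have ex : exists p, [set p | exists i, Ui i w /\ X i w = p] p.
      by exists (X i w); exists i.
    have [j [Ujw jE]] := xgetPex (slt_point (st w n)) ex.
    by rewrite /= -jE -(Uiw.2 j Ujw.1).
  by rewrite /= xgetPN// => p [i [Uiw _]]; exact: (nU i I).
split=> // i; rewrite (_ : mkset _ = [set w | X i w = slt_point (st w n.+1)] `|`
    [set w | slt_used (st w n) (X i w)]).
  by apply: measurableU => //; exact: meq.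
by apply/seteqP; split.
Qed.

Lemma slt_measurable n : slt_state_measurable n.
Proof.
elim: n => [|n]; last exact: slt_state_measurableS.
split; [exact: measurable_cst|exact: measurable_cst|].
by move=> i; rewrite (_ : mkset _ = set0)//; apply/seteqP; split.
Qed.

Lemma measurable_slt_chain n :
  measurable_fun setT (fun w => slt_chain g (atoms w) z0 n : borel S).
Proof. by have [_ mp _] := slt_measurable n; exact: (measurableT_comp measurable_fst mp). Qed.

Variable Delta : S.

Lemma measurable_hit_by n : measurable_fun setT (fun w => hit_by g (atoms w) z0 Delta n).
Proof.
elim: n => [|n IH] /=; first exact: measurable_cst.
apply: measurable_or => //; apply: (measurable_fun_bool true); rewrite setTI.
rewrite (_ : _ @^-1` _ = (fun w => slt_chain g (atoms w) z0 n.+1 : borel S) @^-1` [set Delta]).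
  by apply: mpre; [exact: measurable_slt_chain|exact: measurable_borel1].
by apply/seteqP; split=> w /= /eqP.
Qed.

Lemma measurable_stopped_local_time n z :
  measurable_fun setT (fun w => stopped_local_time g (atoms w) z0 Delta n z).
Proof.
elim: n => [|n IH] /=; first exact: measurable_cst.
apply: measurable_funD => //; apply: measurable_fun_ifT => //; first exact: measurable_hit_by.
apply: measurable_funM; first exact/measurable_slt_gap/slt_measurable.
have h := gpt (slt_measurable n).
exact: (measurableT_comp h (pair2_measurable (z : borel S))).
Qed.

Lemma measurable_soft_local_time_hit z :
  measurable_fun setT (fun w => soft_local_time_hit g (atoms w) z0 Delta z).
Proof.
under eq_fun do rewrite (soft_local_time_hitE _ _ _ g_ge0).
apply: (@emeasurable_fun_cvg _ _ _ setT
  (fun n w => (stopped_local_time g (atoms w) z0 Delta n z)%:E)).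
  by move=> n; apply/measurable_EFinP; exact: measurable_stopped_local_time.
move=> w _; apply: ereal_nondecreasing_cvgn => a b ab; rewrite lee_fin.
exact: nondecreasing_stopped_local_time.
Qed.

Lemma measurable_visits (Gamma : set (borel S)) : measurable Gamma ->
  measurable_fun setT (fun w => visits g (atoms w) z0 Delta Gamma : \bar R).
Proof.
move=> mG; pose V k := if k is m.+1 then [set w | ~~ hit_by g (atoms w) z0 Delta m] `&`
  (fun w => slt_chain g (atoms w) z0 m.+1 : borel S) @^-1` Gamma else set0.
have mV k : measurable (V k).
  case: k => [|k]; first exact: measurable0.
  apply: measurableI; last by apply: mpre => //; exact: measurable_slt_chain.
  rewrite (_ : mkset _ = (fun w => hit_by g (atoms w) z0 Delta k) @^-1` [set false]).
    by apply: mpre => //; exact: measurable_hit_by.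
  by apply/seteqP; split=> w /=; [move/negbTE|move=> ->].
rewrite (_ : (fun w => _) = how_many V); first exact: measurable_how_many.
apply/funext => w; rewrite visitsE counting_dirac; apply: eq_eseriesr => k _.
rewrite diracE indicE; congr (_%:R%:E); congr nat_of_bool; apply/idP/idP; rewrite !inE.
  by case: k => [[]|k [_ []]].
by case: k => // k [].
Qed.

End slt_measurable.

(** * The initial configuration *)
Section poisson_initial.
Local Open Scope ereal_scope.
Context {R : realType} {dO dT dP} {O : measurableType dO}
  {T : measurableType dT} {P : measurableType dP}.
Variables (Q : probability O R) (nu : {measure set P -> \bar R}) (P0 : set P)
  (F : nat -> set P) (kappa : nat -> P -> nat) (X : nat -> O -> P).
Hypotheses (diss : dissecting nu P0 F kappa)
  (ppp : poisson_point_process Q nu X).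

Lemma point_measureE w A :
  point_measure (X ^~ w) A = how_many (fun i => X i @^-1` A) w :> \bar R.
Proof. by []. Qed.

Let mX i : measurable_fun setT (X i). Proof. by case: ppp. Qed.

Let mXA i A : measurable A -> measurable (X i @^-1` A).
Proof. by move=> mA; rewrite -[X in measurable X]setTI; exact: mX. Qed.

Let count A w : \bar R := point_measure (X ^~ w) A.

Let mcount A x : measurable A -> measurable (count A @^-1` [set x]).
Proof.
move=> mA; rewrite -[X in measurable X]setTI.
exact: (measurable_how_many (fun i => mXA i mA)).
Qed.

Let count_eq0 A w : count A w = 0 <-> forall j, ~ A (X j w).
Proof.
split=> [c0 j Aj|no]; last by rewrite /count point_measureE how_many0.
have := @le_how_many_sum R _ _ (fun i => X i @^-1` A) j.+1 w.
rewrite -point_measureE -/(count A w) c0 leNgt => /negP; apply.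
apply: (@lt_le_trans _ _ (1%R)%:E) => //.
rewrite big_ord_recr/= indicE mem_set//= leeDr// sume_ge0//.
Qed.

Let count_ge2 A w i j : i <> j -> A (X i w) -> A (X j w) -> 1 < count A w.
Proof.
move=> ij Ai Aj; rewrite /count point_measureE /how_many.
rewrite (@nneseriesD1 _ _ i)//.
rewrite (@nneseriesD1 _ _ j)//; last by apply/eqP => ji; apply: ij.
rewrite !indicE !mem_set// addeA -EFinD.
apply: (@lt_le_trans _ _ (1 + 1)%R%:E); first by rewrite lte_fin ltrDl.
by rewrite leeDl// nneseries_ge0.
Qed.

Let Q_count0 A : measurable A -> nu A < +oo ->
  Q (count A @^-1` [set 0]) = (expR (- fine (nu A)))%:E.
Proof.
move=> mA Afin; have [_ /(_ A mA Afin 0%N) + _ _] := ppp.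
rewrite (_ : mkset _ = count A @^-1` [set 0])// => ->; rewrite /poisson_prob.
case: ifPn => [r0|]; first by rewrite esum_set1 ?lee_fin ?poisson_pmf_ge0// /poisson_pmf r0 expr0 fact0 invr1 !mul1r.
rewrite -leNgt => r0; have -> : fine (nu A) = 0%R by apply/eqP; rewrite eq_le r0 fine_ge0.
by rewrite oppr0 expR0 diracE mem_set.
Qed.

Let Q_count1 A : measurable A -> nu A < +oo ->
  Q (count A @^-1` [set 1]) = (fine (nu A) * expR (- fine (nu A)))%:E.
Proof.
move=> mA Afin; have [_ /(_ A mA Afin 1%N) + _ _] := ppp.
rewrite (_ : mkset _ = count A @^-1` [set 1])// => ->; rewrite /poisson_prob.
case: ifPn => [r0|]; first by rewrite esum_set1 ?lee_fin ?poisson_pmf_ge0// /poisson_pmf r0 expr1 factS fact0 invr1 mulr1.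
rewrite -leNgt => r0; have -> : fine (nu A) = 0%R by apply/eqP; rewrite eq_le r0 fine_ge0.
by rewrite mul0r diracE memNset.
Qed.

Let many A := ~` (count A @^-1` [set 0] `|` count A @^-1` [set 1]).

Let mmany A : measurable A -> measurable (many A).
Proof. by move=> mA; apply: measurableC; apply: measurableU; exact: mcount. Qed.

(** A Poisson variable of small parameter r exceeds 1 with probability of
    order r^2: this is what rules out multiple points. *)
Let Q_many A : measurable A -> nu A < +oo -> Q (many A) <= (fine (nu A) ^+ 2)%:E.
Proof.
move=> mA Afin; have m0 := mcount 0 mA; have m1 := mcount 1 mA.
rewrite /many probability_setC; last exact: measurableU.
have -> : Q (count A @^-1` [set 0] `|` count A @^-1` [set 1]) =
    Q (count A @^-1` [set 0]) + Q (count A @^-1` [set 1]).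
  apply: measureU => //; apply/seteqP; split=> // w [/= -> /eqP].
  by rewrite eqe eq_sym oner_eq0.
rewrite Q_count0// Q_count1//.
have r0 : (0 <= fine (nu A))%R by rewrite fine_ge0.
set r := fine _ in r0 *; rewrite [leLHS](_ : _ = (1 - (expR (- r) + r * expR (- r)))%R%:E)// lee_fin.
have := expR_ge1Dx (- r); have := expR_gt0 (- r); nra.
Qed.

Let doubled n m := \bigcup_k many (F n `&` kappa m @^-1` [set k]).

Let mcell n m k : measurable (F n `&` kappa m @^-1` [set k]).
Proof.
have [[mF _ _ _] mk _ _] := diss.
by apply: measurableI => //; rewrite -[X in measurable X]setTI; exact: mk.
Qed.

Let mdoubled n m : measurable (doubled n m).
Proof. by apply: bigcupT_measurable => k; exact: mmany. Qed.

(** Sum of the squares of the measures of the cells, hence at most the largest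
    one times the total. *)
Let Q_doubled n m (e : R) :
  (forall k, nu (F n `&` kappa m @^-1` [set k]) <= e%:E) ->
  Q (doubled n m) <= e%:E * nu (F n).
Proof.
move=> small; have [[mF _ _ Foo] mk _ _] := diss.
have e0 : 0 <= e%:E := le_trans (measure_ge0 nu _) (small 0%N).
have le1 : Q (doubled n m) <= \sum_(k <oo) Q (many (F n `&` kappa m @^-1` [set k])).
  by apply: measure_sigma_subadditive => // k; exact: mmany.
apply: (le_trans le1).
have -> : nu (F n) = \sum_(k <oo) nu (F n `&` kappa m @^-1` [set k]).
  rewrite -measure_semi_bigcup//.
  - by rewrite -setI_bigcupr -preimage_bigcup bigcup_imset1 image_id preimage_setT setIT.
  - by move=> i j _ _ [x [[_ /= <-] [_ /= <-]]].
  - by apply: bigcupT_measurable => k; exact: mcell.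
rewrite -nneseriesZl//; apply: lee_nneseries => // k _.
have fin : nu (F n `&` kappa m @^-1` [set k]) < +oo := le_lt_trans (small k) (ltry _).
apply: (le_trans (Q_many (mcell n m k) fin)).
rewrite expr2 EFinM fineK ?ge0_fin_numE//; exact: lee_wpmul2r.
Qed.

(** Two atoms at the same place lie in the same cell of every partition, while
    the probability that some cell holds two atoms tends to 0. *)
Lemma poisson_ae_distinct :
  {ae Q, forall w, forall i j, i <> j -> P0 (X i w) -> X i w <> X j w}.
Proof.
have [[mF ndF P0E Foo] mk sep small] := diss.
pose D n := \bigcap_m doubled n m.
have mD n : measurable (D n) by exact: bigcapT_measurable.
have QD n : Q (D n) = 0.
  have V0 : (0 <= fine (nu (F n)))%R by rewrite fine_ge0.
  apply/eqP; rewrite -measure_le0; apply/lee_addgt0Pr => e e0; rewrite add0e.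
  pose d := (e / (fine (nu (F n)) + 1))%R.
  have d0 : (0 < d)%R by rewrite divr_gt0// ltr_wpDl.
  have [m0 hm] := small n d d0.
  have le1 : Q (D n) <= Q (doubled n m0).
    by apply: le_measure; rewrite ?inE// => w; exact.
  apply: (le_trans le1); apply: (le_trans (Q_doubled (hm m0 (leqnn _)))).
  rewrite -[nu (F n)]fineK ?ge0_fin_numE// -EFinM lee_fin /d.
  by rewrite mulrAC ler_pdivrMr ?ltr_wpDl// ler_pM2l// lerDl.
exists (\bigcup_n D n); split.
- exact: bigcupT_measurable.
- apply/eqP; rewrite -measure_le0.
  have le1 : Q (\bigcup_n D n) <= \sum_(n <oo) Q (D n).
    by apply: measure_sigma_subadditive => //; exact: bigcupT_measurable.
  by apply: (le_trans le1); rewrite eseries0.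
move=> w /= /existsNP[i] /existsNP[j] /not_implyP[ij] /not_implyP[].
rewrite P0E => -[n _ Fi] /contrapT ijE; exists n => // m _.
exists (kappa m (X i w)) => //=; rewrite /many/=.
have := @count_ge2 (F n `&` kappa m @^-1` [set kappa m (X i w)]) w i j ij.
rewrite -ijE => /(_ (conj Fi erefl) (conj Fi erefl)) c1 [c|c]; move: c1; rewrite c ?ltxx//.
by rewrite lte_fin ltNge ler01.
Qed.

Lemma poisson_given_init (y : T) : poisson_given Q nu P0 (cst y) X.
Proof.
split=> //; first exact: poisson_ae_distinct.
move=> B A mB mA _ Afin.
have avE : avoid (cst y) X (setT `*` A) = count A @^-1` [set 0].
  apply/seteqP; split=> w /=; first by move=> h; apply/count_eq0 => j Aj; exact: (h j).
  by move=> /count_eq0 h j [_ /h].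
rewrite avE; have [yB|yB] := pselect (B y).
  rewrite (_ : _ @^-1` _ = setT); last by apply/seteqP; split.
  rewrite setTI probability_setT mul1e Q_count0// -[in RHS](@fineK _ (nu A))//.
  by rewrite ge0_fin_numE.
rewrite (_ : _ @^-1` _ = set0); last by apply/seteqP; split.
by rewrite set0I measure0 mul0e.
Qed.

End poisson_initial.

(** * The Markov property along the construction *)
Section along_the_path.
Context {R : realType} {S : completePMetricType R}.
Hypothesis S_separable : separable S.
Context {d} {Omega : measurableType d}.
Variables (mu : {sigma_finite_measure set (borel S) -> \bar R}) (g : S -> S -> R).
Hypotheses (g_ge0 : forall z z', 0 <= g z z')
  (g_measurable : measurable_fun [set: borel S * borel S]
    (fun p : borel S * borel S => g p.1 p.2))
  (g_density : forall z,
    (\int[mu]_(z' in [set: borel S]) (g z z')%:E = 1)%E).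
Variables (Delta zhat : S).

Let gb : borel S -> borel S -> R := g.

(** A state consists of the current point of the chain, the height still missing
    at zhat, and the fact that Delta has been visited. *)
Definition current (y : borel S * R * bool) : borel S := y.1.1.

(** Effect on the state of the first ring x.2; after the visit to Delta the
    missing height no longer changes. *)
Definition next_progress (x : (borel S * R * bool) * (borel S * R)) : borel S * R * bool :=
  (x.2.1, if x.1.2 then x.1.1.2
          else x.1.1.2 - clock gb current x * g (current x.1) zhat,
   x.1.2 || (x.2.1 == Delta)).

Lemma measurable_next_progress : measurable_fun setT next_progress.
Proof.
have mx (f : (borel S * R * bool) * (borel S * R) -> borel S) :
    measurable_fun setT f -> measurable_fun setT (fun x => g (current x.1) (f x)).
  move=> mf; have h : measurable_fun setT
      (fun x : (borel S * R * bool) * (borel S * R) => (current x.1, f x)).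
    apply: measurable_fun_pair => //.
    by apply: measurableT_comp => //; exact: measurableT_comp.
  exact: (measurableT_comp g_measurable h).
have m2 : measurable_fun setT (fun x : (borel S * R * bool) * (borel S * R) => x.2.1).
  exact: measurableT_comp.
have mb : measurable_fun setT (fun x : (borel S * R * bool) * (borel S * R) => x.1.2).
  exact: measurableT_comp.
have mh : measurable_fun setT (fun x : (borel S * R * bool) * (borel S * R) => x.1.1.2).
  by apply: measurableT_comp => //; exact: measurableT_comp.
apply: measurable_fun_pair; first apply: measurable_fun_pair => //.
  apply: measurable_fun_ifT => //; apply: measurable_funB => //.
  apply: measurable_funM; last exact: mx.
  apply: measurable_funM; first exact: measurableT_comp.
  exact: (measurable_fun_inv (fun x => g_ge0 _ _) (mx _ m2)).
apply: measurable_or => //; apply: (measurable_fun_bool true); rewrite setTI.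
rewrite (_ : _ @^-1` _ = (fun x : (borel S * R * bool) * (borel S * R) => x.2.1)
    @^-1` [set Delta]).
  by rewrite -[X in measurable X]setTI; apply: m2 => //; exact: measurable_borel1.
by apply/seteqP; split=> x /= /eqP.
Qed.

Variables (Q : probability Omega R) (X : nat -> Omega -> borel S * R).
Hypotheses (X_ge0 : forall i w, 0 <= (X i w).2)
  (X_poisson : poisson_point_process Q (intensity mu) X).
Variables (z0 : S) (s : R).

Let atoms w : set (S * R) := range (X ^~ w).
Let st w n := slt g (atoms w) z0 n.

Definition progress_at n w : borel S * R * bool :=
  (slt_chain g (atoms w) z0 n : borel S,
   s - stopped_local_time g (atoms w) z0 Delta n zhat,
   hit_by g (atoms w) z0 Delta n).

(** Almost surely the unused atoms lie above the local time. This condition is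
    built into [remaining] so that the description of a step holds on every
    path where some atom rings first, not just almost surely. *)
Definition above n w := forall j, ~ slt_used (st w n) (X j w) ->
  slt_fun (st w n) (X j w).1 <= (X j w).2.

(** The atoms that the construction may still use, lowered by the local time; the
    height -1 marks a dummy. *)
Definition remaining n j w : borel S * R :=
  if `[< above n w /\ ~ slt_used (st w n) (X j w) >] then
    ((X j w).1, (X j w).2 - slt_fun (st w n) (X j w).1)
  else ((X j w).1, -1).

Lemma remaining_alive n j w : 0 <= (remaining n j w).2 ->
  [/\ above n w, ~ slt_used (st w n) (X j w) &
   remaining n j w = ((X j w).1, (X j w).2 - slt_fun (st w n) (X j w).1)].
Proof.
rewrite /remaining; case: asboolP => [[a u] _|_] //=.
by rewrite oppr_ge0 leNgt ltr01.
Qed.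

Lemma remaining1 n j w : (remaining n j w).1 = (X j w).1.
Proof. by rewrite /remaining; case: ifP. Qed.

(** On a path where atom i rings first among the remaining ones, the infimum
    that defines the increment is attained by atom i only, and equals its
    clock. *)
Section one_path.
Variables (n i : nat) (w : Omega).
Hypothesis first : rings_first gb (progress_at n) (remaining n) current i w.

Let t := clock gb current (progress_at n w, remaining n i w).

Let alive_i : 0 <= (remaining n i w).2. Proof. by case: first => -[]. Qed.

Let rate_gt0 : 0 < g (slt_chain g (atoms w) z0 n) (X i w).1.
Proof. by case: first => -[_]; rewrite /rate remaining1. Qed.

Let t_ge0 : 0 <= t.
Proof. by rewrite divr_ge0// /rate remaining1 ltW. Qed.

Let heightE : (X i w).2 = slt_fun (st w n) (X i w).1 +
  t * g (slt_chain g (atoms w) z0 n) (X i w).1.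
Proof.
have [_ _ E] := remaining_alive alive_i.
rewrite /t /clock /rate remaining1 divfK ?gt_eqF// {1}E /=.
by rewrite addrC subrK.
Qed.

Let others j : j <> i -> ~ slt_used (st w n) (X j w) ->
  slt_fun (st w n) (X j w).1 + t * g (slt_chain g (atoms w) z0 n) (X j w).1 < (X j w).2.
Proof.
move=> ji uj; have [a _ _] := remaining_alive alive_i.
have E : remaining n j w = ((X j w).1, (X j w).2 - slt_fun (st w n) (X j w).1).
  by rewrite /remaining asboolT.
have [_ /(_ j ji)] := first; rewrite E/= subr_ge0 => /(_ (a j uj)).
by rewrite ltrBrDl.
Qed.

Lemma first_gap : slt_gap g (atoms w) z0 n = t.
Proof.
have [_ ui _] := remaining_alive alive_i.
rewrite /slt_gap /slt_incr; set A := (X in inf X).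
have At : A t.
  by split=> //; exists (X i w); [split=> //; exists i|rewrite heightE].
apply/eqP; rewrite eq_le; apply/andP; split.
  by apply: ge_inf => //; exists 0 => x [].
apply: lb_le_inf; first by exists t.
move=> u [u0 [p [[j _ <-] uj] le]]; have [ji|ji] := pselect (j = i).
  move: le; rewrite ji heightE lerD2l ler_pM2r//.
have := lt_le_trans (others ji uj) le; rewrite ltrD2l => h.
by rewrite leNgt; apply/negP => /ltW ut; move: h; rewrite ltNge ler_wpM2r.
Qed.

Lemma first_fun z : slt_fun (st w n.+1) z =
  slt_fun (st w n) z + t * g (slt_chain g (atoms w) z0 n) z.
Proof. by rewrite -first_gap. Qed.

Lemma first_point : slt_point (st w n.+1) = X i w.
Proof.
have [_ ui _] := remaining_alive alive_i.
have E : [set p | unique (fun q => (atoms w `\` slt_used (st w n)) q /\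
    slt_fun (st w n.+1) q.1 = q.2) p] = [set X i w].
  have hit j : ~ slt_used (st w n) (X j w) ->
      slt_fun (st w n.+1) (X j w).1 = (X j w).2 -> X j w = X i w.
    move=> uj Gj; have [->//|ji] := pselect (j = i).
    by have := others ji uj; rewrite -Gj first_fun ltxx.
  apply/seteqP; split=> p; first by move=> [[[[j _ <-] uj] Gj] _]; exact: hit.
  move=> ->; split; first by split; [split=> //; exists i|rewrite first_fun heightE].
  by move=> _ [[[j _ <-] uj] Gj]; apply/esym; exact: hit.
rewrite {1}/st /slt iterS -/(slt g (atoms w) z0 n) -/(st w n) /=.
rewrite [X in xget _ X]E.
by have := xgetPex (slt_point (st w n)) (ex_intro [set X i w] (X i w) erefl).
Qed.

Lemma first_used p : slt_used (st w n.+1) p <-> p = X i w \/ slt_used (st w n) p.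
Proof. by rewrite -first_point. Qed.

Lemma first_above j : ~ slt_used (st w n.+1) (X j w) ->
  slt_fun (st w n.+1) (X j w).1 < (X j w).2.
Proof.
move=> uj; have [ji|ji] := pselect (j = i).
  by exfalso; apply: uj; apply/first_used; left; rewrite ji.
rewrite first_fun; apply: others => // u; apply: uj; apply/first_used; by right.
Qed.

Lemma first_remaining j : j <> i -> 0 <= (remaining n j w).2 ->
  remaining n.+1 j w = ((remaining n j w).1,
    (remaining n j w).2 - t * rate gb current (progress_at n w) (remaining n j w).1).
Proof.
move=> ji /remaining_alive[_ uj ->] /=.
rewrite /remaining asboolT; first by rewrite first_fun opprD addrA.
split; first by move=> k uk; exact/ltW/first_above.
move=> /first_used[Xji|//]; by have := others ji uj; rewrite Xji -heightE ltxx.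
Qed.

Lemma first_dead j : j = i \/ (remaining n j w).2 < 0 -> (remaining n.+1 j w).2 < 0.
Proof.
move=> h; have uj : slt_used (st w n.+1) (X j w).
  apply/first_used; case: h => [->|]; first by left.
  have [a _ _] := remaining_alive alive_i.
  rewrite /remaining; case: asboolP => [[_ uj]|h _]; first by rewrite /= subr_lt0 ltNge a.
  by right; apply: contrapT => uj; apply: h.
by rewrite /remaining asboolF/= ?ltrN10// => -[].
Qed.

Lemma first_progress :
  progress_at n.+1 w = next_progress (progress_at n w, remaining n i w).
Proof.
have E : slt_chain g (atoms w) z0 n.+1 = (X i w).1 by rewrite /slt_chain -first_point.
rewrite /progress_at /next_progress /= E remaining1 -/t; congr (_, _, _).
by rewrite opprD addrA first_gap; case: hit_by; rewrite ?subr0.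
Qed.

End one_path.
Let mX i : measurable_fun setT (X i). Proof. by case: X_poisson. Qed.

Let used n j := [set w | slt_used (st w n) (X j w)].

Let mused n j : measurable (used n j).
Proof.
by have [_ _ mu_] := slt_measurable S_separable z0 g_ge0 g_measurable mX n; exact: mu_.
Qed.

Let mfun n j : measurable_fun setT (fun w => slt_fun (st w n) (X j w).1).
Proof.
have [mf _ _] := slt_measurable S_separable z0 g_ge0 g_measurable mX n.
have h : measurable_fun setT (fun w => (w, (X j w).1)).
  by apply: measurable_fun_pair => //; exact: measurableT_comp.
exact: (measurableT_comp mf h).
Qed.

Let mabove n : measurable [set w | above n w].
Proof.
rewrite (_ : mkset _ = \bigcap_j (used n j `|`
    [set w | slt_fun (st w n) (X j w).1 <= (X j w).2])).
  apply: bigcapT_measurable => j; apply: measurableU => //.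
  rewrite -[X in measurable X]setTI; apply: measurable_fun_ler => //.
  exact: measurableT_comp.
apply/seteqP; split=> w h j.
  by move=> _; have [uj|uj] := pselect (slt_used (st w n) (X j w)); [left|right; exact: h].
by move=> uj; have [] := h j I.
Qed.

Lemma measurable_remaining n j : measurable_fun setT (remaining n j).
Proof.
have mm : measurable_fun setT (fun w => `[< above n w /\ ~ slt_used (st w n) (X j w) >]).
  apply: (measurable_fun_bool true); rewrite setTI.
  rewrite (_ : _ @^-1` _ = [set w | above n w] `&` ~` used n j).
    by apply: measurableI => //; exact: measurableC.
  by apply/seteqP; split=> w /= /asboolP.
have m1 : measurable_fun setT (fun w => (X j w).1) by exact: measurableT_comp.
apply: measurable_fun_ifT => //; apply: measurable_fun_pair => //.
by apply: measurable_funB => //; exact: measurableT_comp.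
Qed.

Lemma measurable_progress_at n : measurable_fun setT (progress_at n).
Proof.
apply: measurable_fun_pair; first apply: measurable_fun_pair.
- exact: measurable_slt_chain.
- by apply: measurable_funB => //; exact: measurable_stopped_local_time.
- exact: measurable_hit_by.
Qed.

Let m_current : measurable_fun setT current.
Proof. exact: measurableT_comp. Qed.

(** At the start the atoms are the Poisson process itself and the state is
    deterministic; each further step is [poisson_given_step]. *)
Lemma poisson_given_slt n :
  poisson_given Q (intensity mu) (@alive R _ (borel S)) (progress_at n) (remaining n).
Proof.
have [F [kappa diss]] := dissecting_intensity S_separable mu.
elim: n => [|n IH].
  rewrite (_ : progress_at 0 = cst (z0 : borel S, s - 0, false))//.
  rewrite (_ : remaining 0 = X); first exact: (poisson_given_init diss X_poisson).
  apply/funext => j; apply/funext => w; rewrite /remaining asboolT /=.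
    by rewrite subr0 -surjective_pairing.
  by split=> [k _|[]]; exact: X_ge0.
apply: (@poisson_given_step _ _ _ _ _ _ _ _ _ mu gb g_ge0 g_measurable g_density
  Q F kappa diss _ _ IH _ m_current _ _ next_progress _ _ measurable_next_progress).
- exact: measurable_progress_at.
- exact: measurable_remaining.
- by move=> i w; exact: first_progress.
- by move=> i j w fi ji a; exact: (first_remaining fi ji a).
- by move=> i j w fi h; exact: (first_dead fi h).
Qed.

(** After a first ring the other atoms are strictly above the new local time,
    and almost surely there is a first ring at every step. *)
Lemma ae_above : {ae Q, forall w, forall n j, ~ slt_used (st w n.+1) (X j w) ->
  slt_fun (st w n.+1) (X j w).1 < (X j w).2}.
Proof.
have [F [kappa diss]] := dissecting_intensity S_separable mu.
apply/ae_foralln => n.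
apply: filterS (ae_rings_first (g := gb) g_ge0 g_measurable g_density diss
  (poisson_given_slt n) m_current) => w [i fi] j.
exact: first_above fi j.
Qed.

End along_the_path.

(** * The probability of gaining a given height *)
Section exceedance.
Local Open Scope ereal_scope.
Context {R : realType} {S : completePMetricType R}.
Hypothesis S_separable : separable S.
Variables (mu : {sigma_finite_measure set (borel S) -> \bar R}) (g : S -> S -> R).
Hypotheses (g_ge0 : forall z z', (0 <= g z z')%R)
  (g_measurable : measurable_fun [set: borel S * borel S]
    (fun p : borel S * borel S => g p.1 p.2))
  (g_density : forall z,
    \int[mu]_(z' in [set: borel S]) (g z z')%:E = 1).
Variables (Delta zhat : S).

Let gb : borel S -> borel S -> R := g.
Let nu : {sigma_finite_measure set (borel S * R)%type -> \bar R} := intensity mu.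
Let next := @next_progress R S g Delta zhat.
Let ring (y : borel S * R * bool) : set (borel S * R) := [set p | may_ring gb current (y, p)].
Let e (y : borel S * R * bool) (p : borel S * R) : \bar R :=
  (expR (- clock gb current (y, p)))%:E.

(** Probability that the Markov chain of [next_progress], started at y, brings
    the missing height down to 0 within k steps. *)
Fixpoint exceed (k : nat) (y : borel S * R * bool) : \bar R :=
  if k is m.+1 then \int[nu]_(p in ring y) (exceed m (next (y, p)) * e y p)
  else (\1_[set y : borel S * R * bool | (y.1.2 <= 0)%R] y)%:E.

Let e_ge0 y p : 0 <= e y p. Proof. by rewrite lee_fin expR_ge0. Qed.

Lemma exceed_ge0 k y : 0 <= exceed k y.
Proof.
elim: k y => [|k IH] y /=; first by rewrite lee_fin.
by apply: integral_ge0 => p _; rewrite mule_ge0.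
Qed.

Let m_cur d (V : measurableType d) (a : V -> borel S * R * bool) :
  measurable_fun setT a -> measurable_fun setT (fun v => (a v).1.1).
Proof. by move=> ma; apply: measurableT_comp => //; exact: measurableT_comp. Qed.

Let m_rate : measurable_fun setT (fun x : (borel S * R * bool) * (borel S * R) =>
  g x.1.1.1 x.2.1).
Proof.
have h : measurable_fun setT
    (fun x : (borel S * R * bool) * (borel S * R) => (x.1.1.1, x.2.1)).
  by apply: measurable_fun_pair; [exact: m_cur|exact: measurableT_comp].
exact: (measurableT_comp g_measurable h).
Qed.

Let m_clock : measurable_fun setT (fun x => clock gb current x).
Proof.
apply: measurable_funM; first exact: measurableT_comp.
exact: (measurable_fun_inv (fun x => g_ge0 _ _) m_rate).
Qed.

Let m_ring : measurable (may_ring gb current).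
Proof.
apply: measurableI.
  rewrite -[X in measurable X]setTI; apply: measurable_fun_ler => //.
  exact: measurableT_comp.
by rewrite -[X in measurable X]setTI; apply: measurable_fun_ltr => //; exact: m_rate.
Qed.

Let m_e : measurable_fun setT (fun x => e x.1 x.2).
Proof.
by apply/measurable_EFinP; apply: measurableT_comp => //; exact: measurableT_comp.
Qed.

Let m_next : measurable_fun setT next.
Proof. exact: measurable_next_progress. Qed.

Lemma measurable_exceed k : measurable_fun setT (exceed k).
Proof.
elim: k => [|k IH] /=.
  apply/measurable_EFinP; apply: measurable_indic.
  rewrite -[X in measurable X]setTI; apply: measurable_fun_ler => //.
  by apply: measurableT_comp => //; exact: measurableT_comp.
pose f := (fun x => exceed k (next x) * e x.1 x.2) \_ (may_ring gb current).
have mf : measurable_fun setT f.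
  apply: (measurable_restrictT _ m_ring).1; apply: measurable_funTS.
  by apply: emeasurable_funM => //; exact: measurableT_comp.
have f0 x : 0 <= f x by apply: erestrict_ge0 => ? _; rewrite mule_ge0// exceed_ge0.
have := @measurable_fun_fubini_tonelli_F _ _ _ _ _ nu f mf f0.
congr measurable_fun; apply/funext => y; rewrite /fubini_F [RHS]integral_mkcond.
by apply: eq_integral => p _; rewrite /f !patchE.
Qed.

Let me y : measurable_fun setT (e y).
Proof. exact: (measurableT_comp m_e (pair1_measurable y)). Qed.

Let mring y : measurable (ring y).
Proof.
rewrite -[X in measurable X]setTI.
exact: (pair1_measurable y measurableT m_ring).
Qed.

Let mex k y y' : measurable_fun setT (fun p => exceed k (next (y', p)) * e y p).
Proof.
apply: emeasurable_funM => //; apply: (measurableT_comp (measurable_exceed k)).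
exact: (measurableT_comp m_next (pair1_measurable y')).
Qed.

Let mex0 k y y' p : 0 <= exceed k (next (y', p)) * e y p.
Proof. by rewrite mule_ge0// exceed_ge0. Qed.

Let integral_e_tail y u : (0 <= u)%R ->
  \int[nu]_(p in [set p | ring y p /\ (u <= clock gb current (y, p))%R]) e y p =
  (expR (- u))%:E.
Proof.
move=> u0; rewrite -(integral_clock_tail (g := gb) g_ge0 g_measurable g_density (current y) u0).
congr (integral _ _ _); apply/seteqP; split=> p /=.
  by move=> [[p0 r0] up]; split=> //; rewrite -ler_pdivlMr.
move=> [r0 up]; split; last by rewrite /clock/= ler_pdivlMr.
by split=> //; apply: le_trans up; rewrite mulr_ge0// ltW.
Qed.

Let integral_e y : \int[nu]_(p in ring y) e y p = 1.
Proof.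
rewrite -[RHS](_ : (expR (- 0))%:E = _); last by rewrite oppr0 expR0.
rewrite -(integral_e_tail y (lexx _)); congr (integral _ _ _).
apply/seteqP; split=> [p [p0 r0]|p []//]; split=> //.
by rewrite divr_ge0// ltW.
Qed.

Lemma exceed_le1 k y : exceed k y <= 1.
Proof.
elim: k y => [|k IH] y /=; first by rewrite lee_fin indicE; case: (_ \in _).
rewrite -(integral_e y); apply: ge0_le_integral => //.
- exact: measurable_funTS.
- exact: measurable_funTS.
- by move=> p _; rewrite -[leRHS]mul1e lee_wpmul2r.
Qed.

Let height_le y p : ring y p -> ((next (y, p)).1.2 <= y.1.2)%R.
Proof.
move=> [p0 r0]; rewrite /next/=; case: ifP => // _.
by rewrite gerBl mulr_ge0// divr_ge0// ltW.
Qed.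

Lemma exceed_le0 k y : (y.1.2 <= 0)%R -> exceed k y = 1.
Proof.
move=> y0; apply/eqP; rewrite eq_le exceed_le1/=.
elim: k y y0 => [|k IH] y y0 /=; first by rewrite indicE mem_set.
rewrite -[leLHS](integral_e y); apply: ge0_le_integral => //.
- exact: measurable_funTS.
- exact: measurable_funTS.
- move=> p yp; rewrite -[leLHS]mul1e lee_wpmul2r// IH//.
  exact: le_trans (height_le yp) y0.
Qed.

Lemma exceed_hit k z x : (0 < x)%R -> exceed k (z, x, true) = 0.
Proof.
move=> x0; elim: k z => [|k IH] z /=; first by rewrite indicE memNset//= => /(lt_le_trans x0); rewrite ltxx.
by rewrite integral0_eq// => p _; rewrite /next/next_progress/= IH mul0e.
Qed.

Section analytic.
Variables (l v : R) (c : \bar R).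
Hypotheses (l_gt0 : (0 < l)%R) (v_ge2 : (2 <= v)%R) (c_ge0 : 0 <= c)
  (g_le : forall z, (g z zhat <= l)%R)
  (exceed_le : forall k z x b, (v / 2 * l <= x)%R -> exceed k (z, x, b) <= c).

Let K := (expR (- (v / 2 - 1)))%:E + c.

Let K_ge0 : 0 <= K. Proof. by rewrite adde_ge0// lee_fin expR_ge0. Qed.

(** Induction on the steps, looking at the first one. The case of a step that
    cannot change the height, and the case of clocks too short to gain h (the
    region D1), follow from the induction hypothesis. On D2 the height h is
    gained at once, which has probability exp(-h / g(z, zhat)); the larger
    height is then either gained up to at most v l / 2, on D3, or left to be
    gained from the new state with probability at most c. *)
Lemma exceed_contract k z (h : R) b : (0 < h)%R ->
  exceed k (z, (h + (v - 1) * l)%R, b) <= K * exceed k (z, h, b).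
Proof.
have v1 : (0 <= v - 1)%R by move: v_ge2; lra.
have v2 : (0 <= v / 2 - 1)%R by move: v_ge2; lra.
have vl0 : (0 <= (v - 1) * l)%R by rewrite mulr_ge0// ltW.
elim: k z h b => [|k IH] z h b h0.
  rewrite [leLHS](_ : _ = 0) ?mule_ge0 ?exceed_ge0// /= indicE memNset//=.
  by apply/negP; rewrite -ltNge ltr_pwDl.
set y' := (z, (h + (v - 1) * l)%R, b); set y := (z, h, b).
have -> : exceed k.+1 y' = \int[nu]_(p in ring y) (exceed k (next (y', p)) * e y p) by [].
rewrite /= -[X in K * X]/(\int[nu]_(p in ring y) (exceed k (next (y, p)) * e y p)).
have [flat|] := boolP (b || (g z zhat == 0%R)).
  rewrite -ge0_integralZl//; last exact: measurable_funTS.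
  apply: ge0_le_integral => //.
  - exact: measurable_funTS.
  - by apply: measurable_funTS; exact: measurable_funeM.
  move=> p _; rewrite muleA lee_wpmul2r//.
  have E a : next (z, a, b, p) = (p.1, a, b || (p.1 == Delta)).
    rewrite /next/next_progress/=; case: (b) flat => //= /eqP ->.
    by rewrite mulr0 subr0.
  by rewrite /y /y' !E; exact: IH.
rewrite negb_or => /andP[/negbTE b0 gz0]; rewrite {}b0 in y y' *.
have gz : (0 < g z zhat)%R by rewrite lt_neqAle eq_sym gz0 g_ge0.
pose D2 := [set p | ring y p /\ (h / g z zhat <= clock gb current (y, p))%R].
pose D1 := [set p | ring y p /\ (clock gb current (y, p) < h / g z zhat)%R].
pose D3 := [set p | ring y p /\
  ((h + (v / 2 - 1) * l) / g z zhat <= clock gb current (y, p))%R].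
have mclock : measurable_fun setT (fun p => clock gb current (y, p)).
  exact: (measurableT_comp m_clock (pair1_measurable y)).
have mtail u : measurable [set p | ring y p /\ (u <= clock gb current (y, p))%R].
  apply: measurableI => //.
  by rewrite -[X in measurable X]setTI; exact: measurable_fun_ler.
have mD1 : measurable D1.
  apply: measurableI => //.
  by rewrite -[X in measurable X]setTI; exact: measurable_fun_ltr.
have mD2 : measurable D2 by exact: mtail.
have mD3 : measurable D3 by exact: mtail.
have D12 : ring y = D1 `|` D2.
  apply/seteqP; split=> p; last by case=> -[].
  by move=> yp; have [?|?] := leP (h / g z zhat)%R (clock gb current (y, p)); [right|left].
have disj : [disjoint D1 & D2].
  by apply/disj_setPS => p [[_ lt] [_ le]]; have := lt_le_trans lt le; rewrite ltxx.
have heightE a p : next (z, a, false, p) =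
    (p.1, (a - clock gb current (y, p) * g z zhat)%R, p.1 == Delta) by [].
rewrite D12 !ge0_integral_setU//; try by exact: measurable_funTS.
rewrite ge0_muleDr ?integral_ge0//; apply: leeD.
  rewrite -ge0_integralZl//; last exact: measurable_funTS.
  apply: ge0_le_integral => //.
  - exact: measurable_funTS.
  - by apply: measurable_funTS; exact: measurable_funeM.
  move=> p [_ ph]; rewrite muleA lee_wpmul2r// /y /y' !heightE addrAC.
  by apply: IH; rewrite subr_gt0 -ltr_pdivlMr.
have v3 : (0 <= (v / 2 - 1) * l)%R by rewrite mulr_ge0// ltW.
have u3 : (h / g z zhat <= (h + (v / 2 - 1) * l) / g z zhat)%R.
  by rewrite ler_pM2r ?invr_gt0// lerDl.
have hg0 : (0 <= h / g z zhat)%R by rewrite divr_ge0// ltW.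
apply: (@le_trans _ _ (\int[nu]_(p in D2) (c * e y p + (e y \_ D3) p))).
  apply: ge0_le_integral => //.
  - exact: measurable_funTS.
  - apply: measurable_funTS; apply: emeasurable_funD; first exact: measurable_funeM.
    by apply: (measurable_restrictT _ mD3).1; exact: measurable_funTS.
  move=> p [yp _]; rewrite patchE; case: ifPn => [_|].
    apply: (@le_trans _ _ (e y p)); last by rewrite leeDr// mule_ge0.
    by rewrite -[leRHS]mul1e lee_wpmul2r// exceed_le1.
  rewrite notin_setE => pD3; rewrite [X in _ + X](_ : _ = 0)// adde0 lee_wpmul2r// /y' heightE exceed_le//.
  have : (clock gb current (y, p) < (h + (v / 2 - 1) * l) / g z zhat)%R.
    by rewrite ltNge; apply/negP => ?; apply: pD3.
  rewrite ltr_pdivlMr// => lt; nra.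
rewrite ge0_integralD//; first last.
- by apply: measurable_funTS; apply: (measurable_restrictT _ mD3).1; exact: measurable_funTS.
- by move=> p _; exact: erestrict_ge0.
- by apply: measurable_funTS; exact: measurable_funeM.
- by move=> p _; rewrite mule_ge0.
rewrite ge0_integralZl//; last exact: measurable_funTS.
rewrite -integral_mkcondr (_ : D2 `&` D3 = D3); last first.
  by apply/seteqP; split=> p; [case|move=> [yp le]; split; split=> //; exact: le_trans le].
rewrite !integral_e_tail//; last exact: le_trans u3.
have -> : \int[nu]_(p in D2) (exceed k (next (y, p)) * e y p) = (expR (- (h / g z zhat)))%:E.
  rewrite -(integral_e_tail y)//; apply: eq_integral => p; rewrite inE => -[yp le].
  by rewrite /y heightE exceed_le0 ?mul1e//= subr_le0 -ler_pdivrMr.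
rewrite /K ge0_muleDl ?lee_fin ?expR_ge0// addeC leeD2r// -EFinM lee_fin -expRD ler_expR.
(* lack of memory: only the overshoot, at rate g z zhat <= l, is paid for *)
rewrite -opprD lerN2 mulrDl [leLHS]addrC lerD2l -mulrA ler_peMr//.
by rewrite ler_pdivlMr// mul1r.
Qed.

End analytic.
End exceedance.

(** * Atoms under the local time are points of the chain *)
Lemma le_counting (R : realType) (T U : choiceType) (A : set T) (B : set U) :
  (A #<= B)%card -> (counting A <= counting B :> \bar R)%E.
Proof.
move=> AB; rewrite /counting; case: (asboolP (finite_set B)) => [fB|_]; last by rewrite leey.
have fA := card_le_finite AB fB; rewrite asboolT//.
have /finite_setP[n An] := fA; have /finite_setP[m Bm] := fB.
rewrite (card_fset_set An) (card_fset_set Bm) lee_fin ler_nat -card_le_II.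
by rewrite -(card_le_eql An) -(card_le_eqr Bm).
Qed.

Section pathwise.
Context {R : realType} {T : choiceType}.
Variables (g : T -> T -> R) (z0 Delta : T) (X : nat -> T * R).
Hypotheses (g_ge0 : forall z z', 0 <= g z z')
  (X_inj : forall i j, i <> j -> X i <> X j).

Let E := range X.
Let st n := slt g E z0 n.

(** Almost surely satisfied, by [ae_above]. *)
Hypothesis used_below : forall n j, (X j).2 <= slt_fun (st n.+1) (X j).1 ->
  slt_used (st n.+1) (X j).

Lemma slt_used_point n p : slt_used (st n) p ->
  exists k, [/\ (0 < k)%N, (k <= n)%N & p = slt_point (st k)].
Proof.
elim: n => [[]|n IH]; rewrite {1}/st /slt iterS => -[pE|/IH[k [k0 kn pk]]].
  by exists n.+1.
by exists k; split=> //; exact: leqW.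
Qed.

Lemma soft_local_time_ge0 n z : 0 <= soft_local_time g E z0 n z.
Proof.
elim: n => [|n IH]; first by rewrite /soft_local_time.
by rewrite soft_local_timeS addr_ge0// mulr_ge0// slt_gap_ge0.
Qed.

(** Each increment is a multiple of some g(z_k, .), and g(z_k, x) is at least a
    times g(z_k, zhat). *)
Lemma soft_local_time_min_ratio (Gamma : set T) zhat a n x : Gamma x ->
  min_ratio g zhat Gamma = a%:E ->
  a * soft_local_time g E z0 n zhat <= soft_local_time g E z0 n x.
Proof.
move=> Gx aE; elim: n => [|n IH]; first by rewrite /soft_local_time/= mulr0.
rewrite !soft_local_timeS mulrDr lerD// mulrCA ler_wpM2l ?slt_gap_ge0//.
set z := slt_chain _ _ _ _; have [g0|g0] := ltP 0 (g z zhat); last first.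
  have -> : g z zhat = 0 by apply/eqP; rewrite eq_le g0 g_ge0.
  by rewrite mulr0.
rewrite -ler_pdivlMr// -lee_fin -aE; apply: ereal_inf_lbound.
by exists z, x.
Qed.

(** The infimum defining alpha is then over an empty set: g(., zhat) vanishes. *)
Lemma soft_local_time_no_ratio (Gamma : set T) zhat n x : Gamma x ->
  min_ratio g zhat Gamma = +oo%E -> soft_local_time g E z0 n zhat = 0.
Proof.
move=> Gx aE; elim: n => [//|n IH].
rewrite soft_local_timeS IH add0r; set z := slt_chain _ _ _ _.
have [g0|g0] := ltP 0 (g z zhat); last first.
  have -> : g z zhat = 0 by apply/eqP; rewrite eq_le g0 g_ge0.
  by rewrite mulr0.
have : (min_ratio g zhat Gamma <= (g z x / g z zhat)%:E)%E.
  by apply: ereal_inf_lbound; exists z, x.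
by rewrite aE leye_eq.
Qed.

Lemma min_ratio_ge0 (Gamma : set T) zhat : (0 <= min_ratio g zhat Gamma)%E.
Proof.
apply: le_ereal_inf_tmp => _ [z [x [_ g0 ->]]].
by rewrite lee_fin divr_ge0// ltW.
Qed.

(** The atoms of the strip lie under the graph of G at the stopped time, so each
    of them is the point of the chain at some time k; different atoms have
    different k. At least one step is needed, since at time 0 the atoms of
    height 0 are still unused. *)
Lemma strip_le_visits (Gamma : set T) zhat N (u : R) : 0 <= u ->
  u <= stopped_local_time g E z0 Delta N.+1 zhat ->
  (counting [set j | Gamma (X j).1 /\ (0 <= (X j).2)%R /\
     ((X j).2%:E <= u%:E * min_ratio g zhat Gamma)%E] <=
   visits g E z0 Delta Gamma :> \bar R)%E.
Proof.
move=> u0; rewrite stopped_local_timeE.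
set m := (X in soft_local_time _ _ _ X _) => um.
have [m' mE] : exists m', m = m'.+1.
  rewrite /m; case ht : hitting_time => [t|]; last by exists N.
  move: ht; rewrite /hitting_time; case: pselect => // h [].
  case: ex_minnP => t' /andP[t0 _] _ tE; exists (minn N t'.-1).
  by rewrite -tE -minnSS prednK.
have until k : (k < m)%N -> ~~ hit_by g E z0 Delta k.
  rewrite hit_by_hitting_time /m; case: hitting_time => [t|_ //].
  by rewrite leq_min => /andP[_]; rewrite ltnNge.
set D := mkset _.
have pos j : D j -> exists k, [/\ (0 < k)%N, (k <= m)%N & X j = slt_point (st k)].
  move=> [Gj [_ le]]; apply: slt_used_point; rewrite mE; apply: used_below.
  rewrite -mE -/(soft_local_time g E z0 m (X j).1).
  have := min_ratio_ge0 Gamma zhat; case aE : (min_ratio g zhat Gamma) => [a| |] // a0.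
    apply: le_trans (soft_local_time_min_ratio m Gj aE).
    move: le; rewrite aE -EFinM lee_fin => /le_trans; apply.
    by rewrite mulrC ler_wpM2l.
  have uE : u = 0.
    by apply/eqP; rewrite eq_le u0 andbT -(soft_local_time_no_ratio m Gj aE).
  move: le; rewrite aE uE mul0e lee_fin => /le_trans; apply.
  exact: soft_local_time_ge0.
have ex j : exists k, D j -> [/\ (0 < k)%N, (k <= m)%N & X j = slt_point (st k)].
  by have [/pos[k ?]|?] := pselect (D j); [exists k|exists 0%N].
have [f hf] := choice ex.
have finj : {in D &, injective f}.
  move=> i j; rewrite !inE => /hf[_ _ Xi] /hf[_ _ Xj] fij.
  by apply: contrapT => /X_inj; apply; rewrite Xi Xj fij.
rewrite visitsE; apply: le_counting.
rewrite -(card_le_eql (inj_card_eq finj)); apply: subset_card_le => _ [j Dj <-].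
have [f0 fm Xj] := hf j Dj; split=> //; split; first by apply: until; rewrite prednK.
by case: Dj => + _; rewrite Xj.
Qed.

End pathwise.

(** * The tail of the local time at Delta *)
Section tail.
Local Open Scope ereal_scope.
Context {R : realType} {S : completePMetricType R}.
Hypothesis S_separable : separable S.
Context {d} {Omega : measurableType d}.
Variables (mu : {sigma_finite_measure set (borel S) -> \bar R}) (g : S -> S -> R).
Hypotheses (g_ge0 : forall z z', (0 <= g z z')%R)
  (g_measurable : measurable_fun [set: borel S * borel S]
    (fun p : borel S * borel S => g p.1 p.2))
  (g_density : forall z, \int[mu]_(z' in [set: borel S]) (g z z')%:E = 1).
Variables (Delta zhat : S).
Variables (Q : probability Omega R) (X : nat -> Omega -> borel S * R).
Hypotheses (X_ge0 : forall i w, (0 <= (X i w).2)%R)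
  (X_poisson : poisson_point_process Q (intensity mu) X).

Let gb : borel S -> borel S -> R := g.
Let atoms w : set (S * R) := range (X ^~ w).
Let stopped z n w := stopped_local_time g (atoms w) z Delta n zhat.

Let mX i : measurable_fun setT (X i). Proof. by case: X_poisson. Qed.

(** [integral_step] trades one step of the construction for one level of the
    recursion. *)
Lemma integral_exceed z s k n :
  \int[Q]_w exceed mu g Delta zhat k (progress_at g Delta zhat X z s n w) =
  exceed mu g Delta zhat (k + n) (z : borel S, s, false).
Proof.
elim: n k => [|n IH] k.
  rewrite addn0 (eq_integral (cst (exceed mu g Delta zhat k (z : borel S, s, false)))).
    by rewrite integral_cst//= -[RHS]mule1; congr (_ * _); exact: probability_setT.
  by move=> w _; rewrite /progress_at/= subr0.
have [F [kappa diss]] := dissecting_intensity S_separable mu.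
have mz : measurable_fun setT (@current R S) by exact: measurableT_comp.
have pg m := poisson_given_slt S_separable g_ge0 g_measurable g_density Delta zhat
  X_ge0 X_poisson z s m.
rewrite (@integral_step _ _ _ _ _ _ _ _ _ mu gb g_ge0 g_measurable g_density
  Q F kappa diss _ _ (pg n) (@current R S) mz _ (remaining g X z n.+1)
  (next_progress g Delta zhat)).
- by rewrite addnS -addSn -IH.
- by have [] := pg n.+1.
- by have [] := pg n.+1.
- exact: measurable_next_progress.
- by move=> i w; exact: first_progress.
- by move=> i j w fi ji a; exact: (first_remaining g_ge0 fi ji a).
- by move=> i j w fi h; exact: (first_dead g_ge0 fi h).
- exact: measurable_exceed.
- by move=> y; exact: exceed_ge0.
Qed.

Let mstopped z n (s : R) : measurable [set w | (s <= stopped z n w)%R].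
Proof.
rewrite -[X in measurable X]setTI; apply: measurable_fun_ler => //.
exact: measurable_stopped_local_time.
Qed.

Lemma stopped_local_time_tail z n s :
  Q [set w | (s <= stopped z n w)%R] = exceed mu g Delta zhat n (z : borel S, s, false).
Proof.
rewrite -[n in RHS]add0n -integral_exceed /= -[LHS]mul1e.
rewrite -[in LHS](setIT [set w | _]) -integral_indic// mul1e.
apply: eq_integral => w _; congr (_%:E); rewrite !indicE; congr (_%:R).
by congr nat_of_bool; apply/idP/idP; rewrite !inE/= subr_le0.
Qed.

Section bound.
Variables (Gamma : set (borel S)).
Hypothesis Gamma_measurable : measurable Gamma.
Variables (l v : R).
Hypotheses (l_ge0 : (0 <= l)%R) (g_le : forall z, (g z zhat <= l)%R) (v_ge2 : (2 <= v)%R).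

Let strip : set (borel S * R) :=
    [set p | Gamma p.1 /\ (0 <= p.2)%R /\
             p.2%:E <= (2^-1 * v * l)%:E * min_ratio g zhat Gamma].

Let sparse z := [set w | point_measure (X ^~ w) strip <=
  visits g (atoms w) z Delta Gamma :> \bar R].

Let mstrip : measurable strip.
Proof.
rewrite (_ : strip = (fun p : borel S * R => p.1) @^-1` Gamma `&`
  ([set p | (0 <= p.2)%R] `&`
   [set p | p.2%:E <= (2^-1 * v * l)%:E * min_ratio g zhat Gamma]))//.
apply: measurableI; first by rewrite -[X in measurable X]setTI; exact: measurable_fst.
apply: measurableI.
  by rewrite -[X in measurable X]setTI; exact: measurable_fun_ler.
rewrite -[X in measurable X]setTI; apply: measurable_fun_lee => //.
exact/measurable_EFinP.
Qed.

Let msparse z : measurable (sparse z).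
Proof.
rewrite -[X in measurable X]setTI; apply: measurable_fun_lee => //.
  apply: (@measurable_how_many R _ _ (fun i => X i @^-1` strip)) => i.
  by rewrite -[X in measurable X]setTI; exact: mX.
exact: measurable_visits.
Qed.

Let vl_ge0 : (0 <= 2^-1 * v * l)%R.
Proof. by rewrite !mulr_ge0// (le_trans _ v_ge2). Qed.

(** The hypotheses of [strip_le_visits] hold almost surely, by
    [poisson_ae_distinct] and [ae_above]. *)
Lemma sparse_of_stopped z n :
  Q [set w | (2^-1 * v * l <= stopped z n.+1 w)%R] <= Q (sparse z).
Proof.
have [F [kappa diss]] := dissecting_intensity S_separable mu.
have dist := poisson_ae_distinct diss X_poisson.
have below := ae_above S_separable g_ge0 g_measurable g_density Delta zhat
  X_ge0 X_poisson z 0%R.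
have [N [mN QN NP]] := filterI dist below.
rewrite -[leRHS]addr0 -QN; apply: (@le_trans _ _ (Q (sparse z `|` N))); last first.
  exact: measureU2.
apply: le_measure; rewrite ?inE//; first exact: measurableU.
move=> w le; have [?|wN] := pselect (N w); [by right|left].
have [dw bw] : (forall i j : nat, i <> j -> alive (X i w) -> X i w <> X j w) /\
   (forall n0 j, ~ slt_used (slt g (atoms w) z n0.+1) (X j w) ->
     (slt_fun (slt g (atoms w) z n0.+1) (X j w).1 < (X j w).2)%R).
  by apply: contrapT => h; exact: wN (NP _ h).
rewrite /sparse/= (_ : point_measure _ _ = counting [set j | strip (X j w)]).
  apply: (@strip_le_visits R S g z Delta (X ^~ w) g_ge0 _ _ Gamma zhat n _ vl_ge0 le).
  - by move=> i j ij; apply: dw => //; exact: X_ge0.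
  - by move=> m j lej; apply: contrapT => /bw; rewrite ltNge lej.
rewrite counting_dirac /point_measure /mseries; apply: eq_eseriesr => j _.
by rewrite !diracE; congr (_%:R%:E); congr nat_of_bool; apply/idP/idP; rewrite !inE.
Qed.

Let c : \bar R := ereal_sup [set Q (sparse z) | z in [set: S]].

Let sparse_le z : Q (sparse z) <= c.
Proof. by apply: ereal_sup_ubound; exists z. Qed.

Let c_ge0 : 0 <= c.
Proof. by apply: le_trans (sparse_le zhat). Qed.

Let c_le1 : c <= 1.
Proof. by apply: ge_ereal_sup => _ [z _ <-]; exact: probability_le1. Qed.

Let G z w := soft_local_time_hit g (atoms w) z Delta zhat.

Let mG z (s : \bar R) : measurable [set w | s <= G z w].
Proof.
rewrite -[X in measurable X]setTI; apply: measurable_fun_lee => //.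
exact: measurable_soft_local_time_hit.
Qed.

Let stopped_le_G z n w : (stopped z n w)%:E <= G z w.
Proof.
by rewrite /G soft_local_time_hitE//; apply: ereal_sup_ubound; exists n.
Qed.

Let K := (expR (- (v / 2 - 1)))%:E + c.

Let exceed_le_c k z x b : (0 < l)%R -> (v / 2 * l <= x)%R ->
  exceed mu g Delta zhat k (z, x, b) <= c.
Proof.
move=> l0 vx; have x0 : (0 < x)%R.
  by apply: lt_le_trans vx; rewrite mulr_gt0// divr_gt0// (lt_le_trans _ v_ge2).
case: b; first by rewrite exceed_hit.
rewrite -stopped_local_time_tail; case: k => [|k].
  by rewrite (_ : mkset _ = set0) ?measure0//; apply/seteqP; split=> // w; rewrite /= leNgt x0.
apply: le_trans (sparse_le z); apply: le_trans (sparse_of_stopped z k).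
apply: le_measure; rewrite ?inE// => w /=; apply: le_trans.
by rewrite (mulrC 2^-1%R).
Qed.

(** Passing from h to h + (v - 1) l costs the factor K. The strict inequality
    h < l leaves room for G, a supremum, to exceed h + (v - 1) l after finitely
    many steps. *)
Let local_time_tail_lt z (h : R) : (0 < h)%R -> (h < l)%R ->
  Q [set w | (v * l)%:E <= G z w] <= K * Q [set w | h%:E <= G z w].
Proof.
move=> h0 hl; have l0 := lt_trans h0 hl.
pose A n := [set w | (h + (v - 1) * l <= stopped z n w)%R].
have mA n : measurable (A n) by exact: mstopped.
have ndA : nondecreasing_seq A.
  move=> m n mn; apply/subsetPset => w /= /le_trans; apply.
  exact: nondecreasing_stopped_local_time.
have mUA : measurable (\bigcup_n A n) by exact: bigcupT_measurable.
apply: (@le_trans _ _ (Q (\bigcup_n A n))).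
  apply: le_measure; rewrite ?inE// => w /=.
  rewrite /G soft_local_time_hitE// => vG.
  have : ((h + (v - 1) * l)%:E < (v * l)%:E) by rewrite lte_fin; move: hl; lra.
  move=> /lt_le_trans/(_ vG)/ereal_sup_gt[_ [n _ <-]]; rewrite lte_fin => /ltW ?.
  by exists n.
have cv := nondecreasing_cvg_mu (mu := Q) mA mUA ndA.
rewrite -(cvg_lim _ cv)//; apply: lime_le; first by apply/cvg_ex; eexists; exact: cv.
apply: nearW => n /=; rewrite /A stopped_local_time_tail.
have contract : exceed mu g Delta zhat n (z : borel S, (h + (v - 1) * l)%R, false) <=
    K * exceed mu g Delta zhat n (z : borel S, h, false).
  apply: exceed_contract => // k x u b; exact: exceed_le_c.
apply: (le_trans contract).
rewrite lee_wpmul2l//; first by rewrite adde_ge0// lee_fin expR_ge0.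
rewrite -stopped_local_time_tail; apply: le_measure; rewrite ?inE// => w /= hs.
by apply: le_trans (stopped_le_G z n w); rewrite lee_fin.
Qed.

(** Let h increase to l. If l = 0 there is no such h; the strip then reduces to
    height at most 0 and is always exhausted after one step, so that c = 1. *)
Theorem local_time_tail z :
  Q [set w | (v * l)%:E <= G z w] <= Q [set w | l%:E <= G z w] * K.
Proof.
have [l0|l0] := ltP 0%R l; last first.
  have -> : l = 0%R by apply/eqP; rewrite eq_le l0 l_ge0.
  rewrite mulr0 -[leLHS]mule1 lee_wpmul2l//.
  apply: (@le_trans _ _ c); last by rewrite leeDr// lee_fin expR_ge0.
  apply: le_trans (sparse_le z); apply: le_trans (sparse_of_stopped z 0%N).
  rewrite (_ : mkset _ = setT) ?probability_setT//; apply/seteqP; split=> // w _ /=.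
  have -> : (2^-1 * v * l = 0)%R by apply/eqP; rewrite mulf_eq0; apply/orP; right; rewrite eq_le l0 l_ge0.
  apply: (@le_trans _ _ (stopped z 0%N w)) => //.
  exact: nondecreasing_stopped_local_time.
pose h (n : nat) : R := (l - l / n.+2%:R)%R.
have h_gt0 n : (0 < h n)%R.
  by rewrite subr_gt0 ltr_pdivrMr// ltr_pMr// ltr1n.
have h_lt n : (h n < l)%R by rewrite gtrBl divr_gt0.
pose B n := [set w | (h n)%:E <= G z w].
have niB : nonincreasing_seq B.
  move=> m n mn; apply/subsetPset => w /=; apply: le_trans.
  by rewrite lee_fin lerD2l lerN2 ler_pM2l// lef_pV2 ?posrE// ler_nat.
have capB : \bigcap_n B n = [set w | l%:E <= G z w].
  apply/seteqP; split=> w.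
    move=> Bw /=; apply/lee_subgt0Pr => e e0.
    have := Bw (Num.truncn (l / e)) I; apply: le_trans; rewrite -EFinB lee_fin.
    rewrite lerD2l lerN2 ler_pdivrMr// mulrC -ler_pdivrMr//.
    by apply: ltW; apply: lt_le_trans (truncnS_gt _) _; rewrite ler_nat.
  by move=> /= lG n _; apply: le_trans lG; rewrite lee_fin ltW.
have cv : Q (B n) @[n --> \oo] --> Q [set w | l%:E <= G z w].
  rewrite -capB; apply: nonincreasing_cvg_mu => //.
  - exact: le_lt_trans (probability_le1 Q (mG z _)) (ltry _).
  - by move=> n; exact: mG.
  - by rewrite capB; exact: mG.
have Kfin : K \is a fin_num.
  by rewrite /K fin_numD/= ge0_fin_numE// (le_lt_trans c_le1) ?ltry.
rewrite muleC.
have cvK := cvgeZl Kfin cv.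
rewrite -(cvg_lim _ cvK)//; apply: lime_ge; first by apply/cvg_ex; eexists; exact: cvK.
by apply: nearW => n; exact: local_time_tail_lt.
Qed.

End bound.
End tail.

Section sigma_finite_structure.
Context {d} {T : measurableType d} {R : realType}.
Variables (mu : {measure set T -> \bar R}) (mu_sf : sigma_finite setT mu).

(** A copy of mu that remembers the proof, so that the structure of
    sigma-finite measure can be attached to it. *)
Definition with_sigma_finite of sigma_finite setT mu : set T -> \bar R := mu.

Local Notation mu' := (with_sigma_finite mu_sf).

HB.instance Definition _ := Measure.copy mu' mu.

HB.instance Definition _ := Measure_isSigmaFinite.Build _ _ _ mu' mu_sf.

End sigma_finite_structure.

Theorem theorem4p9 (R : realType)
  (S : completePMetricType R)
  (S_separable : separable S)
  (S_locally_compact : locally_compact [set: S])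
  (mu : {measure set (borel S) -> \bar R})
  (mu_radon : radon mu)
  (g : S -> S -> R)
  (g_ge0 : forall z z', 0 <= g z z')
  (g_measurable : measurable_fun [set: borel S * borel S]
    (fun p : borel S * borel S => g p.1 p.2))
  (g_density : forall z,
    (\int[mu]_(z' in [set: borel S]) (g z z')%:E = 1)%E)
  (Delta : S)
  (mu_Delta : mu [set Delta] = 1%E)
  (g_Delta : forall z, g Delta z = \1_[set Delta] z)
  (d : measure_display) (Omega : measurableType d)
  (Q : probability Omega R)
  (X : nat -> Omega -> borel S * R)
  (X_ge0 : forall i w, 0 <= (X i w).2)
  (X_poisson : poisson_point_process Q (slt_intensity mu) X)
  (Z0 zhat : S)
  (Gamma : set (borel S)) (Gamma_measurable : measurable Gamma)
  (l : R)
  (l_sup : (ereal_sup [set (g z' zhat)%:E | z' in [set: S]] <= l%:E)%E)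
  (v : R) (v_ge2 : 2 <= v) :
  let eta w : set (borel S * R) -> \bar R := point_measure (X ^~ w) in
  let atoms w : set (S * R) := range (X ^~ w) in
  let G z0 w : \bar R := soft_local_time_hit g (atoms w) z0 Delta zhat in
  let N z0 w : \bar R := visits g (atoms w) z0 Delta Gamma in
  let alpha := min_ratio g zhat Gamma in
  let strip : set (borel S * R) :=
    [set p | Gamma p.1 /\ 0 <= p.2 /\
             (p.2%:E <= (2^-1 * v * l)%:E * alpha)%E] in
  (Q [set w | (v * l)%:E <= G Z0 w]%E <=
   Q [set w | l%:E <= G Z0 w]%E *
   ((expR (- (v / 2 - 1)))%:E +
    ereal_sup [set Q [set w | eta w strip <= N z' w]%E | z' in [set: S]]))%E.
Proof.
have sf := radon_sigma_finite S_separable S_locally_compact mu_radon.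
pose mu' : {sigma_finite_measure set (borel S) -> \bar R} := with_sigma_finite sf.
have g_le z : g z zhat <= l.
  rewrite -lee_fin; apply: le_trans l_sup; apply: ereal_sup_ubound; by exists z.
have l_ge0 : 0 <= l := le_trans (g_ge0 zhat zhat) (g_le zhat).
exact: (@local_time_tail R S S_separable _ Omega mu' g g_ge0 g_measurable g_density
  Delta zhat Q X X_ge0 X_poisson Gamma Gamma_measurable l v l_ge0 g_le v_ge2 Z0).
Qed.
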